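(* The diamond-free editing problem, parameterized by $k$, admits a kernel with $O(k^8)$ vertices: there is a polynomial-time algorithm that, given an instance $(G,k)$, outputs an instance $(G',k')$ with $k'\le k$ and $|V(G')| = O(k^8)$ such that $(G,k)$ is a yes-instance if and only if $(G',k')$ is a yes-instance.
   Context: Graphs are finite, simple and undirected. A diamond is the graph obtained from $K_4$ by deleting one edge; a graph is diamond-free if no four of its vertices induce a diamond. The diamond-free editing problem: given a graph $G$ and an integer $k\ge 0$, decide whether there exist a set $E_+$ of non-edges of $G$ and a set $E_-$ of edges of $G$ with $|E_+\cup E_-|\le k$ such that the graph with vertex set $V(G)$ and edge set $(E(G)\cup E_+)\setminus E_-$ is diamond-free. $(G,k)$ is a yes-instance if such sets exist. *)

(* Defs.v *)
From mathcomp Require Export all_boot.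

Set Implicit Arguments.
Unset Strict Implicit.
Unset Printing Implicit Defensive.

(* A graph on the vertex set T is given by its edge set, a set of 2-subsets
   of T. *)
Definition pairs (T : finType) : {set {set T}} := [set e : {set T} | #|e| == 2].

Definition simple_graph (T : finType) (E : {set {set T}}) : bool :=
  E \subset pairs T.

Definition adj (T : finType) (E : {set {set T}}) (x y : T) : bool :=
  [set x; y] \in E.

(* K_4 on {0, 1, 2, 3} with the edge {0, 1} deleted. *)
Definition diamond : {set {set 'I_4}} :=
  pairs 'I_4 :\ [set inord 0; inord 1].

Definition diamond_free (T : finType) (E : {set {set T}}) : Prop :=
  ~ exists f : 'I_4 -> T,
      injective f /\ forall i j : 'I_4, adj E (f i) (f j) = adj diamond i j.

(* The vertex set of an instance is {0, ..., nverts - 1}, as is usual for the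
   input of an algorithm. *)
Record instance := Instance {
  nverts : nat;
  edges : {set {set 'I_nverts}};
  edges_simple : simple_graph edges;
  budget : nat
}.

Definition yes_instance (I : instance) : Prop :=
  exists Ep Em : {set {set 'I_(nverts I)}},
    [/\ Ep \subset pairs 'I_(nverts I) :\: edges I,
        Em \subset edges I,
        #|Ep :|: Em| <= budget I &
        diamond_free ((edges I :|: Ep) :\: Em)].

(* The machine model is a random access machine with structured control and
   finitely many (those named in the program) unbounded arrays of natural
   numbers; a scalar variable is cell 0 of an array. The only arithmetic
   operations are addition and truncated subtraction, so that each operation
   lengthens the largest number in memory by at most one bit, and unit cost is
   polynomially equivalent to Turing machine time (Cook and Reckhow). *)
Inductive expr :=
  | Const of nat
  | Read of nat & expr
  | Add of expr & expr
  | Sub of expr & expr.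

Inductive cmd :=
  | Skip
  | Write of nat & expr & expr
  | Seq of cmd & cmd
  | If of expr & cmd & cmd
  | While of expr & cmd.

Definition state := nat -> nat -> nat.

Fixpoint eval (s : state) (e : expr) : nat :=
  match e with
  | Const n => n
  | Read a i => s a (eval s i)
  | Add e1 e2 => eval s e1 + eval s e2
  | Sub e1 e2 => eval s e1 - eval s e2
  end.

Fixpoint cost (e : expr) : nat :=
  match e with
  | Const _ => 1
  | Read _ i => (cost i).+1
  | Add e1 e2 | Sub e1 e2 => (cost e1 + cost e2).+1
  end.

Definition update (s : state) (a i v : nat) : state :=
  fun b j => if (b == a) && (j == i) then v else s b j.

(* exec c s t s' : started in s, the program c halts in s' after time t. *)
Inductive exec : cmd -> state -> nat -> state -> Prop :=
  | exec_skip s : exec Skip s 1 s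
  | exec_write s a i e :
      exec (Write a i e) s (cost i + cost e).+1
        (update s a (eval s i) (eval s e))
  | exec_seq s s1 s2 c1 c2 t1 t2 :
      exec c1 s t1 s1 -> exec c2 s1 t2 s2 ->
      exec (Seq c1 c2) s (t1 + t2) s2
  | exec_if_true s s1 e c1 c2 t :
      eval s e != 0 -> exec c1 s t s1 ->
      exec (If e c1 c2) s (cost e + t).+1 s1
  | exec_if_false s s1 e c1 c2 t :
      eval s e = 0 -> exec c2 s t s1 ->
      exec (If e c1 c2) s (cost e + t).+1 s1
  | exec_while_true s s1 s2 e c t1 t2 :
      eval s e != 0 -> exec c s t1 s1 -> exec (While e c) s1 t2 s2 ->
      exec (While e c) s (cost e + t1 + t2).+1 s2
  | exec_while_false s e c :
      eval s e = 0 -> exec (While e c) s (cost e).+1 s.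

(* An instance is stored with its number of vertices in array 0, its budget in
   array 1 and its adjacency matrix, row by row, in array 2. *)
Definition input (I : instance) : state := fun a i =>
  match a with
  | 0 => if i == 0 then nverts I else 0
  | 1 => if i == 0 then budget I else 0
  | 2 => [exists x : 'I_(nverts I), exists y : 'I_(nverts I),
            (i == x * nverts I + y) && adj (edges I) x y]
  | _ => 0
  end.

Definition output (s : state) (I : instance) : Prop :=
  [/\ s 0 0 = nverts I,
      s 1 0 = budget I &
      forall x y : 'I_(nverts I),
        s 2 (x * nverts I + y) = adj (edges I) x y :> nat].

(* The bits of the adjacency matrix together with those of the budget, written
   in binary. *)
Definition instance_size (I : instance) : nat :=
  nverts I * nverts I + (trunc_log 2 (budget I)).+1.

Definition poly_time (F : instance -> instance) : Prop :=
  exists (P : cmd) (c : nat), forall I : instance,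
    exists (t : nat) (s : state),
      [/\ exec P (input I) t s,
          output s (F I) &
          t <= c * instance_size I ^ c].

Definition big_O (f g : nat -> nat) : Prop :=
  exists C N : nat, forall k : nat, N <= k -> f k <= C * g k.

(* Main.v *)
Require Import Defs.
From mathcomp Require Import all_boot.
From mathcomp Require Import zify.
From Stdlib Require Import Classical IndefiniteDescription.

Set Implicit Arguments.
Unset Strict Implicit.
Unset Printing Implicit Defensive.

(** Diamond-freeness is hereditary, so it suffices to find a small vertex set W
    such that a solution of size at most k for G[W] yields one for G.

    Preparation.  If more than k diamonds pairwise share exactly the pair uv,
    then uv is edited in every solution, and we edit it.  Afterwards every
    edited pair has fewer than 4k+4 common neighbours: two of them avoided by
    the solution and by the diamonds through the pair would span a diamond with
    it.  A maximal packing of pair-disjoint diamonds has at most k members (else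
    the answer is no); together with the maximal flowers at the packed pairs it
    gives O(k^2) triples such that each diamond consists of one of them and a
    fourth vertex.  The core Y collects these triples and up to L = 6k+6 fourth
    vertices for each, so |Y| = O(k^3).  Finally W adds to Y up to L common
    neighbours b of each pair x, a in Y, and up to L common neighbours of each
    such a, b; hence |W| = O(k^8).

    Correctness.  Let h be a minimum solution of G[W].  In a diamond-free graph
    a vertex outside a maximal clique has at most one neighbour in it, so
    the inside of such a clique can be replaced by any diamond-free graph.
    This shows that added edges join vertices of Y (otherwise cutting a small
    clique off the maximal clique of h through the edge is cheaper) and that
    deleted edges lie in cliques of G that are represented in W (otherwise
    restoring the clique is cheaper).  So all common neighbours of an edited
    pair lie in W, and then the edits create no diamond outside W.

    Running time.  The algorithm is written in a language whose only loops run
    over the n vertices, so that its running time is polynomial in n by the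
    nesting depth alone. *)

(** * Diamonds and edits *)

(** Edits are recorded as ordered pairs, so a budget k appears as [2 * k], and at most 2k vertices
    are touched. A solution of G[W] is handled as a graph on all vertices that agrees with G outside
    W, so the combinatorial argument never changes the vertex type.

    The constants come from one count. A hitting set for the diamonds through a pair has at most
    2k+2 vertices: k petals of two vertices each, and the pair itself. With 2k touched vertices and
    one chosen common neighbour this makes 4k+3, whence 4k+4. L = 6k+6 still leaves 4k+4 after the
    loss of 2k touched vertices or of the two ends of an edge.

    The obstacle is that restoring a clique fails in two ways: two of its vertices lie in Y, or an
    added edge xa gives an outside vertex x a second neighbour b in the clique. In the second case x
    and a lie in Y, but b need not. Hence W is closed in two layers, under common neighbours b of
    pairs x, a in Y and then under those of the pairs a, b; this costs |Y|^2 times O(k^2). *)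

Section Diamonds.
Variable T : finType.
Implicit Types (e h : rel T) (u v c d x y a b : T) (W M : {set T}).

Definition sgraph e := symmetric e /\ irreflexive e.

(* The four vertices induce a diamond, in a form that is invariant under their
   permutations; [dia] also fixes which pair is the missing edge. *)
Definition d4 e u v c d :=
  uniq [:: u; v; c; d] &&
  (e u v + e u c + e u d + e v c + e v d + e c d == 5).

Definition dia e x y a b :=
  [&& x != y, ~~ e x y, e x a, e x b, e y a, e y b & e a b].

Lemma d4_swap12 e u v c d : symmetric e -> d4 e u v c d = d4 e v u c d.
Proof.
move=> es; rewrite /d4 (es v u); congr (_ && _).
  by apply: perm_uniq; rewrite (perm_catCA [:: u] [:: v]).
by congr (_ == _); lia.
Qed.

Lemma d4_swap34 e u v c d : symmetric e -> d4 e u v c d = d4 e u v d c.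
Proof.
move=> es; rewrite /d4 (es d c); congr (_ && _).
  by apply: perm_uniq; rewrite !perm_cons (perm_catCA [:: c] [:: d]).
by congr (_ == _); lia.
Qed.

Lemma d4_swap23 e u v c d : symmetric e -> d4 e u v c d = d4 e u c v d.
Proof.
move=> es; rewrite /d4 (es c v); congr (_ && _).
  by apply: perm_uniq; rewrite !perm_cons (perm_catCA [:: v] [:: c]).
by congr (_ == _); lia.
Qed.

Lemma d4E e u v c d : sgraph e ->
  d4 e u v c d = [|| dia e u v c d, dia e u c v d, dia e u d v c,
                     dia e v c u d, dia e v d u c | dia e c d u v].
Proof.
case=> es ei; rewrite /d4 /dia /= !inE !negb_or.
rewrite (es c v) (es d v) (es d c) (es v u) (es c u) (es d u).
have dst x y : e x y -> x != y.
  by apply: contraTneq => ->; rewrite ei.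
move: (dst u v) (dst u c) (dst u d) (dst v c) (dst v d) (dst c d).
by case: (e u v); case: (e u c); case: (e u d); case: (e v c); case: (e v d);
   case: (e c d) => /= h1 h2 h3 h4 h5 h6; rewrite -?plusE /= ?andbF ?andbT ?orbF //;
   try rewrite (h1 isT); try rewrite (h2 isT); try rewrite (h3 isT);
   try rewrite (h4 isT); try rewrite (h5 isT); try rewrite (h6 isT);
   rewrite ?andbT.
Qed.

Lemma dia_d4 e x y a b : sgraph e -> dia e x y a b -> d4 e x y a b.
Proof. by move=> es dxy; rewrite d4E // dxy. Qed.

Definition dfree_on W e := forall u v c d,
  u \in W -> v \in W -> c \in W -> d \in W -> ~~ d4 e u v c d.

Lemma dfree_onP W e : sgraph e ->
  (forall x y a b, x \in W -> y \in W -> a \in W -> b \in W -> ~~ dia e x y a b) ->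
  dfree_on W e.
Proof. by move=> es H u v c d *; rewrite d4E // !negb_or !H. Qed.

(** Ordered pairs: each edited pair counts twice, which is why budgets read [2 * k] below. *)
Definition edits e h : {set T * T} := [set p | e p.1 p.2 != h p.1 p.2].

Lemma in_edits e h x y : ((x, y) \in edits e h) = (e x y != h x y).
Proof. by rewrite inE. Qed.

Lemma edits_sym e h x y : symmetric e -> symmetric h ->
  ((x, y) \in edits e h) = ((y, x) \in edits e h).
Proof. by move=> es hs; rewrite !inE /= es hs. Qed.

Definition touched e h : {set T} := [set p.1 | p in edits e h].

Lemma card_touched e h : #|touched e h| <= #|edits e h|.
Proof. exact: leq_imset_card. Qed.

Lemma untouched e h x y : x \notin touched e h -> h x y = e x y.
Proof.
move=> xn; apply/eqP; rewrite eq_sym; apply: contraNT xn => exy.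
by apply/imsetP; exists (x, y); rewrite ?inE.
Qed.

Definition cnbr e x y : {set T} := [set z | e x z && e y z].

Lemma exists_notin (A B : {set T}) : #|B| < #|A| -> exists2 x, x \in A & x \notin B.
Proof.
move=> lt; apply/exists_inP; rewrite -negb_forall_in; apply/negP => /forall_inP H.
have /subset_leq_card : A \subset B by apply/subsetP.
by rewrite leqNgt lt.
Qed.

(** Any two vertices of a diamond have a common neighbour in it, and no vertex outside M has two
    neighbours in M. So a diamond of [h'] that meets M twice lies inside M, where there is none, and
    any other one is already a diamond of [h]. *)
Lemma replace_dfree W M h h' : sgraph h -> sgraph h' -> dfree_on W h ->
  M \subset W ->
  (forall x y, (x \notin M) || (y \notin M) -> h' x y = h x y) ->
  (forall w p q, w \in W -> w \notin M -> p \in M -> q \in M -> h w p -> h w q -> p = q) ->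
  (forall x y a b, x \in M -> y \in M -> a \in M -> b \in M -> ~~ dia h' x y a b) ->
  dfree_on W h'.
Proof.
move=> hs h's hf MW eqM one HM; apply: dfree_onP => // x y a b xW yW aW bW.
have irr' z : h' z z = false by case: h's => _ ->.
have sym' : symmetric h' by case: h's.
apply/negP => D; have := D; rewrite /dia => /and5P [nxy xy' xa xb /and3P [ya yb ab]].
have two w p q : w \in W -> w \notin M -> p \in M -> q \in M -> h' w p -> h' w q -> p = q.
  move=> wW wM pM qM; rewrite !eqM ?wM //; exact: one.
have old : dia h x y a b -> False.
  by move/(dia_d4 hs); apply/negP; exact: hf.
have nab : a <> b by move=> E; rewrite E irr' in ab.
have nyx : x <> y by apply/eqP.
case aM : (a \in M); case bM : (b \in M).
- case xM : (x \in M); last by apply: nab; apply: (two x) => //; rewrite xM.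
  case yM : (y \in M); last by apply: nab; apply: (two y) => //; rewrite yM.
  by move/negP: (HM _ _ _ _ xM yM aM bM); apply.
- have xM : x \notin M.
    by apply/negP => xM; have E := two b a x bW (negbT bM) aM xM; rewrite E ?irr' // sym' in xa.
  have yM : y \notin M.
    by apply/negP => yM; have E := two b a y bW (negbT bM) aM yM; rewrite E ?irr' // sym' in ya.
  by apply: old; move: D; rewrite /dia !eqM ?xM ?yM ?bM ?orbT.
- have xM : x \notin M.
    apply/negP => xM; have E := two a b x aW (negbT aM) bM xM.
    by rewrite E ?irr' // sym' in xb.
  have yM : y \notin M.
    apply/negP => yM; have E := two a b y aW (negbT aM) bM yM.
    by rewrite E ?irr' // sym' in yb.
  by apply: old; move: D; rewrite /dia !eqM ?xM ?yM ?aM ?orbT.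
- apply: old; move: D; rewrite /dia.
  have/orP XY : (x \notin M) || (y \notin M).
    rewrite -negb_and; apply/negP => /andP [xM yM]; apply: nyx.
    by apply: (two a); rewrite ?aM // sym'.
  by rewrite !eqM ?aM ?bM ?orbT //; apply/orP.
Qed.

End Diamonds.

(** * The core theorem *)

Lemma exists_minimizer (A : Type) (P : A -> Prop) (f : A -> nat) :
  (exists a, P a) -> exists2 a, P a & forall b, P b -> f a <= f b.
Proof.
case=> a; have [m] := ubnP (f a); elim: m a => // m IH a am Pa.
case: (classic (exists2 b, P b & f b < f a)) => [[b Pb ba] | H].
  by apply: (IH b) => //; lia.
by exists a => // b Pb; rewrite leqNgt; apply/negP => lt; apply: H; exists b.
Qed.

Section Kernel.
Variables (T : finType) (e : rel T) (k : nat) (Y W : {set T}).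
Implicit Types (h : rel T) (u v c d x y z a b p q : T).

Let L := 6 * k + 6.

Definition flower_bound := forall u v, u != v ->
  exists2 F : {set T}, #|F| <= 2 * k + 2 &
    forall c d, c \notin F -> d \notin F -> ~~ d4 e u v c d.

(** A fourth vertex outside Y is represented by at least L > 2k fourth vertices of the same triple
    in Y, and every solution leaves one of these untouched. *)
Definition diamond_core := forall u v c d, d4 e u v c d -> d \notin Y ->
  [/\ u \in Y, v \in Y, c \in Y & L <= #|[set x in Y | d4 e u v c x]|].

Definition rich x y := (cnbr e x y :\: Y \subset W) \/
  (L <= #|(cnbr e x y :\: Y) :&: W|).

(** The second clause does not ask for [rich a b] once L common neighbours of x and a are kept: then
    xa is edited in no solution, and b only matters for edited xa. *)
Definition core_closed :=
  (forall x a, x \in Y -> a \in Y -> rich x a) /\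
  (forall x a b, x \in Y -> a \in Y -> b \in cnbr e x a :\: Y ->
     (L <= #|(cnbr e x a :\: Y) :&: W|) \/ rich a b).

(** A solution of G[W], extended to all vertices by e. By symmetry both ends of an edited pair lie
    in W. *)
Definition sol h :=
  [/\ sgraph h, dfree_on W h, #|edits e h| <= 2 * k &
      forall x y, e x y != h x y -> x \in W].

Hypothesis eg : sgraph e.
Hypothesis fl : flower_bound.
Hypothesis dc : diamond_core.
Hypothesis YW : Y \subset W.
Hypothesis cc : core_closed.

Let es : symmetric e. Proof. by case: eg. Qed.
Let ei : irreflexive e. Proof. by case: eg. Qed.
Let enq x y : e x y -> x != y.
Proof. by apply: contraTneq => ->; rewrite ei. Qed.

(** * Constraints on an arbitrary solution of G[W] *)

Section Sol.
Variable h : rel T.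
Hypothesis hsol : sol h.

Let hg : sgraph h. Proof. by case: hsol. Qed.
Let hs : symmetric h. Proof. by case: hg. Qed.
Let hi : irreflexive h. Proof. by case: hg. Qed.
Let hf : dfree_on W h. Proof. by case: hsol. Qed.
Let hW x y : e x y != h x y -> x \in W.
Proof. by case: hsol => _ _ _ H; apply: H. Qed.
Let hW2 x y : e x y != h x y -> y \in W.
Proof. by rewrite es hs; apply: hW. Qed.
Let tc : #|touched e h| <= 2 * k.
Proof. by apply: leq_trans (card_touched e h) _; case: hsol. Qed.

Lemma edited_touched x y : e x y != h x y -> x \in touched e h.
Proof. by move=> E; apply/imsetP; exists (x, y) => //; rewrite inE. Qed.

(** The pair uv flips while all other pairs of u, v, c, d keep their status, so one of e and h has
    exactly five edges there, whatever [e c d] is. F, the touched vertices and c exclude at most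
    4k+3 candidates for d. *)
Lemma edited_few_cnbr u v : e u v != h u v -> #|cnbr e u v :&: W| < 4 * k + 4.
Proof.
move=> uv; rewrite ltnNge; apply/negP => big.
have nuv : u != v by apply: contraNneq uv => ->; rewrite ei hi.
have [F cF HF] := fl nuv.
have [c] : exists2 c, c \in cnbr e u v :&: W & c \notin F :|: touched e h.
  apply: exists_notin; move: (leq_card_setU F (touched e h)).1 cF tc big; clear; lia.
rewrite !inE negb_or => /andP [/andP [uc vc] cW] /andP [cF' ct].
have [d] : exists2 d, d \in cnbr e u v :&: W & d \notin c |: (F :|: touched e h).
  apply: exists_notin; move: (leq_card_setU F (touched e h)).1 cF tc big; clear.
  by rewrite cardsU1; case: (c \notin _) => /=; lia.
rewrite !inE !negb_or => /andP [/andP [ud vd] dW] /and3P [dc' dF dt].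
have := HF _ _ cF' dF; have := hf (hW uv) (hW2 uv) cW dW.
rewrite /d4 /= !inE !negb_or nuv !(enq uc, enq ud, enq vc, enq vd) eq_sym dc' /=.
have U := untouched.
rewrite (hs u c) (hs u d) (hs v c) (hs v d) !(U _ _ _ _ _ ct) !(U _ _ _ _ _ dt).
rewrite !(es c u) !(es d u) !(es c v) !(es d v) uc vc ud vd.
by move: uv; case: (e u v); case: (h u v) => //; case: (e c d).
Qed.

(** Some representative x is untouched; if no pair of the triple were edited, u, v, c, x would be a
    diamond of h inside W. *)
Lemma reps_edited u v c d : d4 e u v c d -> d \notin Y ->
  [|| e u v != h u v, e u c != h u c | e v c != h v c].
Proof.
move=> D dY; have [uY vY cY reps] := dc D dY; apply/negPn/negP.
rewrite !negb_or !negbK => /and3P [/eqP uv /eqP uc /eqP vc].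
have [x] : exists2 x, x \in [set x in Y | d4 e u v c x] & x \notin touched e h.
  by apply: exists_notin; apply: leq_trans reps; move: tc; clear; rewrite /L; lia.
rewrite !inE => /andP [xY Dx] xt.
have S := subsetP YW; have := hf (S _ uY) (S _ vY) (S _ cY) (S _ xY).
move: Dx; rewrite /d4 -uv -uc -vc (hs u x) (hs v x) (hs c x) !(untouched _ xt).
by rewrite -(es u x) -(es v x) -(es c x) => ->.
Qed.

End Sol.

(** * Exchange arguments for a minimum solution *)

Section MinSol.
Variable h : rel T.
Hypothesis hsol : sol h.
Hypothesis hmin : forall h', sol h' -> #|edits e h| <= #|edits e h'|.

Let hg : sgraph h. Proof. by case: hsol. Qed.
Let hs : symmetric h. Proof. by case: hg. Qed.
Let hi : irreflexive h. Proof. by case: hg. Qed.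
Let hf : dfree_on W h. Proof. by case: hsol. Qed.
Let hW x y : e x y != h x y -> x \in W.
Proof. by case: hsol => _ _ _ H; apply: H. Qed.
Let hW2 x y : e x y != h x y -> y \in W.
Proof. by rewrite es hs; apply: hW. Qed.
Let hk : #|edits e h| <= 2 * k. Proof. by case: hsol. Qed.
Let hnq x y : h x y -> x != y.
Proof. by apply: contraTneq => ->; rewrite hi. Qed.

(* M is the maximal clique of h through the added edge uv.  If v were outside
   Y, detaching from M the e-clique A of v in M would be cheaper. *)
Lemma added_core_l v u : h v u -> ~~ e v u -> v \in Y.
Proof.
move=> hvu evu; apply/negPn/negP => vY.
have Evu : e v u != h v u by rewrite hvu (negbTE evu).
have [vW uW] := (hW Evu, hW2 Evu).
pose M := [set z in W | ((z == u) || h z u) && ((z == v) || h z v)].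
have uM : u \in M by rewrite inE uW eqxx /= hs hvu orbT.
have vM : v \in M by rewrite inE vW eqxx /= hvu orbT.
have MW : M \subset W by apply/subsetP => z; rewrite inE => /andP [].
have MWs := subsetP MW.
have nod x y a b : x \in W -> y \in W -> a \in W -> b \in W -> dia h x y a b -> False.
  by move=> xW yW aW bW /(dia_d4 hg); apply/negP; apply: hf.
have inM z : z \in M -> z != u -> z != v -> h z u && h z v.
  by rewrite inE => /and3P [_ /orP [->|->] // /orP [->|->]].
have Mcl x y : x \in M -> y \in M -> x != y -> h x y.
  move=> xM yM nxy; have [xW yW] := (MWs _ xM, MWs _ yM).
  case: (eqVneq x u) => [xu|xu].
    subst x; case: (eqVneq y v) => [->|yv]; first by rewrite hs.
    by rewrite eq_sym in nxy; rewrite hs; case/andP: (inM y yM nxy yv).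
  case: (eqVneq x v) => [xv|xv].
    subst x; case: (eqVneq y u) => [->//|yu].
    by rewrite eq_sym in nxy; rewrite hs; case/andP: (inM y yM yu nxy).
  case/andP: (inM x xM xu xv) => xu' xv'.
  case: (eqVneq y u) => [->//|yu]; case: (eqVneq y v) => [->//|yv].
  case/andP: (inM y yM yu yv) => yu' yv'.
  apply/negPn/negP => xy; apply: (nod x y u v) => //.
  by rewrite /dia nxy xy xu' xv' yu' yv' hs hvu.
have one w p q : w \in W -> w \notin M -> p \in M -> q \in M -> h w p -> h w q -> p = q.
  move=> wW wM pM qM wp wq; apply/eqP/negPn/negP => npq.
  have key r : r \in M -> w != r -> ~~ h w r -> False.
    move=> rM nwr wr; apply: (nod w r p q) => //; do ?exact: MWs.
    rewrite /dia nwr wr wp wq !Mcl //; apply/eqP => E; subst r.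
      by rewrite wq in wr.
    by rewrite wp in wr.
  have wnM r : r \in M -> w != r by move=> rM; apply: contraNneq wM => ->.
  move: wM; rewrite inE wW /= negb_and !negb_or => /orP [] /andP [_ hw].
    exact: (key u uM (wnM _ uM) hw).
  exact: (key v vM (wnM _ vM) hw).
clearbody M.
have eh x y : x \in M -> y \in M -> e x y -> e x y == h x y.
  by move=> xM yM exy; rewrite exy Mcl ?enq.
(* Here v, z, c, d would be an e-diamond with missing edge vz. [reps_edited] then asks for an edited
   pair among z, c, d, but e-edges inside the clique M are unedited. *)
have noedge z c d : z \in M -> c \in M -> d \in M -> ~~ e v z -> z != v ->
    e v c -> e v d -> e z c -> e z d -> e c d -> False.
  move=> zM cM dM vz nzv vc vd zc zd cd.
  have D : dia e z v c d by rewrite /dia nzv es vz zc zd vc vd cd.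
  move/(dia_d4 eg): D => D.
  have D' : d4 e z c d v by rewrite (d4_swap34 _ _ _ _ es) (d4_swap23 _ _ _ _ es).
  by move: (reps_edited hsol D' vY); rewrite !eh.
(* An induced path a b c among the e-neighbours of v in M would give L representatives in Y, all of
   them common neighbours of the edited pair ac. So these e-neighbours form disjoint cliques. *)
have noP3 a b c : a \in M -> b \in M -> c \in M -> e v a -> e v b -> e v c ->
    e a b -> e b c -> a != c -> e a c.
  move=> aM bM cM va vb vc ab bc nac; apply/negPn/negP => ac.
  have D : dia e a c b v.
    by rewrite /dia nac ac ab (es c b) bc !(es _ v) va vb vc.
  move/(dia_d4 eg): D => D; case: (dc D vY) => aY cY bY reps.
  have Eac : e a c != h a c by rewrite (negbTE ac) Mcl.
  have := edited_few_cnbr hsol Eac; rewrite ltnNge => /negP; apply.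
  have LL : 4 * k + 4 <= L by clear; rewrite /L; lia.
  apply: (leq_trans LL); apply: (leq_trans reps).
  apply: subset_leq_card; apply/subsetP => x; rewrite !inE => /andP [xY].
  rewrite (subsetP YW _ xY) andbT /d4 => /andP [_].
  by rewrite (negbTE ac); case: (e a b); case: (e a x); case: (e c b); case: (e c x);
    case: (e b x).
(* v with the clique of its e-neighbours in M that contains a chosen a; only v if it has no
   e-neighbour in M. *)
pose A := if [pick a in M | e v a] is Some a
  then [set z in M | ((z == v) || e v z) && ((z == a) || e a z)] else [set v].
have AM : A \subset M.
  rewrite /A; case: pickP => [a _ | _]; first by apply/subsetP => z; rewrite inE => /andP [].
  by rewrite sub1set.
have vA : v \in A.
  rewrite /A; case: pickP => [a /andP [_ va]| _]; last by rewrite inE.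
  by rewrite inE vM eqxx /= es va orbT.
have Av z : z \in A -> z != v -> e v z.
  rewrite /A; case: pickP => [a _| _]; rewrite inE; last by move=> ->.
  by case/and3P => _ /orP [->|->].
have uA : u \notin A.
  apply/negP => uA; move: evu; rewrite (Av u) //.
  by rewrite eq_sym; apply: hnq.
(* If z is an e-neighbour of v, then v is its only neighbour in A by [noP3]; otherwise two
   neighbours in A would form with v and z the configuration excluded by [noedge]. *)
have few z x y : z \in M -> z \notin A -> x \in A -> y \in A -> e z x -> e z y -> x = y.
  move=> zM zA; rewrite /A in zA *; case: pickP zA => [a /andP [aM va]|N] zA.
    move: zA; rewrite !inE zM /= negb_and !negb_or => zA.
    case/and3P=> xM xv xa /and3P [yM yv ya] zx zy; apply/eqP/negPn/negP => nxy.
    have Acl : forall x y, x \in M -> y \in M -> (x == v) || e v x -> (x == a) || e a x ->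
        (y == v) || e v y -> (y == a) || e a y -> x != y -> e x y.
      move=> x1 y1 x1M y1M /orP [/eqP -> _ |vx].
        by move=> /orP [/eqP ->|//]; rewrite eqxx.
      move=> xa' /orP [/eqP -> *|vy]; first by rewrite es.
      move=> ya' nxy'; case/orP: xa' => [/eqP E|ax].
        by subst x1; case/orP: ya' nxy' => [/eqP ->|//]; rewrite eqxx.
      case/orP: ya' => [/eqP ->|ay]; first by rewrite es.
      by apply: (noP3 x1 a y1) => //; rewrite es.
    case vz: (e v z).
      rewrite vz andbF /= in zA; case/andP: zA => nza az.
      have K w : w \in M -> (w == v) || e v w -> (w == a) || e a w -> e z w -> w = v.
        move=> wM /orP [/eqP //|vw] wa zw; exfalso; move/negP: az; apply.
        case/orP: wa => [/eqP <-|aw]; first by rewrite es.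
        by apply: (noP3 a w z) => //; rewrite 1?es 1?eq_sym.
      by move/eqP: nxy; apply; rewrite (K x) // (K y).
    have nzv : z != v by move: (hnq hvu); apply: contraTneq => E; subst z;
      move: zA; rewrite eqxx /= (es a v) va andbF.
    have nv w : (w == v) || e v w -> e z w -> e v w.
      by case/orP => [/eqP ->|//]; rewrite es vz.
    apply: (noedge z x y) => //; rewrite ?vz //; do ?exact: nv.
    exact: Acl.
  rewrite !inE => /eqP -> /eqP ->; by [].
have Asmall z : z \in M -> z \notin A -> e z v -> exists2 a, a \in A & a != v.
  rewrite /A => zM; case: pickP => [a /andP [aM va] _ _|N _ zv].
    exists a; last by rewrite eq_sym enq.
    by rewrite inE aM eqxx va !orbT.
  by have := N z; rewrite /= zM es zv.
clearbody A.
pose cut x y := (x \in A) && (y \in M :\: A) || (y \in A) && (x \in M :\: A).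
(* Between A and the rest of M only the e-edges at u survive. Keeping these means that no cut pair
   at u is edited, so the edit vu is saved outright. *)
pose h' x y := if cut x y then e x y && ((x == u) || (y == u)) else h x y.
have cutS x y : cut x y = cut y x by rewrite /cut orbC.
have h'g : sgraph h'.
  split=> [x y|x]; rewrite /h'; first by rewrite cutS es hs orbC.
  by rewrite hi ei; case: ifP.
have cutM x y : cut x y -> (x \in M) && (y \in M).
  rewrite /cut !inE => /orP [/and3P [xA _ ->]|/and3P [yA _ ->]].
    by rewrite (subsetP AM).
  by rewrite (subsetP AM _ yA).
have h'f : dfree_on W h'.
  apply: (replace_dfree (M := M) hg h'g) => //.
    move=> x y; rewrite /h' -negb_and => /negbTE xy.
    by case: ifP => // /cutM; rewrite xy.
  move=> x y a b xM yM aM bM; apply/negP => /and5P [nxy xy xa xb /and3P [ya yb ab]].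
  wlog xA : x y nxy xy xa xb ya yb xM yM / x \in A.
    move=> H; case xA : (x \in A); first exact: (H x y).
    apply: (H y x) => //; rewrite 1?eq_sym //; first by case: h'g => ->.
    apply/negPn/negP => yA; move: xy; rewrite /h' /cut xA (negbTE yA) /= Mcl //.
  have yA : y \notin A.
    apply/negP => yA; move: xy; rewrite /h' /cut !inE xA yA /= Mcl //.
  have inA z : z \in M -> z \in A -> h' y z -> (y == u) && e u z.
    move=> zM zA; rewrite /h' /cut !inE zA yA yM /= andbF /=.
    case/andP=> yz /orP [/eqP E|/eqP E]; last by rewrite -E zA in uA.
    by rewrite -E eqxx.
  have inB z : z \in M -> z \notin A -> h' x z -> z = u.
    move=> zM zA; rewrite /h' /cut !inE xA zA zM /=.
    case/andP=> xz /orP [/eqP E|/eqP //]; by rewrite -E xA in uA.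
  have h'i : irreflexive h' by case: h'g.
  case aA : (a \in A); case bA : (b \in A).
  - case/andP: (inA a aM aA ya) => /eqP yu ua.
    case/andP: (inA b bM bA yb) => _ ub.
    by move: ab; rewrite (few u a b) // h'i.
  - case/andP: (inA a aM aA ya) => /eqP yu ua.
    by move: yb; rewrite yu (inB b bM (negbT bA) xb) h'i.
  - case/andP: (inA b bM bA yb) => /eqP yu ub.
    by move: ya; rewrite yu (inB a aM (negbT aA) xa) h'i.
  - by move: ab; rewrite (inB a aM (negbT aA) xa) (inB b bM (negbT bA) xb) h'i.
pose a0 := odflt v [pick a in A | a != v].
pose sw x := if x == v then a0 else v.
pose f (p : T * T) := if p.1 \in A then if p.2 \in M :\: A then (sw p.1, p.2) else p
  else if (p.2 \in A) && (p.1 \in M) then (p.1, sw p.2) else p.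
have a0A : a0 \in A by rewrite /a0; case: pickP => [a /andP []|].
have a0v z : z \in M -> z \notin A -> e z v -> a0 != v.
  move=> zM zA zv; rewrite /a0; case: pickP => [a /andP []//|N].
  by have [a aA av] := Asmall z zM zA zv; have := N a; rewrite /= aA av.
have swA x : sw x \in A by rewrite /sw; case: ifP.
have swe x z : z \in M -> z \notin A -> x \in A -> e z x -> (sw x != x) && ~~ e z (sw x).
  move=> zM zA xA zx.
  have nx : sw x != x.
    rewrite /sw; case: ifP => [/eqP E|]; last by rewrite eq_sym => ->.
    by subst x; exact: (a0v z).
  rewrite nx /=; apply/negP => zs; move/eqP: nx; apply.
  exact: (few z).
have E'cut x y : cut x y -> (x, y) \in edits e h' -> e x y && (x != u) && (y != u).
  move=> C; rewrite inE /= /h' C.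
  by case: (e x y) => //=; case: (x == u); case: (y == u).
have fD (p : T * T) : p \in edits e h' -> f p \in edits e h :\ (v, u).
  case: p => x y Exy; rewrite /f /=.
  have sw_case x' y' : x' \in A -> y' \in M :\: A -> (x', y') \in edits e h' ->
      ((sw x', y') != (v, u)) && ((sw x', y') \in edits e h) && ((y', sw x') \in edits e h).
    move=> xA yB E; have C : cut x' y' by rewrite /cut xA yB.
    case/andP: (E'cut _ _ C E) => /andP [exy _] yu.
    move: yB; rewrite inE => /andP [yA yM].
    rewrite es in exy; case/andP: (swe x' y' yM yA xA exy) => _ nsw.
    rewrite (edits_sym y' (sw x') es hs) -andbA andbb xpair_eqE (negbTE yu) andbF /= inE /=.
    rewrite es (negbTE nsw) Mcl //; first exact: (subsetP AM).
    by apply: contraNneq yA => <-.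
  case xA : (x \in A).
    case: ifP => yB.
      by case/andP: (sw_case x y xA yB Exy) => /andP [n1 n2] _; rewrite in_setD1 n1.
    have C : cut x y = false by rewrite /cut yB !inE xA /= andbF.
    rewrite in_setD1; apply/andP; split.
      apply/eqP => -[E1 E2]; subst x y.
      by move: yB; rewrite inE uM uA.
    by move: Exy; rewrite !inE /h' C.
  case: ifP => [/andP [yA xM]|yx].
    have xB : x \in M :\: A by rewrite inE xA.
    have h's : symmetric h' by case: h'g.
    rewrite (edits_sym _ _ es h's) in Exy.
    case/andP: (sw_case y x yA xB Exy) => _ n2; rewrite in_setD1 n2 andbT.
    by apply/eqP => -[E1 E2]; subst x; rewrite vA in xA.
  have C : cut x y = false by rewrite /cut !inE xA /= yx.
  rewrite in_setD1; apply/andP; split.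
    by apply/eqP => -[E1 E2]; subst x; rewrite vA in xA.
  by move: Exy; rewrite !inE /h' C.
have fI : {in edits e h' &, injective f}.
  have h's : symmetric h' by case: h'g.
  have eA x y : x \in A -> y \in M :\: A -> (x, y) \in edits e h' -> e y x.
    move=> xA yB E; have C : cut x y by rewrite /cut xA yB.
    by rewrite es; case/andP: (E'cut _ _ C E) => /andP [].
  move=> [x y] [x' y'] E E'; rewrite /f /=.
  have E2 := E; have E2' := E'.
  rewrite (edits_sym _ _ es h's) in E2; rewrite (edits_sym _ _ es h's) in E2'.
  have nB z : z \in A -> (z \in M :\: A) = false by move=> zA; rewrite inE zA.
  case xA : (x \in A); case x'A : (x' \in A).
  - case: ifP => yB; case: ifP => yB' [].
    + move=> _ yy; subst y'; congr (_, _).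
      move: (yB); rewrite inE => /andP [yA yM].
      by apply: (few y) => //; apply: eA.
    + by move=> _ yy; subst y'; rewrite yB in yB'.
    + by move=> _ yy; subst y'; rewrite yB in yB'.
    + by move=> -> ->.
  - by case: ifP => yB; case: ifP => yB' [] xx; subst; move: x'A; rewrite ?swA // ?xA.
  - by case: ifP => yB; case: ifP => yB' [] xx; subst; move: xA; rewrite ?swA // ?x'A.
  - case: ifP => /= yA; case: ifP => /= yA' [].
    + move=> xx _; subst x'; congr (_, _); case/andP: yA => yA xM.
      case/andP: yA' => yA' _; apply: (few x) => //; first by rewrite xA.
        by apply: eA => //; rewrite inE xA.
      by apply: eA => //; rewrite inE xA.
    + move=> xx yy; subst x' y'; case/andP: yA => yA xM.
      by rewrite xM swA in yA'.
    + move=> xx yy; subst x' y; case/andP: yA' => yA' xM.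
      by rewrite xM swA in yA.
    + by move=> -> ->.
have lt : #|edits e h'| < #|edits e h|.
  rewrite (cardsD1 (v, u) (edits e h)) in_edits Evu add1n ltnS.
  rewrite -(card_in_imset fI); apply: subset_leq_card.
  by apply/subsetP => q /imsetP [p pE ->]; exact: fD.
have h'sol : sol h'.
  split=> //; first exact: leq_trans (ltnW lt) hk.
  move=> x y; rewrite /h'; case: ifP => [/cutM /andP [xM _] _|_]; first exact: MWs.
  exact: hW.
by move: (hmin h'sol); rewrite leqNgt lt.
Qed.


Lemma added_core x y : h x y -> ~~ e x y -> (x \in Y) && (y \in Y).
Proof.
move=> hxy exy; rewrite (added_core_l hxy exy) /=.
by apply: (@added_core_l y x); rewrite 1?hs 1?es.
Qed.

(* If the clique R of e through a deleted edge meets Y in at most one vertex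
   and no added edge creates a second neighbour in R, restoring R is cheaper. *)
Lemma deleted_cases u v : e u v -> ~~ h u v -> v \notin Y ->
  cnbr e u v \subset Y \/
  (forall c d, c \in cnbr e u v -> d \in cnbr e u v -> c != d -> e c d) /\
  let R := [set u; v] :|: (cnbr e u v :&: W) in
  (exists p q, [/\ p \in R, q \in R, p != q, p \in Y & q \in Y]) \/
  (exists x a b, [/\ a \in R, b \in R, a != b & [/\ x \in Y, a \in Y, e x b & h x a && ~~ e x a]]).
Proof.
move=> uv huv vY.
(* If two common neighbours c, d are nonadjacent, then each common neighbour z lies in a diamond
   with v and two of u, c, d. As v is outside Y, z is in Y. *)
case: (classic (exists c d, [/\ c \in cnbr e u v, d \in cnbr e u v, c != d & ~~ e c d])).
  case=> c [d []]; rewrite !inE => /andP [uc vc] /andP [ud vd] ncd cd; left.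
  have inY p q r : dia e p q r v -> r \in Y.
    by move/(dia_d4 eg) => D; case: (dc D vY).
  have cdY : (c \in Y) && (d \in Y).
    have D : dia e c d u v by rewrite /dia ncd cd !(es _ u) !(es _ v) uc vc ud vd (es v u) uv.
    by case: (dc (dia_d4 eg D) vY) => -> ->.
  case/andP: cdY => cY dY; apply/subsetP => z; rewrite inE => /andP [uz vz].
  have non p : p \in cnbr e u v -> p != z -> ~~ e p z -> z \in Y.
    rewrite inE => /andP [up vp] npz pz.
    have D : dia e p z u v by rewrite /dia npz pz (es p u) (es p v) (es z u) (es z v) up vp uz vz uv.
    by case: (dc (dia_d4 eg D) vY).
  case: (eqVneq c z) => [<-//|ncz]; case: (eqVneq d z) => [<-//|ndz].
  case cz : (e c z); last by apply: (non c) => //; rewrite ?inE ?uc // cz.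
  case dz : (e d z); last by apply: (non d) => //; rewrite ?inE ?ud // dz.
  by apply: (inY c d); rewrite /dia ncd cd cz dz (es c v) (es d v) (es z v) vc vd vz.
move=> Hcl; right.
have cl c d : c \in cnbr e u v -> d \in cnbr e u v -> c != d -> e c d.
  by move=> cN dN ncd; apply/negPn/negP => cd; apply: Hcl; exists c, d.
split=> //= {Hcl}; set R := _ :|: _; apply: NNPP => H.
have Euv : e u v != h u v by rewrite uv (negbTE huv).
have [uW vW] := (hW Euv, hW2 Euv).
have uR : u \in R by rewrite !inE eqxx.
have vR : v \in R by rewrite !inE eqxx orbT.
have RW : R \subset W.
  by apply/subsetP => z; rewrite !inE => /orP [/orP [] /eqP -> //|/andP []].
have inR z : z \in R -> [\/ z = u, z = v | z \in cnbr e u v].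
  by rewrite !in_setU !in_set1 in_setI => /orP [/orP [] /eqP ->|/andP [? _]];
    [constructor 1 | constructor 2 | constructor 3].
have Rcl x y : x \in R -> y \in R -> x != y -> e x y.
  have cN z : z \in cnbr e u v -> e u z && e v z by rewrite inE.
  move=> /inR [->|->|xN] /inR [->|->|yN] nxy //; rewrite ?eqxx // in nxy *.
  - by case/andP: (cN _ yN).
  - by rewrite es.
  - by case/andP: (cN _ yN).
  - by rewrite es; case/andP: (cN _ xN).
  - by rewrite es; case/andP: (cN _ xN).
  - exact: cl.
have Rone p q : p \in R -> q \in R -> p \in Y -> q \in Y -> p = q.
  move=> pR qR pY qY; apply/eqP/negPn/negP => npq; apply: H; left.
  by exists p, q.
have wR w : w \in W -> w \notin R -> ~~ e w u \/ ~~ e w v.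
  move=> wW; rewrite !inE wW andbT !negb_or negb_and (es u) (es v).
  by case/andP=> _ /orP [] ->; [left | right].
(* A vertex w outside R misses u or v. Two e-neighbours p, q of w in R would form an e-diamond with
   w and that vertex; at most one of its vertices is outside Y, so two vertices of R lie in Y. If wp
   is added, then w and p lie in Y; the other neighbour lies in Y too if its edge is added, and
   otherwise gives the second alternative. *)
have one w p q : w \in W -> w \notin R -> p \in R -> q \in R -> h w p -> h w q -> p = q.
  move=> wW wnR pR qR hwp hwq; apply/eqP/negPn/negP => npq.
  have nw r : r \in R -> w != r by move=> rR; apply: contraNneq wnR => ->.
  have key r : r \in R -> ~~ e w r -> e w p -> e w q -> False.
    move=> rR wr wp wq.
    have nrp : r != p by apply: contraNneq wr => ->.
    have nrq : r != q by apply: contraNneq wr => ->.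
    have D : d4 e w r p q.
      by apply: dia_d4 => //; rewrite /dia nw // wr wp wq !Rcl.
    case: (boolP (q \in Y)) => [qY|qY]; last first.
      by case: (dc D qY) => _ rY pY _; move/eqP: nrp; apply; apply: Rone.
    rewrite (d4_swap34 _ _ _ _ es) in D.
    case: (boolP (p \in Y)) => [pY|pY].
      by move/eqP: npq; apply; apply: Rone.
    by case: (dc D pY) => _ rY _ _; move/eqP: nrq; apply; apply: Rone.
  have add p' q' : p' \in R -> q' \in R -> p' != q' -> h w p' -> h w q' -> ~~ e w p' -> False.
    move=> p'R q'R npq' hp hq ep; case/andP: (added_core hp ep) => wY pY.
    case eq: (e w q'); last first.
      by case/andP: (added_core hq (negbT eq)) => _ qY; move/eqP: npq'; apply; apply: Rone.
    by apply: H; right; exists w, p', q'; split=> //; split=> //; rewrite hp ep.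
  case wp: (e w p); last by apply: (add p q) => //; rewrite wp.
  case wq: (e w q); last by apply: (add q p); rewrite // 1?eq_sym // wq.
  by case: (wR w wW wnR) => wr; [apply: (key u) | apply: (key v)].
clearbody R.
pose h' x y := if (x \in R) && (y \in R) then e x y else h x y.
have h'g : sgraph h'.
  split=> [x y|x]; rewrite /h'; first by rewrite andbC es hs.
  by rewrite ei hi; case: ifP.
have h'f : dfree_on W h'.
  apply: (replace_dfree (M := R) hg h'g) => //.
    by move=> x y; rewrite /h' -negb_and => /negbTE ->.
  move=> x y a b xR yR aR bR; rewrite /dia /h' xR yR /=.
  by case nxy: (x != y) => //=; rewrite Rcl.
have lt : #|edits e h'| < #|edits e h|.
  apply: proper_card; apply/properP; split.
    apply/subsetP => -[x y]; rewrite !in_edits /h'; case: ifP => //.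
    by rewrite eqxx.
  by exists (u, v); rewrite !in_edits // /h' uR vR eqxx.
have h'sol : sol h'.
  split=> //; first exact: leq_trans (ltnW lt) hk.
  move=> x y; rewrite /h'; case: ifP => [/andP [xR _] _|_]; last exact: hW.
  exact: (subsetP RW).
by move: (hmin h'sol); rewrite leqNgt lt.
Qed.

(** W misses the common neighbour d of p and q, so richness supplies L others in W outside Y. A
    diamond has at most one vertex outside Y, hence none contains both d and such a z; this forces z
    to be adjacent to d and then to lie in the clique. The 2 accounts for u and v. *)
Lemma rich_clique u v p q d : e u v -> e p q ->
  (forall c d, c \in cnbr e u v -> d \in cnbr e u v -> c != d -> e c d) ->
  p \in [set u; v] :|: cnbr e u v -> q \in [set u; v] :|: cnbr e u v ->
  d \in cnbr e u v -> d \notin W -> p \in W -> q \in W -> rich p q ->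
  L <= #|cnbr e u v :&: W| + 2.
Proof.
move=> uv pq cl pR qR dN dW pW qW.
have dY : d \notin Y by apply: contraNN dW; apply: (subsetP YW).
move: (dN); rewrite inE => /andP [ud vd].
have toR z : z \in [set u; v] :|: cnbr e u v -> z \in W -> e z d.
  rewrite in_setU !inE => /orP [/orP [] /eqP -> //|zN zW].
  by apply: cl; rewrite ?inE ?ud ?vd //; apply: contraNneq dW => <-.
have pd := toR _ pR pW; have qd := toR _ qR qW.
case=> [/subsetP sub|big].
  by move: (sub d); rewrite !inE dY pd qd (negbTE dW) => /(_ isT).
apply: leq_trans big _.
have sub : (cnbr e p q :\: Y) :&: W \subset (cnbr e u v :&: W) :|: [set u; v].
  apply/subsetP => z; rewrite !inE => /andP [/andP [zY /andP [pz qz]] zW].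
  have ndz : d != z by apply: contraNneq dW => ->.
  have noD x y a : dia e z x y a -> d \in [:: x; y; a] -> False.
    move=> /(dia_d4 eg) D; rewrite !inE => /or3P [] /eqP E; subst d.
    - by rewrite (d4_swap23 _ _ _ _ es) (d4_swap34 _ _ _ _ es) in D; case: (dc D dY); rewrite (negbTE zY).
    - by rewrite (d4_swap34 _ _ _ _ es) in D; case: (dc D dY); rewrite (negbTE zY).
    - by case: (dc D dY); rewrite (negbTE zY).
  have zd : e z d.
    apply/negPn/negP => zd; apply: (noD d p q); last by rewrite !inE eqxx.
    by rewrite /dia eq_sym ndz zd (es z p) (es z q) pz qz !(es d) pd qd pq.
  have zr r : r \in [set u; v] -> e r d -> (z == r) || e r z.
    move=> rR rd; rewrite es; case: eqVneq => //= nzr; apply/negPn/negP => znr.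
    have adj' s : s \in [set u; v] :|: cnbr e u v -> s != r -> e r s.
      move: rR; rewrite !inE => /orP [] /eqP -> /orP [/orP [] /eqP -> //|/andP [us vs]].
      + by rewrite eqxx.
      + by [].
      + by rewrite es.
      + by rewrite eqxx.
      + by [].
    have nrp : p != r by apply: contraNneq znr => <-; rewrite es.
    apply: (noD r p d); last by rewrite !inE eqxx !orbT.
    by rewrite /dia nzr znr (es z p) pz zd adj' // rd pd.
  have := zr u; rewrite !inE eqxx ud => /(_ isT isT).
  have := zr v; rewrite !inE eqxx orbT vd => /(_ isT isT).
  by rewrite zW; case: (z == u); case: (z == v); case: (e u z); case: (e v z).
apply: leq_trans (subset_leq_card sub) _.
apply: leq_trans (leq_card_setU _ _).1 _.
by rewrite leq_add2l cards2; case: (_ != _).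
Qed.

(** If W missed a common neighbour, a rich pair in the clique of uv would yield at least L - 2 =
    6k+4 common neighbours in W, against [edited_few_cnbr]. The rich pair is uv itself, another pair
    in Y, or a pair a, b next to an added edge xa, where the first alternative of [core_closed] is
    impossible. *)
Lemma edited_cnbr_sub u v : e u v != h u v -> cnbr e u v \subset W.
Proof.
move=> Euv; have few := edited_few_cnbr hsol Euv.
have [c1 c2] := cc.
have core : u \in Y -> v \in Y -> cnbr e u v \subset W.
  move=> uY vY; case: (c1 u v uY vY) => [/subsetP sub|big].
    apply/subsetP => z zN; case zY : (z \in Y); first exact: (subsetP YW).
    by apply: sub; rewrite inE zY.
  exfalso; move: few; rewrite ltnNge => /negP; apply.
  apply: leq_trans (leq_trans big (subset_leq_card _)); first by clear; rewrite /L; lia.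
  by apply/setSI/subsetDl.
case uv : (e u v); last first.
  have huv : h u v by move: Euv; rewrite uv; case: (h u v).
  by case/andP: (added_core huv (negbT uv)); apply: core.
have huv : ~~ h u v by move: Euv; rewrite uv; case: (h u v).
move: core few huv uv Euv.
wlog vY : u v / v \notin Y => [Hw core few huv uv Euv|].
  case vY: (v \in Y); last by apply: Hw; rewrite ?vY.
  case uY: (u \in Y); first exact: core.
  have E : cnbr e u v = cnbr e v u by apply/setP => z; rewrite !inE andbC.
  by rewrite E; apply: Hw; rewrite ?uY -?E 1?hs 1?es // es hs.
move=> core few huv uv Euv; have [uW vW] := (hW Euv, hW2 Euv).
case: (deleted_cases uv huv vY) => [sub|[cl /= alt]].
  exact: subset_trans sub YW.
set R := _ :|: _ in alt.
apply/subsetP => d dN; apply/negPn/negP => dW.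
have RR p : p \in R -> (p \in [set u; v] :|: cnbr e u v) && (p \in W).
  rewrite !inE => /orP [/orP [] /eqP ->|/andP [/andP [-> ->] ->]].
  - by rewrite eqxx uW.
  - by rewrite eqxx orbT vW.
  - by rewrite orbT.
have Rcl x y : x \in R -> y \in R -> x != y -> e x y.
  have cN z : z \in cnbr e u v -> e u z && e v z by rewrite inE.
  have inR z : z \in R -> [\/ z = u, z = v | z \in cnbr e u v].
    by rewrite !in_setU !in_set1 in_setI => /orP [/orP [] /eqP ->|/andP [? _]];
      [constructor 1 | constructor 2 | constructor 3].
  move=> /inR [->|->|xN] /inR [->|->|yN] nxy //; rewrite ?eqxx // in nxy *.
  - by case/andP: (cN _ yN).
  - by rewrite es.
  - by case/andP: (cN _ yN).
  - by rewrite es; case/andP: (cN _ xN).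
  - by rewrite es; case/andP: (cN _ xN).
  - exact: cl.
have fin p q : p \in R -> q \in R -> p != q -> rich p q -> False.
  move=> pR qR npq ri; case/andP: (RR _ pR) => pR' pW; case/andP: (RR _ qR) => qR' qW.
  have := rich_clique uv (Rcl _ _ pR qR npq) cl pR' qR' dN dW pW qW ri.
  by move: few; clear; rewrite /L; lia.
case: alt => [[p [q [pR qR npq pY qY]]]|].
  by apply: (fin p q) => //; apply: c1.
case=> x [a [b [aR bR nab [xY aY xb /andP [hxa exa]]]]].
case bY: (b \in Y); first by apply: (fin a b) => //; apply: c1.
have bN : b \in cnbr e x a :\: Y by rewrite !inE bY xb Rcl.
case: (c2 x a b xY aY bN) => [big|]; last exact: fin.
have Exa : e x a != h x a by rewrite hxa (negbTE exa).
move: (edited_few_cnbr hsol Exa); rewrite ltnNge => /negP; apply.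
apply: leq_trans (leq_trans big (subset_leq_card _)); first by clear; rewrite /L; lia.
by apply/setSI/subsetDl.
Qed.

(** By [reps_edited], a diamond of h with a vertex d outside W has an edited pair uv among its other
    vertices. By [edited_cnbr_sub], d is not adjacent to both ends, so the missing edge joins d to u
    or v, and uv was added. *)
Lemma min_sol_dfree : dfree_on setT h.
Proof.
have [c1 c2] := cc.
have edW x y : x \notin W -> h x y = e x y.
  by move=> xW; apply/eqP; rewrite eq_sym; apply: contraNT xW; apply: hW.
have edW2 x y : y \notin W -> h x y = e x y by move=> yW; rewrite hs es edW.
have noN u v d : e u v != h u v -> d \notin W -> e u d -> e v d -> False.
  move=> Euv dW ud vd; move/subsetP: (edited_cnbr_sub Euv) => /(_ d).
  by rewrite inE ud vd (negbTE dW) => /(_ isT).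
(* W misses d, a common neighbour of v and c, so it contains L common neighbours of v and c. At
   least 4k+6 of them are untouched, and each of these is adjacent to u, or else it forms a diamond
   with u, v, c inside W. That is too many for the edited pair uv. *)
have main u v c d : e u v != h u v -> d \notin W -> ~~ h u d ->
    h u v -> h u c -> h v c -> h v d -> h c d -> False.
  move=> Euv dW ud huv huc hvc hvd hcd.
  have [uW vW] := (hW Euv, hW2 Euv).
  have vd : e v d by rewrite -edW2.
  have cd : e c d by rewrite -edW2.
  have cW : c \in W.
    apply/negPn/negP => cW; apply: (noN u v c) => //; by rewrite -edW2.
  have evc : e v c.
    apply/negPn/negP => vc; apply: (noN v c d) => //; by rewrite hvc (negbTE vc).
  have euv : ~~ e u v by move: Euv; rewrite huv; case: (e u v).
  case/andP: (added_core huv euv) => uY vY.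
  have Lsub (A B : {set T}) : A \subset B -> L <= #|A :&: W| -> L <= #|B :&: W|.
    by move=> AB LA; apply: leq_trans LA (subset_leq_card (setSI _ AB)).
  have dY : d \notin Y by apply: contraNN dW; apply: (subsetP YW).
  have few := edited_few_cnbr hsol Euv.
  have rbig : rich v c -> L <= #|cnbr e v c :&: W|.
    case=> [/subsetP /(_ d)|]; last by apply: Lsub; apply: subsetDl.
    by rewrite !inE dY vd cd (negbTE dW) => /(_ isT).
  have big : L <= #|cnbr e v c :&: W|.
    case cY: (c \in Y); first by apply/rbig/c1.
    have euc : e u c.
      apply/negPn/negP => uc; case/andP: (added_core huc uc).
      by rewrite cY.
    have cN : c \in cnbr e u v :\: Y by rewrite !inE cY euc evc.
    case: (c2 u v c uY vY cN) => [big|//].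
    exfalso; move: few; rewrite ltnNge => /negP; apply.
    have := Lsub _ _ (subsetDl (cnbr e u v) Y) big.
    by apply: leq_trans; clear; rewrite /L; lia.
  have sub : (cnbr e v c :&: W) :\: touched e h \subset cnbr e u v :&: W.
    apply/subsetP => z; rewrite !inE => /andP [zt /andP [/andP [vz cz] zW]].
    rewrite zW vz !andbT.
    have hzu : h z u.
      apply/negPn/negP => zu.
      have nzu : z != u by apply: contraNneq zt => ->; apply: edited_touched Euv.
      have D : dia h z u v c.
        by rewrite /dia nzu zu !(untouched _ zt) (es z v) vz (es z c) cz huv huc hvc.
      by move: (dia_d4 hg D); apply/negP; apply: hf.
    by rewrite es -(untouched u zt).
  have tc : #|touched e h| <= 2 * k by apply: leq_trans (card_touched e h) hk.
  have := subset_leq_card sub; rewrite cardsD.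
  have := subset_leq_card (subsetIr (cnbr e v c :&: W) (touched e h)).
  by move: big few tc; clear; rewrite /L; lia.
have edge u v c d : e u v != h u v -> d \notin W -> ~~ d4 h u v c d.
  move=> Euv dW; apply/negP => D.
  have := D; rewrite d4E // => /or4P [] .
  - case/and5P=> _ _ _ ud /and3P [_ vd _].
    by apply: (noN u v d Euv dW); rewrite -(edW2 _ _ dW).
  - case/and5P=> _ _ _ ud /and3P [_ _ vd].
    by apply: (noN u v d Euv dW); rewrite -(edW2 _ _ dW).
  - case/and5P=> _ ud uv uc /and3P [dv dc' vc].
    by apply: (main u v c d) => //; rewrite hs.
  case/or3P.
  - case/and5P=> _ _ _ vd /and3P [_ _ ud].
    by apply: (noN u v d Euv dW); rewrite -(edW2 _ _ dW).
  - case/and5P=> _ vd vu vc /and3P [du dc' uc].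
    by apply: (main v u c d) => //; rewrite 1?es 1?hs // hs.
  - case/and5P=> _ _ _ _ /and3P [du dv _].
    by apply: (noN u v d Euv dW); rewrite -(edW2 _ _ dW) hs.
have anyedge u v c d : d \notin W -> ~~ d4 h u v c d.
  move=> dW; apply/negP => D.
  case: (boolP (e u v != h u v)) => [E|/negPn /eqP uv]; first by move: D; apply/negP; apply: edge.
  have D1 := D; rewrite (d4_swap23 _ _ _ _ hs) in D1.
  case: (boolP (e u c != h u c)) => [E|/negPn /eqP uc]; first by move: D1; apply/negP; apply: edge.
  have D2 := D1; rewrite (d4_swap12 _ _ _ _ hs) (d4_swap23 _ _ _ _ hs) in D2.
  case: (boolP (e c v != h c v)) => [E|/negPn /eqP cv]; first by move: D2; apply/negP; apply: edge.
  have De : d4 e u v c d.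
    by move: D; rewrite /d4 !(edW2 _ _ dW) uv uc (es v c) cv (hs c v).
  have dY : d \notin Y by apply: contraNN dW; apply: (subsetP YW).
  by move: (reps_edited hsol De dY); rewrite uv uc (es v c) (hs v c) cv !eqxx.
move=> u v c d _ _ _ _.
case: (boolP (d \in W)) => dW; last exact: anyedge.
case: (boolP (c \in W)) => cW; last by rewrite (d4_swap34 _ _ _ _ hs) anyedge.
case: (boolP (v \in W)) => vW.
  case: (boolP (u \in W)) => uW; first exact: hf.
  by rewrite (d4_swap12 _ _ _ _ hs) (d4_swap23 _ _ _ _ hs) (d4_swap34 _ _ _ _ hs) anyedge.
by rewrite (d4_swap23 _ _ _ _ hs) (d4_swap34 _ _ _ _ hs) anyedge.
Qed.

End MinSol.

Theorem core_kernel :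
  (exists h, sol h) ->
  exists h, [/\ sgraph h, dfree_on setT h & #|edits e h| <= 2 * k].
Proof.
move=> H; have [h hsol hmin] := exists_minimizer (fun h => #|edits e h|) H.
exists h; split; [by case: hsol | exact: min_sol_dfree | by case: hsol].
Qed.

End Kernel.

(** * Instances, forced edits and packings *)

Definition yes_rel (T : finType) (e : rel T) (k : nat) :=
  exists h, [/\ sgraph h, dfree_on setT h & #|edits e h| <= 2 * k].

Lemma set2_eq (T : finType) (a b c d : T) :
  ([set a; b] == [set c; d]) = (a == c) && (b == d) || (a == d) && (b == c).
Proof.
apply/eqP/idP => [E|/orP [] /andP [/eqP -> /eqP ->] //]; last by rewrite setUC.
have : a \in [set c; d] by rewrite -E !inE eqxx.
have : b \in [set c; d] by rewrite -E !inE eqxx orbT.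
have : c \in [set a; b] by rewrite E !inE eqxx.
have : d \in [set a; b] by rewrite E !inE eqxx orbT.
rewrite !inE (eq_sym c a) (eq_sym c b) (eq_sym d a) (eq_sym d b).
by case: (a == c); case: (a == d); case: (b == c); case: (b == d).
Qed.

Lemma adj_sgraph (T : finType) (E : {set {set T}}) : simple_graph E -> sgraph (adj E).
Proof.
move=> /subsetP sE; split=> [x y|x]; first by rewrite /adj setUC.
by apply/negP => /sE; rewrite inE cards2 eqxx.
Qed.

Lemma adj_diamond (i j : 'I_4) : adj diamond i j =
  (i != j) && ~~ ((i == inord 0) && (j == inord 1) || (i == inord 1) && (j == inord 0)).
Proof. by rewrite /adj !inE set2_eq cards2 andbC; case: (i != j). Qed.

Lemma ord4_cases (i : 'I_4) : [\/ i = inord 0, i = inord 1, i = inord 2 | i = inord 3].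
Proof.
by case: i => [[|[|[|[|//]]]] lt]; [constructor 1 | constructor 2 | constructor 3 | constructor 4];
  apply: val_inj; rewrite /= inordK.
Qed.

Lemma inord4_eq m n : m < 4 -> n < 4 -> ((inord m : 'I_4) == inord n) = (m == n).
Proof. by move=> m4 n4; rewrite -val_eqE /= !inordK. Qed.

Lemma diamond_freeE (T : finType) (E : {set {set T}}) : simple_graph E ->
  diamond_free E <-> dfree_on setT (adj E).
Proof.
move=> sE; have g := adj_sgraph sE; have [es ei] := g; split.
  move=> H; apply: dfree_onP => // x y a b _ _ _ _; apply/negP => D.
  have /andP [U _] := dia_d4 g D.
  case/and5P: D => nxy xy xa xb /and3P [ya yb ab]; apply: H.
  exists (fun i : 'I_4 => nth x [:: x; y; a; b] i); split.
    move=> i j /eqP; rewrite nth_uniq // => /eqP; exact: val_inj.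
  move=> i j; rewrite adj_diamond.
  by case: (ord4_cases i) => ->; case: (ord4_cases j) => ->;
    rewrite !inord4_eq // !inordK //= ?ei // ?(es y x) ?(es a x) ?(es a y)
      ?(es b x) ?(es b y) ?(es b a) ?(negbTE xy) ?xa ?xb ?ya ?yb ?ab.
move=> H [f [fi fe]].
have D : d4 (adj E) (f (inord 0)) (f (inord 1)) (f (inord 2)) (f (inord 3)).
  rewrite /d4 /= !inE !(inj_eq fi) !inord4_eq //= !fe !adj_diamond !inord4_eq //.
by move: D; apply/negP; apply: H; rewrite in_setT.
Qed.

(** Passage from ordered edits to the 2-sets of an instance: each 2-set has exactly two
    preimages. *)
Lemma card_sym_pairs (T : finType) (D : {set T * T}) :
  (forall x y, (x, y) \in D -> (y, x) \in D) -> (forall x, (x, x) \notin D) ->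
  #|D| = 2 * #|[set [set p.1; p.2] | p in D]|.
Proof.
move=> Ds Di; rewrite -sum1_card (partition_big_imset (fun p => [set p.1; p.2])) /=.
rewrite mulnC -sum_nat_const; apply: eq_bigr => S /imsetP [[x y] xyD ->] /=.
rewrite sum1_card.
have nxy : x != y by apply: contraTneq xyD => ->; apply: Di.
rewrite (eq_card (B := [set (x, y); (y, x)])).
  by rewrite cards2 xpair_eqE (negbTE nxy).
move=> [a b]; rewrite !inE /= unfold_in /= set2_eq !xpair_eqE.
apply/idP/idP => [/andP []//|ab]; rewrite ab andbT.
by case/orP: ab => /andP [/eqP -> /eqP ->] //; apply: Ds.
Qed.

Definition edge_set (T : finType) (q : rel T) : {set {set T}} :=
  [set [set p.1; p.2] | p in [set p | q p.1 p.2]].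

Lemma mem_edge_set (T : finType) (q : rel T) x y : symmetric q ->
  ([set x; y] \in edge_set q) = q x y.
Proof.
move=> qs; apply/imsetP/idP => [[[a b]]|qxy]; last by exists (x, y); rewrite ?inE.
rewrite inE /= => qab /eqP; rewrite set2_eq.
by case/orP => /andP [/eqP -> /eqP ->]; rewrite // qs.
Qed.

Lemma edge_set_simple (T : finType) (q : rel T) : irreflexive q -> simple_graph (edge_set q).
Proof.
move=> qi; apply/subsetP => S /imsetP [[x y]]; rewrite inE /= => qxy ->.
by rewrite inE cards2 (_ : x != y) //; apply: contraTneq qxy => ->; rewrite qi.
Qed.

Lemma yes_instanceE (I : instance) :
  yes_instance I <-> yes_rel (adj (edges I)) (budget I).
Proof.
case: I => n E sE k; rewrite /yes_instance /=.
have g := adj_sgraph sE; have [es ei] := g; split.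
  case=> Ep [Em [sp sm ck df]]; set E' := _ :\: _ in df.
  have sE' : simple_graph E'.
    apply/subsetP => S; rewrite !inE => /andP [_ /orP [/(subsetP sE)|/(subsetP sp)]].
      by rewrite inE.
    by rewrite !inE => /andP [].
  have g' := adj_sgraph sE'; have [es' ei'] := g'.
  exists (adj E'); split=> //; first exact/diamond_freeE.
  rewrite card_sym_pairs; last by move=> x; rewrite in_edits ei ei'.
    rewrite leq_mul2l /=; apply: leq_trans (subset_leq_card _) ck.
    apply/subsetP => _ /imsetP [[x y] xyD ->]; move: xyD; rewrite in_edits /adj !inE /=.
    by case: (_ \in E) => /=; case: (_ \in Ep); case: (_ \in Em).
  by move=> x y; rewrite edits_sym.
case=> h [hg hf hk]; have [hs hi] := hg.
pose ep x y := h x y && ~~ adj E x y; pose em x y := adj E x y && ~~ h x y.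
have eps : symmetric ep by move=> x y; rewrite /ep hs es.
have ems : symmetric em by move=> x y; rewrite /em hs es.
have sE' : simple_graph ((E :|: edge_set ep) :\: edge_set em).
  apply/subsetP => S; rewrite !inE => /andP [_ /orP [/(subsetP sE)|]]; first by rewrite inE.
  case/imsetP=> -[x y]; rewrite inE /= => /andP [hxy _] ->; rewrite cards2.
  by rewrite (_ : x != y) //; apply: contraTneq hxy => ->; rewrite hi.
have hE : adj ((E :|: edge_set ep) :\: edge_set em) =2 h.
  move=> x y; rewrite {1}/adj !inE !mem_edge_set // /ep /em /adj.
  by case: (_ \in E); case: (h x y).
exists (edge_set ep), (edge_set em); split.
- apply/subsetP => S /imsetP [[x y]]; rewrite inE /= => /andP [hxy exy] ->.
  by rewrite !inE exy cards2 (_ : x != y) //; apply: contraTneq hxy => ->; rewrite hi.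
- apply/subsetP => S /imsetP [[x y]]; rewrite inE /= => /andP [exy _] ->.
  exact: exy.
- rewrite -(leq_pmul2l (m := 2)) //; apply: leq_trans hk.
  rewrite [X in _ <= X]card_sym_pairs; last by move=> x; rewrite in_edits ei hi.
    rewrite leq_mul2l /=; apply: subset_leq_card; apply/subsetP => S.
    rewrite inE => /orP [] /imsetP [[x y]]; rewrite inE /= => xy ->;
      apply/imsetP; exists (x, y) => //; rewrite in_edits; case/andP: xy => -> /negbTE -> //.
  by move=> x y; rewrite edits_sym.
- apply/(diamond_freeE sE') => x y a b xT yT aT bT.
  by move: (hf x y a b xT yT aT bT); rewrite /d4 !hE.
Qed.

(** * Restricting solutions to an induced subgraph and extending them back *)

Section Induced.
Variables (T T' : finType) (e : rel T) (e' : rel T') (k : nat) (f : T' -> T).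
Hypotheses (fi : injective f) (eg : sgraph e) (fe : forall x y, e' x y = e (f x) (f y)).

Lemma d4_comp (h : rel T) u v c d :
  d4 (fun x y => h (f x) (f y)) u v c d = d4 h (f u) (f v) (f c) (f d).
Proof. by rewrite /d4 /= !inE !(inj_eq fi). Qed.

Lemma yes_induced : yes_rel e k -> yes_rel e' k.
Proof.
case=> h [[hs hi] hf hk]; exists (fun x y => h (f x) (f y)); split.
- by split=> [x y|x]; rewrite ?hi // hs.
- by move=> u v c d _ _ _ _; rewrite d4_comp hf ?inE.
apply: leq_trans hk; pose F (p : T' * T') := (f p.1, f p.2).
have Fi : injective F by move=> [a b] [c d] [/fi -> /fi ->].
rewrite -(card_imset _ Fi); apply: subset_leq_card.
by apply/subsetP => _ /imsetP [[x y] xy ->]; move: xy; rewrite !inE /= fe.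
Qed.

(** [g] is the partial inverse of f; pairs that leave the image of f keep their status in e. *)
Lemma sol_induced : yes_rel e' k -> exists h, sol e k (f @: setT) h.
Proof.
case=> h' [[hs hi] hf hk]; pose g x := [pick x' | f x' == x].
have gf x : g (f x) = Some x.
  by rewrite /g; case: pickP => [y /eqP /fi ->|/(_ x)] //; rewrite eqxx.
have gS x x' : g x = Some x' -> x = f x'.
  by rewrite /g; case: pickP => // y /eqP <- [<-].
pose h x y := if g x is Some x' then if g y is Some y' then h' x' y' else e x y else e x y.
have hff x y : h (f x) (f y) = h' x y by rewrite /h !gf.
have [es ei] := eg; exists h; split.
- split=> [x y|x]; rewrite /h; first by case: (g x) => [x'|]; case: (g y) => [y'|] //; rewrite ?hs // es.
  by case: (g x) => [x'|].
- move=> u v c d /imsetP [u' _ ->] /imsetP [v' _ ->] /imsetP [c' _ ->] /imsetP [d' _ ->].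
  by move: (hf u' v' c' d'); rewrite !inE => /(_ isT isT isT isT); rewrite /d4 !hff /= !inE !(inj_eq fi).
- apply: leq_trans hk; pose F (p : T' * T') := (f p.1, f p.2).
  have sub : edits e h \subset F @: edits e' h'.
    apply/subsetP => -[x y]; rewrite in_edits /h.
    case gx: (g x) => [x'|]; last by rewrite eqxx.
    case gy: (g y) => [y'|]; last by rewrite eqxx.
    move=> E; apply/imsetP; exists (x', y'); last by rewrite /F /= -(gS x) // -(gS y).
    by rewrite in_edits fe -(gS x) // -(gS y).
  exact: leq_trans (subset_leq_card sub) (leq_imset_card _ _).
- move=> x y; rewrite /h; case gx: (g x) => [x'|]; last by rewrite eqxx.
  by move=> _; rewrite (gS x x' gx) imset_f.
Qed.

End Induced.

(** * Lower bounds from flowers and packings, forced edits, and the core *)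

Section Steps.
Variables (T : finType) (e : rel T).
Hypothesis eg : sgraph e.

Definition toggle (u v : T) : rel T :=
  fun x y => e x y (+) ((x == u) && (y == v) || (x == v) && (y == u)).

Lemma toggle_sgraph u v : u != v -> sgraph (toggle u v).
Proof.
case: eg => es ei nuv; split=> [x y|x]; rewrite /toggle.
  by rewrite es orbC (andbC (x == v)) (andbC (x == u)).
by rewrite ei /=; case: eqVneq => [->|]; rewrite ?(negbTE nuv) ?andbF.
Qed.

Lemma card_add2 (D : finType) (A B : {set D}) p q :
  A \subset B -> p \in B -> q \in B -> p \notin A -> q \notin A -> p != q ->
  #|A| + 2 <= #|B|.
Proof.
move=> AB pB qB pA qA npq.
have <- : #|p |: (q |: A)| = #|A| + 2.
  by rewrite !cardsU1 !inE negb_or npq pA qA /=; lia.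
apply: subset_leq_card; apply/subsetP => x.
by rewrite !inE => /or3P [/eqP ->|/eqP ->|/(subsetP AB)].
Qed.

(** Every pair other than uv meets c or d. The last clause records this, with the vertex c or d in
    second place, for the count in [flower_step]. *)
Lemma d4_edited h u v c d : d4 e u v c d -> ~~ d4 h u v c d ->
  exists x y, [/\ x \in [:: u; v; c; d], y \in [:: u; v; c; d], x != y & (x, y) \in edits e h]
    /\ ((x, y) = (u, v) \/ y \in [:: c; d]).
Proof.
move=> De Dh; apply: NNPP => H.
have U : uniq [:: u; v; c; d] by case/andP: De.
have E x y : x \in [:: u; v; c; d] -> y \in [:: u; v; c; d] -> x != y ->
   (x, y) = (u, v) \/ y \in [:: c; d] -> e x y = h x y.
  move=> xD yD nxy xy; apply/eqP/negPn/negP => exy; apply: H; exists x, y.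
  by rewrite in_edits.
move: De Dh; rewrite /d4; rewrite U /=; move: U; rewrite /= !inE !negb_or.
case/and4P=> /and3P [n1 n2 n3] /andP [n4 n5] n6 _.
have E' x y : x \in [:: u; v; c; d] -> x != y -> y \in [:: c; d] -> e x y = h x y.
  move=> xD nxy yD; apply: E => //; last by right.
  by move: yD; rewrite !inE => /orP [] ->; rewrite !orbT.
have -> : e u v = h u v by apply: E; rewrite ?inE ?eqxx ?orbT //; left.
by rewrite !E' ?inE ?eqxx ?orbT // => ->.
Qed.

Section Flower.
Variables (h : rel T) (u v : T).
Hypotheses (hg : sgraph h) (hf : dfree_on setT h).

Definition edits_in (A : {set T}) := edits e h :&: setX A A.

(** As uv is unedited, the petal is broken at a pair meeting c or d. This pair lies in the enlarged
    set but not in A, so both its orders are new and no edit is counted for two petals. *)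
Lemma flower_step (A : {set T}) c d : h u v = e u v -> u \in A -> v \in A ->
  c \notin A -> d \notin A -> d4 e u v c d ->
  #|edits_in A| + 2 <= #|edits_in (c |: (d |: A))|.
Proof.
move=> huv uA vA cA dA D.
have [x [y [[xD yD nxy xyE] xy]]] := d4_edited D (hf (in_setT _) (in_setT _) (in_setT _) (in_setT _)).
have [es ei] := eg; have [hs hi] := hg.
have yA : y \in [:: c; d].
  by case: xy => // -[E1 E2]; subst; rewrite in_edits huv eqxx in xyE.
have ynA : y \notin A by move: yA; rewrite !inE => /orP [] /eqP ->.
have sub z : z \in [:: u; v; c; d] -> z \in c |: (d |: A).
  by rewrite !inE => /or4P [] /eqP ->; rewrite ?uA ?vA ?eqxx ?orbT.
apply: (@card_add2 _ _ _ (x, y) (y, x)).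
- apply: setIS; apply: setXS; apply/subsetP => z zA; by rewrite !inE zA !orbT.
- by rewrite inE xyE in_setX !sub.
- by rewrite inE edits_sym // xyE in_setX !sub.
- by rewrite inE in_setX (negbTE ynA) !andbF.
- by rewrite inE in_setX (negbTE ynA) !andbF.
- by rewrite xpair_eqE negb_and nxy.
Qed.

Definition mark6 (u v c d : T) : {set T * T} :=
  [set p | [&& p.1 \in [:: u; v; c; d], p.2 \in [:: u; v; c; d] & p.1 != p.2]].

Lemma packing_step (P : {set T * T}) a b c d : d4 e a b c d ->
  [disjoint mark6 a b c d & P] ->
  #|edits e h :&: P| + 2 <= #|edits e h :&: (mark6 a b c d :|: P)|.
Proof.
move=> D dis.
have [x [y [[xD yD nxy xyE] _]]] := d4_edited D (hf (in_setT _) (in_setT _) (in_setT _) (in_setT _)).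
have [es ei] := eg; have [hs hi] := hg.
have xy6 : (x, y) \in mark6 a b c d by rewrite inE /= xD yD.
have yx6 : (y, x) \in mark6 a b c d by rewrite inE /= xD yD eq_sym.
apply: (@card_add2 _ _ _ (x, y) (y, x)).
- by apply/setIS/subsetUr.
- by rewrite in_setI xyE in_setU xy6.
- by rewrite in_setI edits_sym // xyE in_setU yx6.
- by rewrite in_setI (disjointFr dis xy6) andbF.
- by rewrite in_setI (disjointFr dis yx6) andbF.
- by rewrite xpair_eqE negb_and nxy.
Qed.

End Flower.

Lemma card_mark6 a b c d : #|mark6 a b c d| <= 12.
Proof.
pose l := [:: (a, b); (a, c); (a, d); (b, a); (b, c); (b, d);
              (c, a); (c, b); (c, d); (d, a); (d, b); (d, c)].
apply: leq_trans (card_size l); apply: subset_leq_card; apply/subsetP => -[x y].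
rewrite inE /= => /and3P []; rewrite !inE.
by do 2![case/or4P => /eqP ->] => n;
  rewrite ?eqxx ?orbT // in n *.
Qed.

(** Leaving uv alone costs at least k+2 edits, so each solution of size k+1 edits uv and toggling
    saves exactly this edit. Conversely the toggle itself is one edit more. *)
Lemma forced_toggle u v k : u != v ->
  (forall h, sgraph h -> dfree_on setT h -> h u v = e u v -> 2 * k.+2 <= #|edits e h|) ->
  yes_rel e k.+1 <-> yes_rel (toggle u v) k.
Proof.
move=> nuv forced; have [es ei] := eg.
pose Q := [set (u, v); (v, u)].
have cQ : #|Q| = 2 by rewrite cards2 xpair_eqE negb_and nuv.
have Qin x y : ((x, y) \in Q) = ((x == u) && (y == v) || (x == v) && (y == u)).
  by rewrite !inE !xpair_eqE.
split=> -[h [hg hf hk]]; exists h; split=> //; have [hs hi] := hg.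
  have huv : h u v != e u v.
    by apply: contraTneq hk => /(forced h hg hf); lia.
  have sub : edits (toggle u v) h \subset edits e h :\: Q.
    apply/subsetP => -[x y]; rewrite in_setD !in_edits Qin /toggle.
    case: (boolP (_ || _)) => [/orP [] /andP [/eqP -> /eqP ->]|_]; last by rewrite addbF.
      by move: huv; case: (e u v); case: (h u v).
    by move: huv; rewrite es hs; case: (e v u); case: (h v u).
  have QE : Q \subset edits e h.
    by rewrite subUset !sub1set !in_edits eq_sym huv es hs eq_sym huv.
  move: (subset_leq_card sub); rewrite cardsD (setIidPr QE) cQ.
  by move: hk (subset_leq_card QE); clear; lia.
have sub : edits e h \subset edits (toggle u v) h :|: Q.
  apply/subsetP => -[x y]; rewrite in_setU !in_edits Qin /toggle.
  by case: ((x == u) && (y == v) || (x == v) && (y == u)); rewrite ?orbT // addbF orbF.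
move: (subset_leq_card sub) (leq_card_setU (edits (toggle u v) h) Q).1.
by rewrite cQ; move: hk; clear; lia.
Qed.

(** Every diamond shares a pair with P, and P joins vertices of Y only. So if d is outside Y, the
    shared pair is among u, v, c, say uv. Its hitting set F contains c or d and lies in Y, hence
    contains c; as d was not collected, the triple has L representatives. *)
Lemma core_of_packing k (P : {set T * T}) (Y : {set T}) :
  (forall u v, (u, v) \in P -> (v, u) \in P) ->
  (forall u v c d, d4 e u v c d -> ~~ [disjoint mark6 u v c d & P]) ->
  (forall u v, (u, v) \in P -> exists F : {set T},
     [/\ u \in F, v \in F, F \subset Y,
         forall c d, c \notin F -> d \notin F -> ~~ d4 e u v c d &
         forall a, a \in F -> [set d | d4 e u v a d] \subset Y \/
           6 * k + 6 <= #|[set x in Y | d4 e u v a x]|]) ->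
  diamond_core e k Y.
Proof.
have [es ei] := eg; move=> Ps Pc PF.
have key u v c d : (u, v) \in P -> d4 e u v c d -> d \notin Y ->
    [/\ u \in Y, v \in Y, c \in Y & 6 * k + 6 <= #|[set x in Y | d4 e u v c x]|].
  move=> uvP D dY; have [F [uF vF FY Fd Fa]] := PF u v uvP.
  have S := subsetP FY.
  have cF : c \in F.
    apply/negPn/negP => cF; have dF : d \notin F by apply: contraNN dY; apply: S.
    by move/negP: (Fd c d cF dF).
  split; [exact: S | exact: S | exact: S |].
  case: (Fa c cF) => [/subsetP /(_ d)|//]; rewrite inE D => /(_ isT).
  by rewrite (negbTE dY).
move=> u v c d D dY.
have PY x y : (x, y) \in P -> (x \in Y) && (y \in Y).
  by case/PF => F [xF yF FY _ _]; rewrite !(subsetP FY).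
have : ~~ [disjoint mark6 u v c d & P] by exact: Pc.
rewrite -setI_eq0 => /set0Pn [[x y]]; rewrite !inE /= => /andP [/and3P [xD yD nxy] xyP].
have /andP [xY yY] := PY _ _ xyP.
have nd z : z \in Y -> z == d = false by move=> zY; apply: contraTF zY => /eqP ->.
rewrite !nd // !orbF in xD yD.
have Puv : (u, v) \in P -> [/\ u \in Y, v \in Y, c \in Y & 6 * k + 6 <= #|[set x in Y | d4 e u v c x]|].
  by move=> H; apply: key H D dY.
have Puc : (u, c) \in P -> [/\ u \in Y, v \in Y, c \in Y & 6 * k + 6 <= #|[set x in Y | d4 e u v c x]|].
  move=> H; rewrite (d4_swap23 _ _ _ _ es) in D; case: (key _ _ _ _ H D dY) => ? ? ? c1; split=> //.
  by under eq_finset => z do rewrite (d4_swap23 _ _ _ _ es).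
have Pvc : (v, c) \in P -> [/\ u \in Y, v \in Y, c \in Y & 6 * k + 6 <= #|[set x in Y | d4 e u v c x]|].
  move=> H; rewrite (d4_swap12 _ _ _ _ es) (d4_swap23 _ _ _ _ es) in D.
  case: (key _ _ _ _ H D dY) => ? ? ? c1; split=> //.
  by under eq_finset => z do rewrite (d4_swap12 _ _ _ _ es) (d4_swap23 _ _ _ _ es).
case/or3P: xD nxy xyP => /eqP ->; case/or3P: yD => /eqP ->; rewrite ?eqxx // => _ H;
  by [exact: Puv | exact: Puc | exact: Pvc | apply/Puv/Ps | apply/Puc/Ps | apply/Pvc/Ps].
Qed.

End Steps.

(** * A language of bounded loops *)

(* Arrays used by the program: 0, 1, 2 hold the input and the output, 3 the
   number of vertices (the bound of every loop), 4 the current adjacency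
   matrix, 5 the row offsets x * n, 6 the number L, 7 a flag for no-instances,
   8 and 9 the vertices and the size of a flower, 10 and 11 the pairs and the
   size of the packing, 12 the set Y, 13 the set W, 14 and 15 counters, 16 and
   17 the list of W and its length, 18 the row offsets of the output, 19 a flag
   that is reset by each forced edit of a round, 20 to 26 the loop variables. *)
Inductive prog :=
  | PSkip
  | PWrite of nat & expr & expr
  | PSeq of prog & prog
  | PIf of expr & prog & prog
  | PFor of nat & prog.

Definition V a := Read a (Const 0).

Fixpoint compile p : cmd :=
  match p with
  | PSkip => Skip
  | PWrite a i e => Write a i e
  | PSeq p q => Seq (compile p) (compile q)
  | PIf e p q => If e (compile p) (compile q)
  | PFor i b => Seq (Write i (Const 0) (Const 0))
      (While (Defs.Sub (V 3) (V i))
         (Seq (compile b) (Write i (Const 0) (Add (V i) (Const 1)))))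
  end.

Fixpoint loop i (f : state -> state) m j s :=
  if m is m'.+1 then loop i f m' j.+1 (f (update s i 0 j)) else update s i 0 j.

Fixpoint den n p s : state :=
  match p with
  | PSkip => s
  | PWrite a i e => update s a (eval s i) (eval s e)
  | PSeq p q => den n q (den n p s)
  | PIf e p q => if eval s e != 0 then den n p s else den n q s
  | PFor i b => loop i (den n b) n 0 s
  end.

Fixpoint writes p : seq nat :=
  match p with
  | PSkip => [::]
  | PWrite a _ _ => [:: a]
  | PSeq p q | PIf _ p q => writes p ++ writes q
  | PFor i b => i :: writes b
  end.

(** No body changes the loop bound in array 3 or its own counter, so the number of iterations is
    known in advance. *)
Fixpoint wf p : bool :=
  match p with
  | PSkip => true
  | PWrite a _ _ => a != 3
  | PSeq p q | PIf _ p q => wf p && wf q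
  | PFor i b => [&& i != 3, i \notin writes b & wf b]
  end.

(** An upper bound that charges both branches of a conditional. In a loop, 12 is 6 for the guard and
    6 for the increment; 9 is 3 for the initialisation and 6 for the final guard. *)
Fixpoint tm n p : nat :=
  match p with
  | PSkip => 1
  | PWrite _ i e => (cost i + cost e).+1
  | PSeq p q => tm n p + tm n q
  | PIf e p q => (cost e + (tm n p + tm n q)).+1
  | PFor _ b => n * (tm n b + 12) + 9
  end.

Lemma upd_eq s a i v : update s a i v a i = v.
Proof. by rewrite /update !eqxx. Qed.

Lemma upd_ne s a i v b j : a != b -> update s a i v b j = s b j.
Proof. by rewrite /update eq_sym => /negbTE ->. Qed.

Lemma upd_at s a i v j : update s a i v a j = if j == i then v else s a j.
Proof. by rewrite /update eqxx. Qed.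

Lemma loop_inv i f n (Inv : nat -> state -> Prop) s :
  Inv 0 s ->
  (forall j s, j < n -> Inv j s -> Inv j.+1 (f (update s i 0 j))) ->
  exists2 s', Inv n s' & loop i f n 0 s = update s' i 0 n.
Proof.
move=> I0 IS; have : forall m j s, m + j = n -> Inv j s ->
    exists2 s', Inv n s' & loop i f m j s = update s' i 0 n.
  elim=> [|m IH] j s' E Ij /=; first by exists s'; rewrite -E.
  by apply: IH; [lia | apply: IS => //; lia].
by move=> /(_ n 0 s); rewrite addn0; apply.
Qed.

Lemma den_frame n p s a j : a \notin writes p -> den n p s a j = s a j.
Proof.
elim: p s j => //= [b i e|p IHp q IHq|e p IHp q IHq|i b IHb] s j.
- by rewrite inE => na; rewrite upd_ne // eq_sym.
- by rewrite mem_cat negb_or => /andP [np nq]; rewrite IHq // IHp.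
- by rewrite mem_cat negb_or => /andP [np nq]; case: ifP => _; [apply: IHp | apply: IHq].
rewrite inE negb_or => /andP [ni nb].
rewrite eq_sym in ni.
have step : forall j' s', j' < n -> s' a j = s a j ->
    den n b (update s' i 0 j') a j = s a j.
  by move=> j' s' _ E; rewrite IHb // upd_ne.
have [s' E ->] := loop_inv (Inv := fun _ s' => s' a j = s a j) (erefl (s a j)) step.
by rewrite upd_ne.
Qed.

Lemma wf_writes p : wf p -> 3 \notin writes p.
Proof.
elim: p => //= [a _ _|p IHp q IHq|e p IHp q IHq|i b IHb].
- by rewrite inE eq_sym.
- by case/andP=> /IHp np /IHq nq; rewrite mem_cat negb_or np.
- by case/andP=> /IHp np /IHq nq; rewrite mem_cat negb_or np.
- by case/and3P=> ni _ /IHb nb; rewrite inE negb_or eq_sym ni.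
Qed.

Lemma exec_compile n p s : wf p -> s 3 0 = n ->
  exists2 t, t <= tm n p & exec (compile p) s t (den n p s).
Proof.
elim: p s => [|a i e|p IHp q IHq|e p IHp q IHq|i b IHb] s /=.
- by move=> _ _; exists 1 => //; constructor.
- by move=> _ _; exists (cost i + cost e).+1 => //; constructor.
- case/andP=> wp wq sn; have [t1 l1 e1] := IHp s wp sn.
  have [|t2 l2 e2] := IHq (den n p s) wq; first by rewrite den_frame ?wf_writes.
  by exists (t1 + t2); [exact: leq_add | apply: exec_seq e1 e2].
- case/andP=> wp wq sn; case: ifP => c.
    have [t l ex] := IHp s wp sn; exists (cost e + t).+1; first by lia.
    exact: exec_if_true.
  have [t l ex] := IHq s wq sn; exists (cost e + t).+1; first by lia.
  by apply: exec_if_false => //; apply/eqP; rewrite -[_ == _]negbK c.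
case/and3P=> ni nb wb sn.
have H : forall m j s, m + j = n -> s 3 0 = n ->
    exists2 t, t <= m * (tm n b + 12) + 6 &
    exec (While (Defs.Sub (V 3) (V i))
         (Seq (compile b) (Write i (Const 0) (Add (V i) (Const 1)))))
      (update s i 0 j) t (loop i (den n b) m j s).
  elim=> [|m IH] j s0 E s0n /=.
    exists 6 => //; apply: exec_while_false.
    by rewrite /= upd_eq upd_ne //; lia.
  have un : update s0 i 0 j 3 0 = n by rewrite upd_ne.
  have [t l ex] := IHb _ wb un.
  set s1 := den n b _ in ex *.
  have s1n : s1 3 0 = n by rewrite /s1 den_frame ?wf_writes.
  have s1i : s1 i 0 = j by rewrite /s1 den_frame // upd_eq.
  have [|t' l' ex'] := IH j.+1 s1 _ s1n; first by lia.
  exists (5 + (t + 6) + t').+1; first by rewrite mulSn; lia.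
  apply: (@exec_while_true _ (update s1 i 0 j.+1)) => //.
    by rewrite /= upd_eq un; lia.
  apply: exec_seq ex _.
  have : exec (Write i (Const 0) (Add (V i) (Const 1))) s1 6 (update s1 i 0 (s1 i 0 + 1)).
    exact: exec_write.
  by rewrite s1i addn1.
have [|t l ex] := H n 0 s _ sn; first by lia.
exists (3 + t); first by lia.
exact: exec_seq (exec_write s i (Const 0) (Const 0)) ex.
Qed.

Fixpoint coef p : nat :=
  match p with
  | PSkip => 1
  | PWrite _ i e => (cost i + cost e).+1
  | PSeq p q => coef p + coef q
  | PIf e p q => (cost e).+1 + (coef p + coef q)
  | PFor _ b => coef b + 21
  end.

Fixpoint depth p : nat :=
  match p with
  | PSkip | PWrite _ _ _ => 0
  | PSeq p q | PIf _ p q => maxn (depth p) (depth q)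
  | PFor _ b => (depth b).+1
  end.

(** Each nested loop costs one factor n+1; the 21 in [coef] is 12 + 9, the overhead of a loop. *)
Lemma tm_poly n p : tm n p <= coef p * n.+1 ^ depth p.
Proof.
have X1 d : 0 < n.+1 ^ d by rewrite expn_gt0.
have pw : forall m d, m <= d -> n.+1 ^ m <= n.+1 ^ d.
  by move=> m d md; apply: leq_pexp2l.
elim: p => [|a i e|p IHp q IHq|e p IHp q IHq|i b IHb] /=.
- by [].
- by rewrite muln1.
- rewrite mulnDl; apply: leq_add.
    by apply: leq_trans IHp _; rewrite leq_mul2l pw ?orbT // leq_maxl.
  by apply: leq_trans IHq _; rewrite leq_mul2l pw ?orbT // leq_maxr.
- rewrite -addSn !mulnDl; apply: leq_add; first by rewrite leq_pmulr.
  apply: leq_add.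
    by apply: leq_trans IHp _; rewrite leq_mul2l pw ?orbT // leq_maxl.
  by apply: leq_trans IHq _; rewrite leq_mul2l pw ?orbT // leq_maxr.
rewrite expnS; move: IHb (X1 (depth b)); set t := tm n b; set K := coef b.
set P := n.+1 ^ _; move=> IH P1.
have : n * t <= n * (K * P) by rewrite leq_mul2l IH orbT.
by nia.
Qed.

(** * Sets stored in arrays, and proof rules for loops *)

Definition mset n A (s : state) : {set 'I_n} := [set x : 'I_n | s A x != 0].

Lemma mset_upd n A s a j v : a != A -> mset n A (update s a j v) = mset n A s.
Proof. by move=> na; apply/setP => x; rewrite !inE upd_ne. Qed.

Lemma mset_add n A s (x : 'I_n) v : v != 0 ->
  mset n A (update s A x v) = x |: mset n A s.
Proof.
move=> v0; apply/setP => y; rewrite !inE upd_at.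
by case: (eqVneq y x) => [->|ne]; rewrite ?eqxx // (negbTE ne : (y == x :> nat) = false).
Qed.

Section Rules.
Variable n : nat.

(** R is a progress preorder along which each [Q x] persists once iteration x has established it,
    and mu is a size that iteration x raises by at most [w x]. Facts about all x and a size bound
    thus follow from one analysis of the body. *)
Lemma for_rule i b (Inv : state -> Prop) (R : state -> state -> Prop)
    (Q : 'I_n -> state -> Prop) (mu : state -> nat) (w : 'I_n -> nat) s :
  (forall s, R s s) -> (forall s1 s2 s3, R s1 s2 -> R s2 s3 -> R s1 s3) ->
  (forall x s1 s2, R s1 s2 -> Q x s1 -> Q x s2) ->
  (forall s j, Inv s -> Inv (update s i 0 j)) ->
  (forall s j, R s (update s i 0 j)) ->
  (forall s j, mu (update s i 0 j) = mu s) ->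
  Inv s ->
  (forall s (x : 'I_n), Inv s -> s i 0 = x ->
     [/\ Inv (den n b s), R s (den n b s), Q x (den n b s) &
         mu (den n b s) <= mu s + w x]) ->
  let s' := den n (PFor i b) s in
  [/\ Inv s', R s s', forall x, Q x s' & mu s' <= mu s + \sum_x w x].
Proof.
move=> Rr Rt QR Iu Ru mu_u Is step.
pose Good j s' := [/\ Inv s', R s s', forall x : 'I_n, x < j -> Q x s' &
                 mu s' <= mu s + \sum_(x < n | x < j) w x].
have G0 : Good 0 s by split=> //; exact: leq_addr.
have GS j s' : j < n -> Good j s' -> Good j.+1 (den n b (update s' i 0 j)).
  move=> jn [I' R' Q' m']; set u := update s' i 0 j.
  have [] := step u (Ordinal jn) (Iu _ _ I') (upd_eq _ _ _ _).
  move=> I2 R2 Q2 m2.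
  have R3 : R s' (den n b u) := Rt _ _ _ (Ru _ _) R2.
  split=> //; first exact: Rt R' R3.
    move=> x; rewrite ltnS leq_eqVlt => /orP [/eqP xj|xj].
      by rewrite (_ : x = Ordinal jn) //; apply: val_inj.
    exact: QR R3 (Q' x xj).
  rewrite mu_u in m2; rewrite (bigD1 (Ordinal jn)) /= ?ltnSn //.
  rewrite (eq_bigl (fun x : 'I_n => x < j)); first by rewrite addnCA addnC; apply: leq_trans m2 _; rewrite leq_add2r.
  by move=> x; rewrite -val_eqE /= ltnS [RHS]ltn_neqAle andbC.
have [s' [I' R' Q' m'] E] := loop_inv G0 GS.
rewrite /= E; split; [exact: Iu | exact: Rt R' (Ru _ _) | |].
  by move=> x; apply: QR (Ru _ _) (Q' x (ltn_ord x)).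
rewrite mu_u; apply: leq_trans m' _; rewrite leq_add2l.
by rewrite [leqLHS](eq_bigl predT) // => x; rewrite ltn_ord.
Qed.

Definition ev s (l : seq expr) := all (fun e => eval s e != 0) l.

Definition PWhen l p := foldr (fun e q => PIf e q PSkip) p l.

Lemma den_when l p s : den n (PWhen l p) s = if ev s l then den n p s else s.
Proof. by elim: l => //= e l ->; case: (eval s e != 0). Qed.

Definition incr c := PWrite c (Const 0) (Add (V c) (Const 1)).

(** Runs b for the first values of i that satisfy the guards l; the counter c stops it after as many
    runs as cell 6 says, which is L. *)
Definition trunc i c (l : seq expr) b :=
  PSeq (PWrite c (Const 0) (Const 0))
       (PFor i (PWhen (rcons l (Defs.Sub (V 6) (V c))) (PSeq b (incr c)))).

(** The set S of processed values is an initial part of C, equal to C unless the counter has reached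
    L. This is the alternative in which [rich] is phrased, and at most L runs give the growth
    bound. *)
Lemma trunc_rule i c l b (Inv : state -> Prop) (R : state -> state -> Prop)
    (Q : 'I_n -> state -> Prop) (mu : state -> nat) (C : {set 'I_n}) (L B : nat) s :
  (forall s, R s s) -> (forall s1 s2 s3, R s1 s2 -> R s2 s3 -> R s1 s3) ->
  (forall x s1 s2, R s1 s2 -> Q x s1 -> Q x s2) ->
  (forall s a j, a \in [:: i; c] -> Inv s -> Inv (update s a 0 j)) ->
  (forall s a j, a \in [:: i; c] -> R s (update s a 0 j)) ->
  (forall s a j, a \in [:: i; c] -> mu (update s a 0 j) = mu s) ->
  i != c -> c \notin writes b -> (forall s, Inv s -> s 6 0 = L) ->
  Inv s ->
  (forall s (x : 'I_n), Inv s -> s i 0 = x -> ev s l = (x \in C)) ->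
  (forall s (x : 'I_n), Inv s -> s i 0 = x -> x \in C ->
     [/\ Inv (den n b s), R s (den n b s), Q x (den n b s) &
         mu (den n b s) <= mu s + B]) ->
  let s' := den n (trunc i c l b) s in
  [/\ Inv s', R s s', mu s' <= mu s + L * B &
      exists2 S : {set 'I_n}, S \subset C &
        (forall x, x \in S -> Q x s') /\ (S = C \/ L <= #|S|)].
Proof.
move=> Rr Rt QR Iu Ru mu_u ic cb IL Is Hev step /=.
have ci : c \in [:: i; c] by rewrite !inE eqxx orbT.
have ii : i \in [:: i; c] by rewrite !inE eqxx.
set s0 := update s c 0 0.
pose Good j s' := exists S : {set 'I_n},
  [/\ Inv s', R s s', mu s' <= mu s + #|S| * B,
      S \subset [set x in C | x < j] &
      [/\ forall x, x \in S -> Q x s', s' c 0 = #|S|, #|S| <= L &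
          #|S| < L -> S = [set x in C | x < j]]].
have G0 : Good 0 s0.
  exists set0; rewrite cards0 mul0n addn0 /s0 mu_u // upd_eq sub0set.
  split=> //; [exact: Iu | exact: Ru | split=> //].
    by move=> x; rewrite inE.
  by move=> _; apply/setP => x; rewrite !inE ltn0 andbF.
have GS j s' : j < n -> Good j s' ->
  Good j.+1 (den n (PWhen (rcons l (Defs.Sub (V 6) (V c))) (PSeq b (incr c))) (update s' i 0 j)).
  move=> jn [S [I' R' m' SC [SQ cS SL full]]].
  pose xj := Ordinal jn; set u := update s' i 0 j.
  have Iu' : Inv u by exact: Iu.
  have Ru' : R s' u by exact: Ru.
  have uc : u c 0 = #|S| by rewrite /u upd_ne.
  have xS : xj \notin S.
    by apply/negP => /(subsetP SC); rewrite inE /= ltnn andbF.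
  have lt (x : 'I_n) : (x < j.+1) = (x == xj) || (x < j).
    by rewrite ltnS leq_eqVlt -val_eqE.
  rewrite den_when /ev all_rcons -/(ev u l) (Hev u xj Iu' (upd_eq _ _ _ _)) /=.
  rewrite (IL u Iu') uc subn_eq0 -ltnNge.
  case: ifP => [/andP [SL' xC]|nC].
    have [I2 R2 Q2 m2] := step u xj Iu' (upd_eq _ _ _ _) xC.
    set s2 := den n b u in I2 R2 Q2 m2 *.
    have s2c : s2 c 0 = #|S| by rewrite /s2 den_frame.
    set s3 := update s2 c 0 _.
    have R3 : R s2 s3 by exact: Ru.
    have R4 : R s' s3 by apply: Rt Ru' (Rt _ _ _ R2 R3).
    have cS' : #|xj |: S| = #|S|.+1 by rewrite cardsU1 xS.
    exists (xj |: S); rewrite cS'; split.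
    - exact: Iu.
    - exact: Rt R' R4.
    - rewrite /s3 mu_u // mulSn; apply: leq_trans m2 _; rewrite /u mu_u //.
      by move: m'; clear; lia.
    - apply/subsetP => x; rewrite !inE lt => /orP [/eqP ->|/(subsetP SC)]; first by rewrite xC eqxx.
      by rewrite inE => /andP [-> ->]; rewrite orbT.
    split=> //.
    - move=> x; rewrite !inE => /orP [/eqP ->|/SQ]; first exact: QR R3 Q2.
      exact: QR.
    - by rewrite /s3 upd_eq s2c addn1.
    - move=> _; rewrite (full SL'); apply/setP => x; rewrite !inE lt.
      by case: (eqVneq x xj) => [->|]; rewrite ?xC.
  exists S; split=> //.
  - exact: Rt R' Ru'.
  - by rewrite /u mu_u.
  - by apply: subset_trans SC _; apply/subsetP => x; rewrite !inE lt => /andP [-> ->]; rewrite orbT.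
  split=> //; first by move=> x /SQ; apply: QR.
  move=> SL'; rewrite SL' /= in nC; rewrite (full SL'); apply/setP => x; rewrite !inE lt.
  by case: (eqVneq x xj) => [->|]; rewrite ?nC.
have [s' [S [I' R' m' SC [SQ cS SL full]]] ->] := loop_inv G0 GS.
have Ru' : R s' (update s' i 0 n) by exact: Ru.
split; [exact: Iu | exact: Rt R' Ru' | |].
  rewrite mu_u //; apply: leq_trans m' _; rewrite leq_add2l leq_mul2r SL orbT //.
have E : [set x in C | x < n] = C by apply/setP => x; rewrite inE ltn_ord andbT.
rewrite E in SC full; exists S => //; split; first by move=> x /SQ; apply: QR.
by case: (ltnP #|S| L) => [/full|]; [left | right].
Qed.

End Rules.

(** * The algorithm *)

Definition neq e1 e2 := Add (Defs.Sub e1 e2) (Defs.Sub e2 e1).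
Definition isz e := Defs.Sub (Const 1) e.
Definition cell2 A e1 e2 := Read A (Add (Read 5 e1) e2).
Definition G := cell2 4.
Definition dia4 u v c d : seq expr :=
  [:: neq u v; neq u c; neq u d; neq v c; neq v d; neq c d;
      isz (neq (Add (Add (Add (Add (Add (G u v) (G u c)) (G u d)) (G v c)) (G v d)) (G c d))
               (Const 5))].
Definition PBlock l := foldr PSeq PSkip l.
Definition mark A e := PWrite A e (Const 1).

Lemma den_nil n s : den n (PBlock [::]) s = s. Proof. by []. Qed.

Lemma den_cons n p l s : den n (PBlock (p :: l)) s = den n (PBlock l) (den n p s).
Proof. by []. Qed.

Lemma den_write n A i e s : den n (PWrite A i e) s = update s A (eval s i) (eval s e).
Proof. by []. Qed.

Lemma den_mark n A e s : den n (mark A e) s = update s A (eval s e) 1.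
Proof. by []. Qed.

Lemma den_incr n c s : den n (incr c) s = update s c 0 (s c 0 + 1).
Proof. by []. Qed.

Definition denE := (den_cons, den_nil, den_write, den_mark, den_incr).

Arguments den : simpl never.
Arguments PWhen : simpl never.
Arguments PBlock : simpl never.

Lemma neq_ne0 s e1 e2 : (eval s (neq e1 e2) != 0) = (eval s e1 != eval s e2).
Proof. by rewrite /=; lia. Qed.

Lemma isz_ne0 s e : (eval s (isz e) != 0) = (eval s e == 0).
Proof. by rewrite /=; lia. Qed.

(** A frame condition: Inv depends on the arrays in A only, so writes elsewhere are dismissed by a
    membership test. *)
Definition keeps (A : seq nat) (Inv : state -> Prop) := forall s s',
  (forall a j, a \in A -> s' a j = s a j) -> Inv s -> Inv s'.

Lemma keep_upd A Inv s a i v : keeps A Inv -> a \notin A -> Inv s -> Inv (update s a i v).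
Proof.
move=> K aA; apply: K => b j bA; rewrite upd_ne //.
by apply: contraNneq aA => ->.
Qed.

Lemma keep_den n A Inv p s : keeps A Inv -> all (fun a => a \notin writes p) A ->
  Inv s -> Inv (den n p s).
Proof. by move=> K /allP H; apply: K => a j /H; apply: den_frame. Qed.

(** * Greedy maximal flowers *)

Section Phases.
Variable n : nat.
Implicit Types (e : rel 'I_n) (s : state).

Lemma idx_eq (x u : nat) (y v : 'I_n) : (x * n + y == u * n + v) = (x == u) && (y == v).
Proof.
apply/eqP/andP => [E|[/eqP -> /eqP ->] //].
have [yn vn] := (ltn_ord y, ltn_ord v).
have n0 : 0 < n by exact: leq_trans yn.
have Ex : x = u.
  have := congr1 (fun m => m %/ n) E.
  by rewrite !divnMDl // !divn_small // !addn0.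
by rewrite Ex eqxx; split=> //; apply/eqP/val_inj; move: E; rewrite Ex /= => /addnI.
Qed.

(** The machine cannot multiply, so row offsets are tabulated. *)
Definition rows s := forall x : 'I_n, s 5 x = x * n.

Definition ctx e k s :=
  [/\ s 1 0 = k, rows s & forall x y : 'I_n, s 4 (x * n + y) = e x y].

Lemma ctx_keeps e k : keeps [:: 1; 4; 5] (ctx e k).
Proof.
by move=> s s' E [H1 H2 H3]; split=> [|x|x y]; rewrite E.
Qed.

Lemma eval_G e k s a b (x y : 'I_n) : ctx e k s ->
  eval s a = x -> eval s b = y -> eval s (G a b) = e x y.
Proof. by case=> _ H2 H3 /= -> ->; rewrite H2 H3. Qed.

Lemma ev_dia4 e k s a b c d (x y z w : 'I_n) : ctx e k s ->
  eval s a = x -> eval s b = y -> eval s c = z -> eval s d = w ->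
  ev s (dia4 a b c d) = d4 e x y z w.
Proof.
move=> cs ax ay az aw; rewrite /ev /dia4; cbn [all].
rewrite !neq_ne0 isz_ne0 ax ay az aw.
have -> (q : expr) m : (eval s (neq q (Const m)) == 0) = (eval s q == m).
  by rewrite -[LHS]negbK neq_ne0 negbK.
rewrite [eval s _](_ : _ = e x y + e x z + e x w + e y z + e y w + e z w).
  by rewrite /d4 /= !inE !negb_or -!val_eqE /= !andbA !andbT.
by cbn [eval]; rewrite -!/(eval _ _) ?(eval_G cs ax ay) ?(eval_G cs ax az)
  ?(eval_G cs ax aw) ?(eval_G cs ay az) ?(eval_G cs ay aw) ?(eval_G cs az aw).
Qed.

(** The first loop clears the marks of earlier calls. One pass over the pairs c, d then gives a
    maximal flower, because marks only grow and a pair once blocked stays blocked. *)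
Definition flower iu iv := PBlock
  [:: PFor 23 (PWrite 8 (V 23) (Const 0));
      mark 8 (V iu); mark 8 (V iv); PWrite 9 (Const 0) (Const 0);
      PFor 23 (PFor 24
        (PWhen [:: isz (Read 8 (V 23)), isz (Read 8 (V 24)) & dia4 (V iu) (V iv) (V 23) (V 24)]
           (PBlock [:: mark 8 (V 23); mark 8 (V 24); incr 9])))].

(** The fourth clause compares the flower with any other hitting set, which must meet every petal;
    the fifth is the lower bound that forces an edit of uv. *)
Definition flower_set e u v cnt (F : {set 'I_n}) :=
  [/\ u \in F, v \in F, #|F| = 2 * cnt + 2,
      forall F' : {set 'I_n}, (forall c d, c \notin F' -> d \notin F' -> ~~ d4 e u v c d) ->
        cnt <= #|F :&: F'| &
      forall h, sgraph h -> dfree_on setT h -> h u v = e u v -> 2 * cnt <= #|edits_in e h F|].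

Lemma flower_spec e k s iu iv (u v : 'I_n) : sgraph e -> ctx e k s ->
  s iu 0 = u -> s iv 0 = v -> u != v ->
  iu \notin [:: 8; 9; 23; 24] -> iv \notin [:: 8; 9; 23; 24] ->
  let s' := den n (flower iu iv) s in
  flower_set e u v (s' 9 0) (mset n 8 s') /\
  forall c d, c \notin mset n 8 s' -> d \notin mset n 8 s' -> ~~ d4 e u v c d.
Proof.
move=> eg cs su sv nuv; rewrite !inE !negb_or.
case/and4P=> nu8 nu9 nu23 nu24 /and4P [nv8 nv9 nv23 nv24].
pose I0 s := [/\ ctx e k s, s iu 0 = u & s iv 0 = v].
have K0 : keeps [:: 1; 4; 5; iu; iv] I0.
  move=> t t' E [c1 c2 c3]; split; rewrite ?E ?inE ?eqxx ?orbT //.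
  by apply: ctx_keeps c1 => a j aA; apply: E; rewrite -[_ :: _]/([:: 1; 4; 5] ++ [:: iu; iv]) mem_cat aA.
have U0 (a : nat) t i w : a \in [:: 8; 9; 23; 24] -> I0 t -> I0 (update t a i w).
  move=> aA; apply: (keep_upd _ _ K0).
  by move: aA; rewrite !inE => /or4P [] /eqP ->; rewrite !negb_or /= eq_sym ?nu8 ?nu9 ?nu23 ?nu24 /= eq_sym.
have I0s : I0 s by [].
rewrite /flower den_cons.
have [] := @for_rule n 23 (PWrite 8 (V 23) (Const 0)) I0
  (fun t t' => forall x, t 8 x = 0 -> t' 8 x = 0) (fun x t => t 8 x = 0) (fun=> 0) (fun=> 0) s.
- by [].
- by move=> s1 s2 s3 H1 H2 x /H1 /H2.
- by move=> x s1 s2; apply.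
- by move=> t j; apply: U0.
- by move=> t j x; rewrite upd_ne.
- by [].
- by [].
- move=> t x It tx; rewrite denE /=; split=> //; first exact: U0.
    by move=> y; rewrite upd_at; case: ifP.
  by rewrite tx upd_at eqxx.
move: (den n (PFor 23 _) s) => s1 I1 _ z1 _.
rewrite !denE /=; set s2 := update _ 9 _ _.
have I2 : I0 s2 by do 3!apply: (@U0 _) => //.
have [c1 u1 v1] := I1.
have m2 : mset n 8 s2 = [set u; v].
  rewrite /s2 mset_upd // u1 (upd_ne _ _ _ _ (_ : 8 != iv)) 1?eq_sym // v1 !mset_add //.
  by rewrite (_ : mset n 8 s1 = set0) ?setU0 1?setUC //; apply/setP => x; rewrite !inE z1.
have c2 : s2 9 0 = 0 by rewrite /s2 upd_eq.
move: s2 I2 m2 c2 => s2 I2 m2 c2 {s1 I1 z1 c1 u1 v1}.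
pose IF t := I0 t /\ flower_set e u v (t 9 0) (mset n 8 t).
have IFu (a : nat) t i w : a \in [:: 23; 24] -> IF t -> IF (update t a i w).
  move=> aA [It Ft]; split; first by apply: U0 It; move: aA; rewrite !inE => /orP [] ->; rewrite !orbT.
  have a8 : (a != 8) && (a != 9) by move: aA; rewrite !inE => /orP [] /eqP ->.
  by case/andP: a8 => a8 a9; rewrite mset_upd // upd_ne.
have IF2 : IF s2.
  split=> //; rewrite c2 m2; split=> //; rewrite ?inE ?eqxx ?orbT //.
  by rewrite cards2 nuv.
pose R (t t' : state) := mset n 8 t \subset mset n 8 t'.
have Rr t : R t t by exact: subxx.
have Rt t1 t2 t3 : R t1 t2 -> R t2 t3 -> R t1 t3 by exact: subset_trans.
have Ru (a : nat) t i w : a != 8 -> R t (update t a i w) by move=> a8; rewrite /R mset_upd.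
pose ok t c d := c \notin mset n 8 t -> d \notin mset n 8 t -> ~~ d4 e u v c d.
have okR t t' c d : R t t' -> ok t c d -> ok t' c d.
  move=> tt' H cn dn; apply: H; [apply: contraNN cn | apply: contraNN dn]; exact: (subsetP tt').
set body := PFor 24 _.
have step t (c : 'I_n) : IF t -> t 23 0 = c ->
  [/\ IF (den n body t), R t (den n body t), forall d, ok (den n body t) c d & 0 <= 0].
  move=> It tc.
have [] := @for_rule n 24 (PWhen [:: isz (Read 8 (V 23)), isz (Read 8 (V 24)) & dia4 (V iu) (V iv) (V 23) (V 24)]
     (PBlock [:: mark 8 (V 23); mark 8 (V 24); incr 9]))
   (fun t => IF t /\ t 23 0 = c) R (fun d t => ok t c d) (fun=> 0) (fun=> 0) t
   Rr Rt (fun d t t' => @okR t t' c d).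
- by move=> t' j [It' tc']; split; [exact: IFu | rewrite upd_ne].
- by move=> t' j; apply: Ru.
- by [].
- by [].
- move=> {t It tc} t d [It tc] td; rewrite den_when.
  have [[ct ut vt] [uF vF cF coF hF]] := It.
  have Ev : ev t [:: isz (Read 8 (V 23)), isz (Read 8 (V 24)) & dia4 (V iu) (V iv) (V 23) (V 24)] =
      [&& c \notin mset n 8 t, d \notin mset n 8 t & d4 e u v c d].
    rewrite -(ev_dia4 ct (x := u) (y := v) (z := c) (w := d) (a := V iu) (b := V iv)
        (c := V 23) (d := V 24)) //.
    by rewrite /ev; cbn [all]; rewrite !isz_ne0 /= tc td !inE !negbK.
  rewrite Ev; case: ifP => [/and3P [cn dn D]|N]; last first.
    split=> // cn dn; apply/negP => D; by rewrite cn dn D in N.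
  rewrite !denE /=; set t' := update _ 9 _ _.
  have Et : mset n 8 t' = c |: (d |: mset n 8 t).
    by rewrite /t' mset_upd // tc upd_ne // td !mset_add // setUCA.
  have c9 : t' 9 0 = (t 9 0).+1 by rewrite /t' upd_eq !upd_ne // addn1.
  have t'23 : t' 23 0 = c by rewrite /t' !upd_ne.
  have ncd : c != d.
    by case/andP: D; rewrite /= !inE !negb_or => /and4P [_ _ -> _].
  have I't : I0 t' by do 3!apply: (@U0 _) => //.
  split=> //.
  + split=> //; split=> //; rewrite Et c9.
    split; [by rewrite 2!in_setU uF !orbT | by rewrite 2!in_setU vF !orbT | | |].
    - by rewrite !cardsU1 in_setU1 negb_or ncd cn dn cF /=; clear; lia.
    - move=> F' HF'; apply: leq_ltn_trans (coF F' HF') _; apply: proper_card.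
      have : (c \in F') || (d \in F').
        by apply/negPn/negP; rewrite negb_or => /andP [c' d']; move/negP: (HF' c d c' d').
      move=> cd'; apply/properP; split.
        by apply: setSI; apply: subset_trans (subsetUr _ _) (subsetUr _ _).
      case/orP: cd' => x'; [exists c | exists d];
        by rewrite in_setI ?(negbTE cn) ?(negbTE dn) // x' !in_setU1 eqxx ?orbT.
    move=> h hg hf huv; apply: leq_trans (flower_step eg hg hf huv uF vF cn dn D).
    by move: (hF h hg hf huv); clear; lia.
  + by rewrite /R Et; apply/subsetP => x xF; rewrite !inE; rewrite inE in xF; rewrite xF !orbT.
  + by move=> cn'; rewrite Et !inE eqxx in cn'.
  by move=> [If _] Rf Qf _; split.
have [[I3 F3] R3 Q3 _] := @for_rule n 23 body IF R (fun c t => forall d, ok t c d) (fun=> 0) (fun=> 0) s2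
  Rr Rt (fun c t t' tt' H d => okR t t' c d tt' (H d))
  (fun t j => IFu 23 t 0 j isT) (fun t j => Ru 23 t 0 j isT) (fun t j => erefl) IF2 step.
by split=> // c d; apply: Q3.
Qed.

End Phases.

Lemma keeps_reg A Inv i (x : nat) : keeps A Inv ->
  keeps (i :: A) (fun s => Inv s /\ s i 0 = x).
Proof.
move=> K s s' E [Is <-]; split; last by rewrite E ?inE ?eqxx.
by apply: K Is => a j aA; rewrite E // inE aA orbT.
Qed.

Lemma den_cat n l1 l2 s :
  den n (PBlock (l1 ++ l2)) s = den n (PBlock l2) (den n (PBlock l1) s).
Proof. by elim: l1 s => //= p l IH s; rewrite !den_cons IH. Qed.

(** * A maximal packing of pair-disjoint diamonds *)

Section Phases2.
Variable n : nat.

Definition pset A (s : state) : {set 'I_n * 'I_n} := [set p : 'I_n * 'I_n | s A (p.1 * n + p.2) != 0].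

Lemma pset_upd A s a j v : a != A -> pset A (update s a j v) = pset A s.
Proof. by move=> na; apply/setP => p; rewrite !inE upd_ne. Qed.

Lemma pset_add A s (x y : 'I_n) v : v != 0 ->
  pset A (update s A (x * n + y) v) = (x, y) |: pset A s.
Proof.
move=> v0; apply/setP => -[a b]; rewrite !inE upd_at /= idx_eq xpair_eqE val_eqE.
by case: ifP.
Qed.

(** The case of [for_rule] in which progress is the growth of one set X, stored in array B. *)
Lemma for_all i b A B (D : finType) (Inv : state -> Prop) (X : state -> {set D})
    (Q : 'I_n -> {set D} -> Prop) (w : 'I_n -> nat) s :
  keeps A Inv -> i \notin A ->
  (forall s a j v, a != B -> X (update s a j v) = X s) -> i != B ->
  (forall x (S S' : {set D}), S \subset S' -> Q x S -> Q x S') ->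
  Inv s ->
  (forall s (x : 'I_n), Inv s -> s i 0 = x ->
     [/\ Inv (den n b s), X s \subset X (den n b s), Q x (X (den n b s)) &
         #|X (den n b s)| <= #|X s| + w x]) ->
  let s' := den n (PFor i b) s in
  [/\ Inv s', X s \subset X s', forall x, Q x (X s') & #|X s'| <= #|X s| + \sum_x w x].
Proof.
move=> K iA XB iB Qm Is step.
apply: (@for_rule n i b Inv (fun t t' => X t \subset X t') (fun x t => Q x (X t))
  (fun t => #|X t|) w s) => //.
- by move=> t1 t2 t3; apply: subset_trans.
- by move=> x t1 t2; apply: Qm.
- by move=> t j; apply: (keep_upd _ _ K).
- by move=> t j; rewrite XB.
- by move=> t j; rewrite XB.
Qed.

Definition regs4 := [:: 20; 21; 22; 23].
Definition l12 := [seq p <- [seq (a, b) | a <- regs4, b <- regs4] | p.1 != p.2].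

Definition mkp (p : nat * nat) := PWrite 10 (Add (Read 5 (V p.1)) (V p.2)) (Const 1).

Definition packing_test := dia4 (V 20) (V 21) (V 22) (V 23) ++
  [seq isz (cell2 10 (V p.1) (V p.2)) | p <- l12].
Definition packing_body := PWhen packing_test
  (PBlock ([seq mkp p | p <- l12] ++ [:: incr 11])).
Definition packing := PFor 20 (PFor 21 (PFor 22 (PFor 23 packing_body))).

Lemma den_marks (g : nat -> 'I_n) l s :
  rows n s -> (forall p, p \in l -> [/\ s p.1 0 = g p.1, s p.2 0 = g p.2, p.1 != 10 & p.2 != 10]) ->
  pset 10 (den n (PBlock [seq mkp p | p <- l]) s) =
  [set p in [seq (g p.1, g p.2) | p <- l]] :|: pset 10 s.
Proof.
elim: l s => [|p l IH] s rs H.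
  by apply/setP => q; rewrite /= in_setU inE in_nil.
have [E1 E2 n1 n2] := H p (mem_head _ _).
rewrite map_cons den_cons den_write /= E1 E2 rs IH; last first.
- move=> q ql; have [F1 F2 m1 m2] := H q (mem_behead (s := p :: l) ql).
  by rewrite !upd_ne // eq_sym.
- by move=> x; rewrite upd_ne.
rewrite pset_add //; apply/setP => q; rewrite 3!in_setU in_set1 !in_set in_cons.
by case: (q == _); rewrite ?orbT.
Qed.

Definition packing_set e cnt (P : {set 'I_n * 'I_n}) :=
  [/\ forall x y, (x, y) \in P -> (y, x) \in P, forall x y, (x, y) \in P -> x != y,
      #|P| <= 12 * cnt &
      forall h, sgraph h -> dfree_on setT h -> 2 * cnt <= #|edits e h :&: P|].

Lemma packing_spec (e : rel 'I_n) k s : sgraph e -> ctx e k s -> pset 10 s = set0 -> s 11 0 = 0 ->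
  let s' := den n packing s in
  packing_set e (s' 11 0) (pset 10 s') /\
  forall a b c d, d4 e a b c d -> ~~ [disjoint mark6 a b c d & pset 10 s'].
Proof.
move=> eg cs P0 c0.
pose I0 t := ctx e k t /\ packing_set e (t 11 0) (pset 10 t).
have K0 : keeps [:: 1; 4; 5; 10; 11] I0.
  move=> t t' E [c1 c2]; split.
    by apply: ctx_keeps c1 => a j aA; apply: E; rewrite -[_ :: _]/([:: 1; 4; 5] ++ [:: 10; 11]) mem_cat aA.
  rewrite (_ : pset 10 t' = pset 10 t) ?E //.
  by apply/setP => p; rewrite !inE E.
have I0s : I0 s.
  split=> //; rewrite P0 c0; split=> //; rewrite ?cards0 // => x y; by rewrite inE.
pose Q (a b c d : 'I_n) (P : {set 'I_n * 'I_n}) := d4 e a b c d -> ~~ [disjoint mark6 a b c d & P].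
have Qm a b c d (P P' : {set 'I_n * 'I_n}) : P \subset P' -> Q a b c d P -> Q a b c d P'.
  move=> PP H /H; apply: contraNN => H'; exact: disjointWr PP H'.
(* The size of the packing is controlled by its counter in [packing_set], so the growth measure gets
   a trivial bound. *)
have bd (X Y : {set 'I_n * 'I_n}) : #|Y| <= #|X| + #|{: 'I_n * 'I_n}|.
  exact: leq_trans (max_card _) (leq_addl _ _).
pose w0 (_ : 'I_n) := #|{: 'I_n * 'I_n}|.
have H4 (a b c : 'I_n) t (d : 'I_n) : ((I0 t /\ t 20 0 = a) /\ t 21 0 = b) /\ t 22 0 = c -> t 23 0 = d ->
  let t' := den n packing_body t in
  [/\ ((I0 t' /\ t' 20 0 = a) /\ t' 21 0 = b) /\ t' 22 0 = c,
      pset 10 t \subset pset 10 t', Q a b c d (pset 10 t') & #|pset 10 t'| <= #|pset 10 t| + w0 d].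
    move=> [[[It ta] tb] tc] td t'; rewrite {}/t' /packing_body den_when.
    have [ct [Ps Pi Pc Ph]] := It.
    (* The vertex held by register r; the registers start at 20. *)
    pose g (r : nat) := nth a [:: a; b; c; d] (r - 20).
    have gE r : r \in regs4 -> t r 0 = g r /\ r != 10.
      by rewrite !inE => /or4P [] /eqP ->.
    have l12r p : p \in l12 -> [/\ p.1 \in regs4, p.2 \in regs4 & p.1 != p.2].
      by rewrite mem_filter => /andP [np /allpairsP [[r1 r2] [? ? E]]]; rewrite E in np *.
    have Eg : [seq g r | r <- regs4] = [:: a; b; c; d] by [].
    have E6 : uniq [:: a; b; c; d] -> [set p in [seq (g p.1, g p.2) | p <- l12]] = mark6 a b c d.
      move=> U; apply/setP => -[x y]; rewrite [LHS]in_set [RHS]in_set -Eg.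
      apply/mapP/and3P => [[[r1 r2] /l12r [r1R r2R nr] [-> ->]]|].
        split; [exact: (map_f g r1R) | exact: (map_f g r2R) |].
        rewrite -[(_, _).1]/(g r1) -[(_, _).2]/(g r2) /g.
        have lt4 r : r \in regs4 -> r - 20 < size [:: a; b; c; d].
          by rewrite !inE; case/or4P => /eqP ->.
        rewrite (nth_uniq _ (lt4 _ r1R) (lt4 _ r2R) U).
        by move: r1R r2R nr; rewrite !inE /=; do 2![case/or4P => /eqP ->].
      case=> /mapP [r1 r1R xE] /mapP [r2 r2R yE] nxy.
      have {}xE : x = g r1 := xE; have {}yE : y = g r2 := yE.
      exists (r1, r2); last by rewrite xE yE.
      rewrite mem_filter; apply/andP; split.
        by apply: contraNneq nxy => /= rr; rewrite xE yE rr eqxx.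
      by apply/allpairsP; exists (r1, r2).
    have Ev : ev t packing_test =
        d4 e a b c d && [disjoint mark6 a b c d & pset 10 t].
      rewrite /ev /packing_test all_cat.
      rewrite -(@ev_dia4 n e k t (V 20) (V 21) (V 22) (V 23) a b c d ct ta tb tc td) -/(ev t (dia4 _ _ _ _)).
      have := @ev_dia4 n e k t (V 20) (V 21) (V 22) (V 23) a b c d ct ta tb tc td.
      case: (ev t _) => // /esym D; rewrite !andTb.
      have uq : uniq [:: a; b; c; d] by case/andP: D.
      rewrite -E6 //; set l := [seq (g _, g _) | p <- l12].
      have -> : [disjoint [set p in l] & pset 10 t] = [disjoint l & pset 10 t].
        by apply: eq_disjoint => q; rewrite in_set.
      rewrite disjoint_has has_map -all_predC all_map; apply: eq_in_all => p pl.
      have [q1 q2 _] := l12r p pl; have [[E1 _] [E2 _]] := (gE _ q1, gE _ q2).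
      rewrite [LHS]isz_ne0 [RHS]inE /= inE negbK /= E1 E2.
      by case: ct => _ -> _.
    rewrite Ev; case: ifP => [/andP [D dis]|N]; last first.
      by split=> // D; move: N; rewrite D /= => ->.
    rewrite den_cat; set t1 := den n (PBlock _) t; rewrite !denE.
    have uq : uniq [:: a; b; c; d] by case/andP: D.
    have F1 r j : r != 10 -> t1 r j = t r j.
      by move=> r10; rewrite /t1 den_frame //=; rewrite !inE (negbTE r10).
    have X1 : pset 10 t1 = mark6 a b c d :|: pset 10 t.
      rewrite /t1 (den_marks (g := g)) ?E6 //; first by case: ct.
      move=> p /l12r [q1 q2 _]; have [[-> ?] [-> ?]] := (gE _ q1, gE _ q2).
      by [].
    set t2 := update t1 11 _ _.
    have X2 : pset 10 t2 = mark6 a b c d :|: pset 10 t by rewrite /t2 pset_upd.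
    have c2 : t2 11 0 = (t 11 0).+1 by rewrite /t2 upd_eq F1 // addn1.
    have F2 r j : r != 10 -> r != 11 -> t2 r j = t r j.
      by move=> r10 r11; rewrite /t2 upd_ne 1?eq_sym // F1.
    split=> //; last first.
    - move=> _; rewrite X2; apply/negP => /pred0P /(_ (a, b)); rewrite /= in_setU.
      rewrite in_set /= !inE !eqxx orbT /=.
      by move: uq; rewrite /= !inE !negb_or => /andP [/and3P [-> _ _] _].
    - by rewrite X2 subsetUr.
    - split; last by rewrite F2. split; last by rewrite F2. split; last by rewrite F2.
      split; first by apply: ctx_keeps ct => r j; rewrite !inE => /or3P [] /eqP ->; rewrite F2.
      rewrite X2 c2; split.
      + move=> x y; rewrite !in_setU => /orP [|/Ps ->]; last by rewrite orbT.
        by rewrite !in_set /= => /and3P [-> -> n1]; rewrite eq_sym n1.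
      + by move=> x y; rewrite in_setU => /orP [|/Pi //]; rewrite in_set /= => /and3P [].
      + apply: leq_trans (leq_card_setU _ _).1 _.
        by rewrite mulnS; apply: leq_add (card_mark6 a b c d) Pc.
      + move=> h hg hf; apply: leq_trans (packing_step eg hg hf D dis).
        by rewrite mulnS addnC leq_add2r; exact: Ph.
have H3 (a b : 'I_n) t (c : 'I_n) : (I0 t /\ t 20 0 = a) /\ t 21 0 = b -> t 22 0 = c ->
  let t' := den n (PFor 23 packing_body) t in
  [/\ (I0 t' /\ t' 20 0 = a) /\ t' 21 0 = b, pset 10 t \subset pset 10 t',
      forall d, Q a b c d (pset 10 t') & #|pset 10 t'| <= #|pset 10 t| + w0 c].
  move=> It tc.
  have [] := @for_all 23 packing_body _ 10 _ _ (pset 10) (Q a b c) w0 t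
    (keeps_reg (i := 22) (x := c) (keeps_reg (i := 21) (x := b) (keeps_reg (i := 20) (x := a) K0))) isT (@pset_upd 10) isT (Qm a b c) (conj It tc) (H4 a b c).
  by move=> [? _] ? ? _; split.
have H2 (a : 'I_n) t (b : 'I_n) : I0 t /\ t 20 0 = a -> t 21 0 = b ->
  let t' := den n (PFor 22 (PFor 23 packing_body)) t in
  [/\ I0 t' /\ t' 20 0 = a, pset 10 t \subset pset 10 t',
      forall c d, Q a b c d (pset 10 t') & #|pset 10 t'| <= #|pset 10 t| + w0 b].
  move=> It tb.
  have [] := @for_all 22 (PFor 23 packing_body) _ 10 _ _ (pset 10) (fun c P => forall d, Q a b c d P) w0 t
    (keeps_reg (i := 21) (x := b) (keeps_reg (i := 20) (x := a) K0)) isT (@pset_upd 10) isT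
    (fun c P P' PP H d => Qm _ _ _ _ _ _ PP (H d)) (conj It tb) (H3 a b).
  by move=> [? _] ? ? _; split.
have H1 t (a : 'I_n) : I0 t -> t 20 0 = a ->
  let t' := den n (PFor 21 (PFor 22 (PFor 23 packing_body))) t in
  [/\ I0 t', pset 10 t \subset pset 10 t',
      forall b c d, Q a b c d (pset 10 t') & #|pset 10 t'| <= #|pset 10 t| + w0 a].
  move=> It ta.
  have [] := @for_all 21 (PFor 22 (PFor 23 packing_body)) _ 10 _ _ (pset 10)
    (fun b P => forall c d, Q a b c d P) w0 t (keeps_reg (i := 20) (x := a) K0) isT (@pset_upd 10) isT
    (fun b P P' PP H c d => Qm _ _ _ _ _ _ PP (H c d)) (conj It ta) (H2 a).
  by move=> [? _] ? ? _; split.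
have [[_ I1] _ Q1 _] := @for_all 20 _ _ 10 _ _ (pset 10)
    (fun a P => forall b c d, Q a b c d P) w0 s K0 isT (@pset_upd 10) isT
    (fun a P P' PP H b c d => Qm _ _ _ _ _ _ PP (H b c d)) I0s H1.
by split=> // a b c d; apply: Q1.
Qed.

End Phases2.

(** * Rounds of forced edits *)

Section Forcing.
Variables (n : nat) (e0 : rel 'I_n) (k0 : nat).
Implicit Types (e : rel 'I_n) (s t : state).

Definition at2 x y := Add (Read 5 x) y.

(** The second write reads the entry that the first has just toggled, so both become equal. Clearing
    cell 19 requests another round. *)
Definition toggle_cmd := PBlock
  [:: PWrite 4 (at2 (V 21) (V 22)) (isz (G (V 21) (V 22)));
      PWrite 4 (at2 (V 22) (V 21)) (G (V 21) (V 22));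
      PWrite 1 (Const 0) (Defs.Sub (V 1) (Const 1));
      PWrite 19 (Const 0) (Const 0)].

Definition forcing_body := PWhen [:: neq (V 21) (V 22)]
  (PBlock [:: flower 21 22;
      PWhen [:: Defs.Sub (V 9) (V 1)]
        (PIf (V 1) toggle_cmd (PWrite 7 (Const 0) (Const 1)))]).

(** All pairs are scanned again after a round with an edit, since an edit changes the diamonds
    through other pairs and lowers the budget. A round without edits leaves cell 19 set and disables
    the later ones. *)
Definition round := PWhen [:: isz (V 19)]
  (PBlock [:: PWrite 19 (Const 0) (Const 1); PFor 21 (PFor 22 forcing_body)]).

(* A forced edit needs k + 1 <= (n - 2) / 2 and decreases k, so that n rounds
   are enough to reach one without edits. *)
Definition forcing := PFor 20 round.

Definition status e k (bad : nat) :=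
  if bad == 0 then yes_rel e0 k0 <-> yes_rel e k else ~ yes_rel e0 k0.

Definition covered e k (u v : 'I_n) := u != v ->
  exists2 F : {set 'I_n}, #|F| <= 2 * k + 2 &
    forall c d, c \notin F -> d \notin F -> ~~ d4 e u v c d.

(** [kst] is the budget at the start of the round. A cleared flag means that an edit has lowered it,
    and the flower behind that edit has enough vertices to show k+1 < n. *)
Definition inv_round kst s := exists e k,
  [/\ sgraph e, ctx e k s, k <= k0, status e k (s 7 0) &
      k <= kst /\ (s 19 0 = 0 -> k < kst /\ k.+1 < n)].

(** By the last clause, graph and budget are unchanged while the flag is set, so pairs checked
    earlier in the round remain covered. *)
Definition forcing_rel s s' :=
  [/\ s 19 0 = 0 -> s' 19 0 = 0, s 7 0 != 0 -> s' 7 0 != 0 &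
      s' 19 0 = 0 \/ forall a j, a \in [:: 1; 4; 5] -> s' a j = s a j].

Definition forcing_post (u v : 'I_n) s :=
  [\/ s 19 0 = 0, s 7 0 != 0 | forall e k, ctx e k s -> covered e k u v].

Lemma inv_round_keeps kst : keeps [:: 1; 4; 5; 7; 19] (inv_round kst).
Proof.
move=> s s' E [e [k [eg cs kk st dr]]]; exists e, k; rewrite !E //; split=> //.
by apply: ctx_keeps cs => a j; rewrite !inE => H; apply: E; rewrite !inE; case/or3P: H => ->; rewrite ?orbT.
Qed.

Lemma forcing_rel_refl s : forcing_rel s s.
Proof. by split=> //; right. Qed.

Lemma forcing_rel_trans s1 s2 s3 : forcing_rel s1 s2 -> forcing_rel s2 s3 -> forcing_rel s1 s3.
Proof.
move=> [a1 b1 c1] [a2 b2 c2]; split; [by move=> /a1 /a2 | by move=> /b1 /b2 |].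
case: c2 => [->|c2]; first by left.
case: c1 => [/a2 ->|c1]; first by left.
by right=> a j aA; rewrite c2 // c1.
Qed.

Lemma forcing_rel_upd s a i v : a \notin [:: 1; 4; 5; 7; 19] -> forcing_rel s (update s a i v).
Proof.
move=> aA; have U b j : b \in [:: 1; 4; 5; 7; 19] -> update s a i v b j = s b j.
  by move=> bA; rewrite upd_ne //; apply: contraNneq aA => ->.
split; rewrite ?U //; right=> b j; rewrite !inE => H; apply: U.
by rewrite !inE; case/or3P: H => ->; rewrite ?orbT.
Qed.

Lemma forcing_post_rel u v s s' : forcing_rel s s' -> forcing_post u v s -> forcing_post u v s'.
Proof.
move=> [a1 b1 c1] [/a1|/b1|H]; [by constructor 1 | by constructor 2 |].
case: c1 => [|E]; [by constructor 1 | constructor 3 => e k cs; apply: H].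
by apply: ctx_keeps cs => a j aA; rewrite E.
Qed.

Lemma toggle_cmd_spec e k s (u v : 'I_n) : sgraph e -> ctx e k.+1 s ->
  s 21 0 = u -> s 22 0 = v -> u != v ->
  let s' := den n toggle_cmd s in
  [/\ ctx (toggle e u v) k s', s' 19 0 = 0 & s' 7 0 = s 7 0].
Proof.
move=> [es ei] cs su sv nuv; have [c1 c2 c3] := cs.
rewrite /toggle_cmd !denE; set s1 := update s 4 _ _.
have E1 : s1 = update s 4 (u * n + v) (~~ e u v).
  rewrite /s1 /= su sv c2 c3; congr update.
  by case: (e u v).
have R1 a j : a != 4 -> s1 a j = s a j by move=> a4; rewrite E1 upd_ne // eq_sym.
set s2 := update s1 4 _ _.
have E2 : s2 = update s1 4 (v * n + u) (~~ e u v).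
  by rewrite /s2 /= !(R1 21) // !(R1 22) // !(R1 5) // su sv !c2 E1 upd_eq.
have R2 a j : a != 4 -> s2 a j = s a j by move=> a4; rewrite E2 upd_ne ?R1 // eq_sym.
rewrite /=; split=> //.
split=> [|x|x y].
- by rewrite upd_ne // upd_eq R2 // c1 subn1.
- by rewrite !upd_ne // R2.
rewrite !upd_ne // E2 upd_at E1 upd_at c3 !idx_eq !val_eqE /toggle.
case: (boolP ((x == v) && (y == u))) => [/andP [/eqP -> /eqP ->]|_].
  by rewrite orbT addbT es.
by rewrite orbF; case: (boolP (_ && _)) => [/andP [/eqP -> /eqP ->]|_]; rewrite ?addbT ?addbF.
Qed.

Lemma forcing_body_spec kst s (u v : 'I_n) : inv_round kst s -> s 21 0 = u -> s 22 0 = v ->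
  let s' := den n forcing_body s in
  [/\ inv_round kst s', s' 21 0 = u, forcing_rel s s' & forcing_post u v s'].
Proof.
move=> Is su sv; have Ev : ev s [:: neq (V 21) (V 22)] = (u != v).
  by rewrite /ev; cbn [all]; rewrite neq_ne0 andbT /= su sv.
rewrite /forcing_body den_when Ev.
have [e [k [eg cs kk st [dr1 dr2]]]] := Is.
case: ifP => nuv; last first.
  split=> //; first exact: forcing_rel_refl.
  by constructor 3 => e' k' _; rewrite /covered nuv.
rewrite den_cons; have := flower_spec eg cs su sv nuv isT isT.
have fr a j : a \notin [:: 8; 9; 23; 24] -> den n (flower 21 22) s a j = s a j.
  move=> aN; apply: den_frame; apply: contraNN aN.
  by rewrite /= !inE; do ![case/orP => [/eqP -> //|]]; move=> /eqP ->.
move: (den n (flower 21 22) s) fr => t fr /= [[uF vF cF _ hF] cov].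
have ct : ctx e k t.
  by apply: ctx_keeps cs => a j; rewrite !inE => /or3P [] /eqP ->; rewrite fr.
have It : inv_round kst t.
  by apply: inv_round_keeps Is => a j; rewrite !inE => H; rewrite fr //;
    move: H; do ![case/orP => [/eqP -> //|]]; move=> /eqP ->.
have Rt : forcing_rel s t.
  split; rewrite ?fr //; right=> a j; rewrite !inE => /or3P [] /eqP ->; by rewrite fr.
have [t1 _ _] := ct.
rewrite den_cons den_nil den_when /= andbT subn_eq0 -ltnNge t1.
case: ifP => [kc|ck]; last first.
  split=> //; first by rewrite fr.
  constructor 3 => e' k' [ck1 _ ck3] _; exists (mset n 8 t).
    by rewrite cF -ck1 t1; move: ck; clear; lia.
  have E x y : e' x y = e x y.
    have [_ _ c3] := ct; have := c3 x y; rewrite ck3.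
    by case: (e' x y); case: (e x y).
  by move=> c d cn dn; rewrite /d4 !E; exact: cov.
have cn : #|mset n 8 t| <= n by rewrite -[X in _ <= X]card_ord max_card.
have tu : t 21 0 = u by rewrite fr.
have tv : t 22 0 = v by rewrite fr.
have t7 : t 7 0 = s 7 0 by rewrite fr.
have sub h : #|edits_in e h (mset n 8 t)| <= #|edits e h| by apply/subset_leq_card/subsetIl.
have toR a b : forcing_rel s a -> forcing_rel a b -> forcing_rel s b by exact: forcing_rel_trans.
rewrite -[den n (PIf _ _ _) t]/(if t 1 0 != 0 then den n toggle_cmd t else update t 7 0 1) t1.
case: k cs kk st dr1 dr2 ct t1 kc => [|k] cs kk st dr1 dr2 ct t1 kc /=.
  (* With budget 0 the pair uv stays unedited, but the flower has a petal and demands an edit. *)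
  have no : ~ yes_rel e0 k0.
    move: st; rewrite /status; case: (s 7 0 == 0) => // -> [h [hg hf]].
    rewrite muln0 leqn0 => /eqP ed.
    have huv : h u v = e u v.
      apply/eqP/negPn/negP => E; have := in_edits e h u v.
      by rewrite eq_sym E; move/eqP: ed; rewrite cards_eq0 => /eqP ->; rewrite inE.
    by have := leq_trans (hF h hg hf huv) (sub h); rewrite ed; move: kc; clear; lia.
  have bad : update t 7 0 1 7 0 != 0 by rewrite upd_eq.
  split.
  - have cu : ctx e 0 (update t 7 0 1).
      by apply: ctx_keeps ct => a j; rewrite !inE => /or3P [] /eqP ->; rewrite upd_ne.
    have su19 : update t 7 0 1 19 0 = s 19 0 by rewrite upd_ne // fr.
    by exists e, 0; rewrite su19 /status (negbTE bad).
  - by rewrite upd_ne.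
  - apply: toR Rt _; split; [by rewrite upd_ne | by rewrite bad | right=> a j].
    by rewrite !inE => /or3P [] /eqP ->; rewrite upd_ne.
  - by constructor 2.
have [c' s19 s7] := toggle_cmd_spec eg ct tu tv nuv.
set t' := den n toggle_cmd t in c' s19 s7 *.
split; last by constructor 1.
- exists (toggle e u v), k; split=> //; first exact: toggle_sgraph; first exact: ltnW.
    rewrite s7 t7; move: st; rewrite /status; case: ifP => // _ ->.
    apply: forced_toggle => // h hg hf huv.
    apply: leq_trans (leq_trans (hF h hg hf huv) (sub h)).
    by rewrite leq_mul2l.
  (* The flower has 2 cnt + 2 <= n vertices and cnt > k+1. *)
  by move: dr1 cn kc; rewrite cF; clear; lia.
- by rewrite /t' den_frame.
- by apply: toR Rt _; split; rewrite ?s19 ?s7 //; left.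
Qed.

Lemma round_spec s e k : sgraph e -> ctx e k s -> k <= k0 -> status e k (s 7 0) -> s 19 0 = 0 ->
  let s' := den n round s in
  exists e' k', [/\ sgraph e', ctx e' k' s', k' <= k0, status e' k' (s' 7 0) &
    if s' 19 0 == 0 then k' < k /\ k'.+1 < n else s' 7 0 != 0 \/ flower_bound e' k'].
Proof.
move=> eg cs kk st s19; rewrite /round den_when /ev /= s19 /= !denE /=.
set s1 := update s 19 0 1.
have I1 : inv_round k s1.
  have c1 : ctx e k s1 by exact: (keep_upd _ _ (@ctx_keeps n e k)).
  have s17 : s1 7 0 = s 7 0 by rewrite /s1 upd_ne.
  have s119 : s1 19 0 = 1 by rewrite /s1 upd_eq.
  by exists e, k; rewrite s17 s119; split=> //; split=> //; rewrite leqnn.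
have K := @inv_round_keeps k.
have Hin t (u : 'I_n) : inv_round k t -> t 21 0 = u ->
  [/\ inv_round k (den n (PFor 22 forcing_body) t), forcing_rel t (den n (PFor 22 forcing_body) t),
      forall v, forcing_post u v (den n (PFor 22 forcing_body) t) & 0 <= 0 + 0].
  move=> It tu.
  have [] := @for_rule n 22 forcing_body (fun t => inv_round k t /\ t 21 0 = u) forcing_rel
    (fun v => forcing_post u v) (fun=> 0) (fun=> 0) t forcing_rel_refl forcing_rel_trans
    (fun v t1 t2 => @forcing_post_rel u v t1 t2) (fun t j => _).
  - by move=> t' j [It' tu']; split; [exact: (keep_upd _ _ K) | rewrite upd_ne].
  - by move=> t' j; apply: forcing_rel_upd.
  - by [].
  - by [].
  - move=> t' v [It' tu'] tv'; have [? ? ? ?] := forcing_body_spec It' tu' tv'.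
    by split.
  by move=> [? _] ? ? _; split.
have [] := @for_rule n 21 (PFor 22 forcing_body) (inv_round k) forcing_rel
    (fun u t => forall v, forcing_post u v t) (fun=> 0) (fun=> 0) s1 forcing_rel_refl forcing_rel_trans
    (fun u t1 t2 R H v => forcing_post_rel R (H v)).
- by move=> t' j It'; exact: (keep_upd _ _ K).
- by move=> t' j; apply: forcing_rel_upd.
- by [].
- by [].
- exact: Hin.
move: (den n _ s1) => s' [e' [k' [eg' cs' kk' st' [dr1 dr2]]]] _ Q _.
exists e', k'; split=> //; case: ifP => [/eqP /dr2 //|s19'].
case: (boolP (s' 7 0 == 0)) => [b0|]; [right | by left].
move=> u v nuv; case: (Q u v) => [s0|b|H]; [by rewrite s0 in s19' | by rewrite b0 in b |].
exact: (H e' k' cs' nuv).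
Qed.

Lemma forcing_spec s : sgraph e0 -> ctx e0 k0 s -> s 7 0 = 0 -> s 19 0 = 0 ->
  let s' := den n forcing s in
  exists e k, [/\ sgraph e, ctx e k s', k <= k0, status e k (s' 7 0) &
    s' 7 0 = 0 -> flower_bound e k].
Proof.
move=> eg cs s7 s19.
(* A flag still clear after j > 0 rounds gives k + j < n, which fails for j = n. So some round has
   found every pair covered; for n = 0 there is no pair. *)
pose Inv j t := exists e k, [/\ sgraph e, ctx e k t, k <= k0, status e k (t 7 0) &
  if t 19 0 == 0 then j = 0 \/ k + j < n else t 7 0 != 0 \/ flower_bound e k].
have I0 : Inv 0 s.
  by exists e0, k0; rewrite s7 s19; split=> //; left.
have IS j t : j < n -> Inv j t -> Inv j.+1 (den n round (update t 20 0 j)).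
  move=> jn [e [k [teg tcs tk tst H]]].
  have cs' : ctx e k (update t 20 0 j) by exact: (keep_upd _ _ (@ctx_keeps n e k)).
  case: (eqVneq (t 19 0) 0) H => [t19 H|t19 H].
    have t7 : status e k (update t 20 0 j 7 0) by rewrite upd_ne.
    have u19 : update t 20 0 j 19 0 = 0 by rewrite upd_ne.
    have [e' [k' [eg' c' kk' st' H']]] := round_spec teg cs' tk t7 u19.
    exists e', k'; split=> //; case: ifP H' => // _ [lt1 lt2]; right.
    by case: H => [->|H]; move: lt1 lt2; [|move: H]; clear; lia.
  rewrite /round den_when /ev /= upd_ne // andbT subn_eq0 -ltnNge ltnS leqn0 (negbTE t19).
  by exists e, k; rewrite !upd_ne // (negbTE t19); split.
have [s' [e [k [teg tcs tk tst H]]] E] := loop_inv (i := 20) I0 IS.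
rewrite -[den n forcing s]/(loop 20 (den n round) n 0 s) E.
have cu : ctx e k (update s' 20 0 n) by exact: (keep_upd _ _ (@ctx_keeps n e k)).
have u7 : update s' 20 0 n 7 0 = s' 7 0 by rewrite upd_ne.
exists e, k; rewrite /= u7; split=> // b0.
rewrite b0 in H; case: (s' 19 0 == 0) H => [H|[]//].
move=> u; have un := ltn_ord u; exfalso; move: H (leq_ltn_trans (leq0n _) un).
by case; clear; lia.
Qed.

End Forcing.

(** * The core Y and its closure W *)

Section Core.
Variables (n : nat) (e : rel 'I_n) (k : nat).
Hypothesis eg : sgraph e.
Let L := 6 * k + 6.
Implicit Types (Y W F : {set 'I_n}) (u v a b x y : 'I_n).

Definition core_inner := PFor 25 (PWhen [:: Read 8 (V 25)]
  (PBlock [:: mark 12 (V 25);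
     trunc 26 14 (dia4 (V 20) (V 21) (V 25) (V 26)) (mark 12 (V 26))])).

Definition core_cmd := PFor 20 (PFor 21 (PWhen [:: cell2 10 (V 20) (V 21)]
  (PBlock [:: flower 20 21; core_inner]))).

Definition core_at Y u v a :=
  a \in Y /\ ([set d | d4 e u v a d] \subset Y \/ L <= #|[set x in Y | d4 e u v a x]|).

Lemma core_at_mono Y Y' u v a : Y \subset Y' -> core_at Y u v a -> core_at Y' u v a.
Proof.
move=> YY [aY H]; split; first exact: (subsetP YY).
case: H => [H|H]; [left; exact: subset_trans H YY | right].
apply: leq_trans H (subset_leq_card _); apply/subsetP => x; rewrite !inE => /andP [xY ->].
by rewrite andbT (subsetP YY).
Qed.

Definition cctx P s := [/\ ctx e k s, s 6 0 = L & pset n 10 s = P].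

Lemma cctx_keeps P : keeps [:: 1; 4; 5; 6; 10] (cctx P).
Proof.
move=> s s' E [cs s6 sP]; split.
- by apply: ctx_keeps cs => a j; rewrite !inE => /or3P [] /eqP ->; rewrite E.
- by rewrite E.
- by rewrite -sP; apply/setP => p; rewrite !inE E.
Qed.

Lemma mset_keeps A (F : {set 'I_n}) : keeps [:: A] (fun s => mset n A s = F).
Proof. by move=> s s' E <-; apply/setP => x; rewrite !inE E ?inE. Qed.

Lemma keeps_and A B I J : keeps A I -> keeps B J -> keeps (A ++ B) (fun s => I s /\ J s).
Proof.
move=> KI KJ s s' E [Is Js]; split; [apply: KI Is | apply: KJ Js] => a j aA;
  by rewrite E // mem_cat aA ?orbT.
Qed.

Lemma core_inner_spec P F s (u v : 'I_n) : cctx P s -> s 20 0 = u -> s 21 0 = v ->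
  mset n 8 s = F ->
  let s' := den n core_inner s in
  [/\ mset n 12 s \subset mset n 12 s', forall a, a \in F -> core_at (mset n 12 s') u v a &
      #|mset n 12 s'| <= #|mset n 12 s| + #|F| * L.+1].
Proof.
move=> cs su sv sF.
pose I t := (((cctx P t /\ t 20 0 = u) /\ t 21 0 = v) /\ mset n 8 t = F).
have K : keeps _ I := keeps_and (keeps_reg (i := 21) (x := v) (keeps_reg (i := 20) (x := u) (@cctx_keeps P)))
  (@mset_keeps 8 F).
have Xu := @mset_upd n 12.
have [] := @for_all n 25 (PWhen [:: Read 8 (V 25)]
  (PBlock [:: mark 12 (V 25); trunc 26 14 (dia4 (V 20) (V 21) (V 25) (V 26)) (mark 12 (V 26))])) _ 12
  _ I (mset n 12) (fun a Y => a \in F -> core_at Y u v a) (fun a => (a \in F) * L.+1) s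
  K isT Xu isT.
- by move=> a Y Y' YY H /H; apply: core_at_mono.
- by [].
- move=> t a It ta; rewrite den_when.
  have [[[[ct t6 tP] tu] tv] tF] := It.
  have -> : ev t [:: Read 8 (V 25)] = (a \in F) by rewrite /ev /= ta andbT -tF inE.
  case: ifP => aF; last by split; rewrite ?addn0.
  rewrite den_cons den_mark den_cons den_nil /= ta.
  set t1 := update t 12 a 1.
  have I1 : I t1 /\ t1 25 0 = a by split; [exact: (keep_upd _ _ K) | rewrite /t1 upd_ne].
  have X1 : mset n 12 t1 = a |: mset n 12 t by rewrite /t1 mset_add.
  have K1 : keeps _ (fun t => I t /\ t 25 0 = a) := keeps_reg K.
  have [] := @trunc_rule n 26 14 (dia4 (V 20) (V 21) (V 25) (V 26)) (mark 12 (V 26))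
    (fun t => I t /\ t 25 0 = a) (fun t t' => mset n 12 t \subset mset n 12 t')
    (fun d t => d \in mset n 12 t) (fun t => #|mset n 12 t|) [set d | d4 e u v a d] L 1 t1.
  + by [].
  + by move=> s1 s2 s3; apply: subset_trans.
  + by move=> d s1 s2 /subsetP; apply.
  + by move=> t' b j bA; apply: (keep_upd _ _ K1); move: bA; rewrite !inE => /orP [] /eqP ->.
  + by move=> t' b j bA; rewrite Xu //; move: bA; rewrite !inE => /orP [] /eqP ->.
  + by move=> t' b j bA; rewrite Xu //; move: bA; rewrite !inE => /orP [] /eqP ->.
  + by [].
  + by [].
  + by move=> t' [[[[[]]]]].
  + exact: I1.
  + move=> t' d [[[[[ct' _ _] tu'] tv'] _] ta'] td'; rewrite inE.
    exact: (@ev_dia4 n e k t' (V 20) (V 21) (V 25) (V 26) u v a d).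
  + move=> t' d It' td' _; rewrite den_mark /= td' mset_add //; split.
    * exact: (keep_upd _ _ K1).
    * exact: subsetUr.
    * by rewrite in_setU1 eqxx.
    * by rewrite addnC cardsU1 leq_add2r leq_b1.
  move: (den n (trunc _ _ _ _) t1) => t2 [I2 _] R2 m2 [S SC [SY full]].
  split=> //.
  + by apply: subset_trans R2; rewrite X1 subsetUr.
  + move=> _; split; first by apply: (subsetP R2); rewrite X1 in_setU1 eqxx.
    case: full => [E|LS]; [left | right].
      by apply/subsetP => d; rewrite -E => /SY.
    apply: leq_trans LS (subset_leq_card _); apply/subsetP => d dS.
    by rewrite [d \in _]in_set SY // andTb; move: (subsetP SC d dS); rewrite [d \in _]in_set.
  + apply: leq_trans m2 _; rewrite muln1 mul1n X1 cardsU1.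
    by rewrite addnS -addSn leq_add2r; case: (_ \notin _); rewrite ?add1n ?add0n ?leqnSn.
move=> _ R3 Q3 m3; split=> //; apply: leq_trans m3 _.
rewrite leq_add2l -big_distrl /= leq_mul2r -sum1_card [X in _ <= X]big_mkcond /=.
by apply: leq_sum => a _; case: (a \in F).
Qed.

Lemma core_spec P s : cctx P s -> flower_bound e k -> (forall x y, (x, y) \in P -> x != y) ->
  mset n 12 s = set0 ->
  let s' := den n core_cmd s in
  #|mset n 12 s'| <= #|P| * ((4 * k + 6) * L.+1) /\
  forall u v, (u, v) \in P -> exists F : {set 'I_n},
     [/\ u \in F, v \in F, F \subset mset n 12 s',
         forall c d, c \notin F -> d \notin F -> ~~ d4 e u v c d &
         forall a, a \in F -> [set d | d4 e u v a d] \subset mset n 12 s' \/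
           L <= #|[set x in mset n 12 s' | d4 e u v a x]|].
Proof.
move=> cs fb Pi Y0; set B := (4 * k + 6) * L.+1.
pose Good u v (Y : {set 'I_n}) := (u, v) \in P -> exists F : {set 'I_n},
     [/\ u \in F, v \in F, forall c d, c \notin F -> d \notin F -> ~~ d4 e u v c d &
         forall a, a \in F -> core_at Y u v a].
have Gm u v (Y Y' : {set 'I_n}) : Y \subset Y' -> Good u v Y -> Good u v Y'.
  move=> YY G0 /G0 [F [h1 h2 h3 h4]]; exists F; split=> // a /h4; exact: core_at_mono.
have Xu := @mset_upd n 12.
have K := @cctx_keeps P.
have H2 t (u v : 'I_n) : cctx P t /\ t 20 0 = u -> t 21 0 = v ->
  let t' := den n (PWhen [:: cell2 10 (V 20) (V 21)] (PBlock [:: flower 20 21; core_inner])) t in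
  [/\ cctx P t' /\ t' 20 0 = u, mset n 12 t \subset mset n 12 t', Good u v (mset n 12 t') &
      #|mset n 12 t'| <= #|mset n 12 t| + ((u, v) \in P) * B].
  move=> [It tu] tv; rewrite den_when; have [ct t6 tP] := It.
  have -> : ev t [:: cell2 10 (V 20) (V 21)] = ((u, v) \in P).
    by rewrite /ev /= tu tv andbT -tP inE /=; case: ct => _ ->.
  case: ifP => uvP; last by split=> //; [rewrite /Good uvP | rewrite addn0].
  rewrite den_cons; have nuv := Pi u v uvP.
  have := flower_spec eg ct tu tv nuv isT isT.
  have X1 : mset n 12 (den n (flower 20 21) t) = mset n 12 t.
    by apply/setP => x; rewrite [LHS]in_set [RHS]in_set den_frame.
  have I1 : cctx P (den n (flower 20 21) t) by apply: (keep_den _ K).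
  have u1 : den n (flower 20 21) t 20 0 = u by rewrite den_frame.
  have v1 : den n (flower 20 21) t 21 0 = v by rewrite den_frame.
  move: (den n (flower 20 21) t) X1 I1 u1 v1 => t1 X1 I1 u1 v1 [[uF vF cF coF _] cov].
  rewrite den_cons den_nil.
  have [R2 Q2 m2] := core_inner_spec I1 u1 v1 erefl.
  have I2 : cctx P (den n core_inner t1) by apply: (keep_den _ K).
  have u2 : den n core_inner t1 20 0 = u by rewrite den_frame.
  move: (den n core_inner t1) R2 Q2 m2 I2 u2 => t2 R2 Q2 m2 I2 u2 /=.
  rewrite X1 in R2 m2; split=> //; first by move=> _; exists (mset n 8 t1).
  apply: leq_trans m2 _; rewrite leq_add2l mul1n leq_mul2r /= cF.
  (* Every petal meets F', which has at most 2k+2 vertices; so there are at most 2k+2 petals and |F|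
     <= 4k+6. *)
  have [F' cF' HF'] := fb u v nuv.
  have := leq_trans (coF F' HF') (leq_trans (subset_leq_card (subsetIr _ _)) cF').
  by clear; lia.
have H1 t (u : 'I_n) : cctx P t -> t 20 0 = u ->
  let t' := den n (PFor 21 (PWhen [:: cell2 10 (V 20) (V 21)] (PBlock [:: flower 20 21; core_inner]))) t in
  [/\ cctx P t', mset n 12 t \subset mset n 12 t', forall v, Good u v (mset n 12 t') &
      #|mset n 12 t'| <= #|mset n 12 t| + \sum_v ((u, v) \in P) * B].
  move=> It tu.
  have [] := @for_all n 21 _ _ 12 _ _ (mset n 12) (Good u) (fun v => ((u, v) \in P) * B) t
    (keeps_reg (i := 20) (x := u) K) isT Xu isT (fun v Y Y' => @Gm u v Y Y') (conj It tu)
    (fun t v It tv => H2 t u v It tv).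
  by move=> [? _] ? ? ?; split.
have [_ _ Q m] := @for_all n 20 _ _ 12 _ _ (mset n 12) (fun u Y => forall v, Good u v Y)
    (fun u => \sum_v ((u, v) \in P) * B) s K isT Xu isT
    (fun u Y Y' YY H v => Gm u v Y Y' YY (H v)) cs H1.
split; last first.
  move=> u v uvP; have [F [uF vF cov HF]] := Q u v uvP; exists F; split=> //.
    by apply/subsetP => a /HF [].
  by move=> a /HF [].
apply: leq_trans m _; rewrite Y0 cards0 add0n.
rewrite pair_bigA /= -big_distrl /= leq_mul2r -sum1_card [X in _ <= X]big_mkcond /=.
by apply/orP; right; apply: leq_sum => -[u v] _ /=; case: ((u, v) \in P).
Qed.

(** The inner loop runs only for the vertices b that the outer one keeps; either all b are kept or L
    of them, whence the disjunction in [core_closed]. *)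
Definition closure_body :=
  trunc 22 14 [:: isz (Read 12 (V 22)); G (V 20) (V 22); G (V 21) (V 22)]
    (PBlock [:: mark 13 (V 22);
       trunc 23 15 [:: isz (Read 12 (V 23)); G (V 21) (V 23); G (V 22) (V 23)]
         (mark 13 (V 23))]).

Definition closure_cmd := PBlock
  [:: PFor 20 (PWhen [:: Read 12 (V 20)] (mark 13 (V 20)));
      PFor 20 (PFor 21 (PWhen [:: Read 12 (V 20); Read 12 (V 21)] closure_body))].

Definition dctx Y s := [/\ ctx e k s, s 6 0 = L & mset n 12 s = Y].

Lemma dctx_keeps Y : keeps [:: 1; 4; 5; 6; 12] (dctx Y).
Proof.
move=> s s' E [cs s6 sP]; split.
- by apply: ctx_keeps cs => a j; rewrite !inE => /or3P [] /eqP ->; rewrite E.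
- by rewrite E.
- by rewrite -sP; apply/setP => p; rewrite !inE E.
Qed.

Definition nb Y x a := cnbr e x a :\: Y.

(** The postcondition of [trunc], as a property of C and Q. *)
Definition part (C : {set 'I_n}) (Q : 'I_n -> Prop) :=
  exists2 S : {set 'I_n}, S \subset C & (forall x, x \in S -> Q x) /\ (S = C \/ L <= #|S|).

Lemma part_imp C (Q Q' : 'I_n -> Prop) : (forall x, Q x -> Q' x) -> part C Q -> part C Q'.
Proof. by move=> H [S SC [SQ full]]; exists S => //; split=> // x /SQ /H. Qed.

Lemma ev_nb Y s (i a b : nat) (x y z : 'I_n) : dctx Y s -> s i 0 = z -> s a 0 = x -> s b 0 = y ->
  ev s [:: isz (Read 12 (V i)); G (V a) (V i); G (V b) (V i)] = (z \in nb Y x y).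
Proof.
move=> [cs _ sY] si sa sb; rewrite /ev; cbn [all].
rewrite isz_ne0 (eval_G (a := V a) (b := V i) (x := x) (y := z) cs) //.
rewrite (eval_G (a := V b) (b := V i) (x := y) (y := z) cs) //.
rewrite !inE -sY inE negbK /= si.
by case: (e x z); case: (e y z); rewrite ?andbF.
Qed.

Definition closed_at Y (W : {set 'I_n}) x a :=
  part (nb Y x a) (fun b => b \in W /\ part (nb Y a b) (fun d => d \in W)).

Lemma closed_at_mono Y (W W' : {set 'I_n}) x a : W \subset W' -> closed_at Y W x a -> closed_at Y W' x a.
Proof.
move=> WW; apply: part_imp => b [bW H]; split; first exact: (subsetP WW).
by apply: part_imp H => d; apply: (subsetP WW).
Qed.

Lemma closure_inner_spec Y s (a b : 'I_n) : dctx Y s -> s 21 0 = a -> s 22 0 = b ->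
  let s' := den n (trunc 23 15 [:: isz (Read 12 (V 23)); G (V 21) (V 23); G (V 22) (V 23)]
         (mark 13 (V 23))) s in
  [/\ mset n 13 s \subset mset n 13 s', part (nb Y a b) (fun d => d \in mset n 13 s') &
      #|mset n 13 s'| <= #|mset n 13 s| + L].
Proof.
move=> cs sa sb.
have K : keeps _ (fun t => (dctx Y t /\ t 21 0 = a) /\ t 22 0 = b) :=
  keeps_reg (keeps_reg (@dctx_keeps Y)).
have Xu := @mset_upd n 13.
have [] := @trunc_rule n 23 15 [:: isz (Read 12 (V 23)); G (V 21) (V 23); G (V 22) (V 23)] (mark 13 (V 23))
    (fun t => (dctx Y t /\ t 21 0 = a) /\ t 22 0 = b) (fun t t' => mset n 13 t \subset mset n 13 t')
    (fun d t => d \in mset n 13 t) (fun t => #|mset n 13 t|) (nb Y a b) L 1 s.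
+ by [].
+ by move=> s1 s2 s3; apply: subset_trans.
+ by move=> d s1 s2 /subsetP; apply.
+ by move=> t' c j cA; apply: (keep_upd _ _ K); move: cA; rewrite !inE => /orP [] /eqP ->.
+ by move=> t' c j cA; rewrite Xu //; move: cA; rewrite !inE => /orP [] /eqP ->.
+ by move=> t' c j cA; rewrite Xu //; move: cA; rewrite !inE => /orP [] /eqP ->.
+ by [].
+ by [].
+ by move=> t' [[[]]].
+ by [].
+ by move=> t' d [[It' ta'] tb'] td'; apply: ev_nb It' td' ta' tb'.
+ move=> t' d It' td' _; rewrite den_mark /= td' mset_add //; split.
  * exact: (keep_upd _ _ K).
  * exact: subsetUr.
  * by rewrite in_setU1 eqxx.
  * by rewrite addnC cardsU1 leq_add2r leq_b1.
by move=> _ R m H; rewrite muln1 in m; split.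
Qed.

Lemma closure_body_spec Y s (x a : 'I_n) : dctx Y s -> s 20 0 = x -> s 21 0 = a ->
  let s' := den n closure_body s in
  [/\ mset n 13 s \subset mset n 13 s', closed_at Y (mset n 13 s') x a &
      #|mset n 13 s'| <= #|mset n 13 s| + L * L.+1].
Proof.
move=> cs sx sa.
pose I t := (dctx Y t /\ t 20 0 = x) /\ t 21 0 = a.
have K : keeps _ I := keeps_reg (keeps_reg (@dctx_keeps Y)).
have Xu := @mset_upd n 13.
have [] := @trunc_rule n 22 14 [:: isz (Read 12 (V 22)); G (V 20) (V 22); G (V 21) (V 22)]
    (PBlock [:: mark 13 (V 22);
       trunc 23 15 [:: isz (Read 12 (V 23)); G (V 21) (V 23); G (V 22) (V 23)]
         (mark 13 (V 23))]) I (fun t t' => mset n 13 t \subset mset n 13 t')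
    (fun b t => b \in mset n 13 t /\ part (nb Y a b) (fun d => d \in mset n 13 t))
    (fun t => #|mset n 13 t|) (nb Y x a) L L.+1 s.
+ by [].
+ by move=> s1 s2 s3; apply: subset_trans.
+ move=> b s1 s2 /subsetP R [bW H]; split; first exact: R.
  by apply: part_imp H.
+ by move=> t' c j cA; apply: (keep_upd _ _ K); move: cA; rewrite !inE => /orP [] /eqP ->.
+ by move=> t' c j cA; rewrite Xu //; move: cA; rewrite !inE => /orP [] /eqP ->.
+ by move=> t' c j cA; rewrite Xu //; move: cA; rewrite !inE => /orP [] /eqP ->.
+ by [].
+ by [].
+ by move=> t' [[[]]].
+ by [].
+ by move=> t' d [[It' tx'] ta'] td'; apply: ev_nb It' td' tx' ta'.
+ move=> t b It tb _; rewrite den_cons den_mark den_cons den_nil /= tb.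
  set t1 := update t 13 b 1.
  have I1 : I t1 by exact: (keep_upd _ _ K).
  have X1 : mset n 13 t1 = b |: mset n 13 t by rewrite /t1 mset_add.
  have [[d1 _] a1] := I1.
  have b1 : t1 22 0 = b by rewrite /t1 upd_ne.
  have [R2 p2 m2] := closure_inner_spec d1 a1 b1.
  have I2 : I (den n (trunc 23 15 [:: isz (Read 12 (V 23)); G (V 21) (V 23); G (V 22) (V 23)]
         (mark 13 (V 23))) t1) by apply: (keep_den _ K).
  move: (den n _ t1) I2 R2 p2 m2 => t2 I2 R2 p2 m2; split=> //.
  * by apply: subset_trans R2; rewrite X1 subsetUr.
  * by split=> //; apply: (subsetP R2); rewrite X1 in_setU1 eqxx.
  * apply: leq_trans m2 _; rewrite X1 cardsU1.
    by rewrite addnS -addSn leq_add2r; case: (_ \notin _); rewrite ?add1n ?add0n ?leqnSn.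
by move=> _ R m H; split.
Qed.

Lemma closure_spec Y s : dctx Y s -> mset n 13 s = set0 ->
  let s' := den n closure_cmd s in
  [/\ Y \subset mset n 13 s', core_closed e k Y (mset n 13 s') &
      #|mset n 13 s'| <= #|Y| + #|Y| * (#|Y| * (L * L.+1))].
Proof.
move=> cs W0; rewrite /closure_cmd den_cons.
have K := @dctx_keeps Y; have Xu := @mset_upd n 13.
have sumY B : \sum_(x : 'I_n) (x \in Y) * B = #|Y| * B.
  by rewrite -big_distrl /= -sum1_card [X in _ = X * _]big_mkcond.
have [] := @for_all n 20 (PWhen [:: Read 12 (V 20)] (mark 13 (V 20))) _ 13 _ _ (mset n 13)
  (fun x W => x \in Y -> x \in W) (fun x => (x \in Y) * 1) s K isT Xu isT.
- by move=> x W W' /subsetP WW H /H /WW.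
- by [].
- move=> t x It tx; rewrite den_when; have [_ _ tY] := It.
  have -> : ev t [:: Read 12 (V 20)] = (x \in Y) by rewrite /ev /= tx andbT -tY inE.
  case: ifP => xY; last by split; rewrite ?addn0.
  rewrite den_mark /= tx mset_add //; split.
  + exact: (keep_upd _ _ K).
  + exact: subsetUr.
  + by rewrite in_setU1 eqxx.
  + by rewrite addnC cardsU1 leq_add2r leq_b1.
move: (den n (PFor 20 _) s) => s1 I1 _ Y1 m1; rewrite W0 cards0 add0n sumY muln1 in m1.
pose B := L * L.+1.
have H2 t (x a : 'I_n) : dctx Y t /\ t 20 0 = x -> t 21 0 = a ->
  let t' := den n (PWhen [:: Read 12 (V 20); Read 12 (V 21)] closure_body) t in
  [/\ dctx Y t' /\ t' 20 0 = x, mset n 13 t \subset mset n 13 t',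
      x \in Y -> a \in Y -> closed_at Y (mset n 13 t') x a &
      #|mset n 13 t'| <= #|mset n 13 t| + (a \in Y) * ((x \in Y) * B)].
  move=> [It tx] ta; rewrite den_when; have [ct t6 tY] := It.
  have -> : ev t [:: Read 12 (V 20); Read 12 (V 21)] = (x \in Y) && (a \in Y).
    by rewrite /ev /= tx ta andbT -tY !inE.
  case: ifP => [/andP [xY aY]|N]; last first.
    by split=> //; [move=> xY aY; rewrite xY aY in N | exact: leq_addr].
  have [R p m] := closure_body_spec It tx ta.
  rewrite xY aY !mul1n; split=> //.
  by split; [apply: (keep_den _ K) | rewrite den_frame].
have H1 t (x : 'I_n) : dctx Y t -> t 20 0 = x ->
  let t' := den n (PFor 21 (PWhen [:: Read 12 (V 20); Read 12 (V 21)] closure_body)) t in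
  [/\ dctx Y t', mset n 13 t \subset mset n 13 t',
      forall a, x \in Y -> a \in Y -> closed_at Y (mset n 13 t') x a &
      #|mset n 13 t'| <= #|mset n 13 t| + (x \in Y) * (#|Y| * B)].
  move=> It tx.
  have [] := @for_all n 21 _ _ 13 _ _ (mset n 13)
    (fun a W => x \in Y -> a \in Y -> closed_at Y W x a) (fun a => (a \in Y) * ((x \in Y) * B)) t
    (keeps_reg (i := 20) (x := x) K) isT Xu isT
    (fun a W W' WW H xY aY => closed_at_mono WW (H xY aY)) (conj It tx)
    (fun t a It ta => H2 t x a It ta).
  by rewrite sumY mulnCA; move=> [? _] ? ? ?; split.
have [_ R2 Q2 m2] := @for_all n 20 _ _ 13 _ _ (mset n 13)
    (fun x W => forall a, x \in Y -> a \in Y -> closed_at Y W x a)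
    (fun x => (x \in Y) * (#|Y| * B)) s1 K isT Xu isT
    (fun x W W' WW H a xY aY => closed_at_mono WW (H a xY aY)) I1 H1.
rewrite den_cons den_nil; move: (den n _ s1) R2 Q2 m2 => s2 R2 Q2 m2.
have rich_of x y : part (nb Y x y) (fun d => d \in mset n 13 s2) -> rich e k Y (mset n 13 s2) x y.
  case=> S SC [SW [E|LS]]; [left | right].
    by apply/subsetP => d; rewrite -/(nb Y x y) -E => /SW.
  apply: leq_trans LS (subset_leq_card _); apply/subsetP => d dS.
  by rewrite in_setI (SW d dS) andbT; apply: (subsetP SC).
split.
- by apply/subsetP => x xY; apply: (subsetP R2); apply: Y1.
- split=> [x a xY aY|x a b xY aY bN].
    by apply: rich_of; apply: part_imp (Q2 x a xY aY) => b [].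
  have [S SC [SQ [E|LS]]] := Q2 x a xY aY; [right | left].
    by rewrite -/(nb Y x a) -E in bN; have [_ /rich_of] := SQ b bN.
  apply: leq_trans LS (subset_leq_card _); apply/subsetP => d dS.
  by have [dW _] := SQ d dS; rewrite in_setI dW andbT; apply: (subsetP SC).
- by apply: leq_trans m2 _; rewrite sumY; apply: leq_add.
Qed.

End Core.

(** * Reading the input and writing the output *)

Definition fill_rows A w := PFor 20
  (PWrite A (Add (V 20) (Const 1)) (Add (Read A (V 20)) (V w))).

Lemma fill_rows_spec n A w s : A \notin [:: w; 20] -> w != 20 -> s A 0 = 0 ->
  forall x, x <= n -> den n (fill_rows A w) s A x = x * s w 0.
Proof.
rewrite !inE negb_or => /andP [Aw A20] w20 A0.
pose Inv j (t : state) := t w 0 = s w 0 /\ forall x, x <= j -> t A x = x * s w 0.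
have I0 : Inv 0 s by split=> // x; rewrite leqn0 => /eqP ->.
have IS j t : j < n -> Inv j t ->
  Inv j.+1 (den n (PWrite A (Add (V 20) (Const 1)) (Add (Read A (V 20)) (V w))) (update t 20 0 j)).
  move=> jn [tw tA]; rewrite den_write /= upd_eq.
  split; first by rewrite upd_ne // upd_ne // eq_sym.
  have n20 : 20 != A by rewrite eq_sym.
  have nw : 20 != w by rewrite eq_sym.
  move=> x xj; rewrite upd_at addn1 !(upd_ne _ _ _ _ n20) (upd_ne _ _ _ _ nw).
  case: eqP => [->|/eqP ne]; first by rewrite tA // tw mulSn addnC.
  by apply: tA; rewrite -ltnS ltn_neqAle ne.
have [s' [_ H] E] := loop_inv (i := 20) I0 IS.
move=> x xn; rewrite -[den n _ s]/(loop 20 _ n 0 s) E upd_ne 1?eq_sym //.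
exact: H.
Qed.

Definition copy_cmd := PFor 20 (PFor 21 (PWrite 4 (at2 (V 20) (V 21)) (Read 2 (at2 (V 20) (V 21))))).

Lemma copy_spec n s : rows n s ->
  forall x y : 'I_n, den n copy_cmd s 4 (x * n + y) = s 2 (x * n + y).
Proof.
move=> rs.
pose I t := rows n t /\ forall j, t 2 j = s 2 j.
have K : keeps [:: 5; 2] I.
  by move=> t t' E [t5 t2]; split=> [x|j]; rewrite E.
pose R (t t' : state) := forall j, t 4 j = s 2 j -> t' 4 j = s 2 j.
have Hin t (x : 'I_n) : I t -> t 20 0 = x ->
  let t' := den n (PFor 21 (PWrite 4 (at2 (V 20) (V 21)) (Read 2 (at2 (V 20) (V 21))))) t in
  [/\ I t', R t t', forall y : 'I_n, t' 4 (x * n + y) = s 2 (x * n + y) & 0 <= 0 + 0].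
  move=> It tx.
  have [] := @for_rule n 21 (PWrite 4 (at2 (V 20) (V 21)) (Read 2 (at2 (V 20) (V 21))))
    (fun t => I t /\ t 20 0 = x) R (fun y t => t 4 (x * n + y) = s 2 (x * n + y)) (fun=> 0) (fun=> 0) t.
  - by move=> t1 j.
  - by move=> t1 t2 t3 H1 H2 j /H1 /H2.
  - by move=> y t1 t2; apply.
  - by move=> t' j [It' tx']; split; [exact: (keep_upd _ _ K) | rewrite upd_ne].
  - by move=> t' j i; rewrite upd_ne.
  - by [].
  - by [].
  - move=> t' y [[r' e'] tx'] ty'; rewrite den_write /= tx' ty' r' e'; split; last by [].
    + by split; [exact: (keep_upd _ _ K) | rewrite upd_ne].
    + by move=> j; rewrite upd_at; case: eqP => [->|].
    + by rewrite upd_eq.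
  by move=> [? _] ? ? _; split.
have [] := @for_rule n 20 (PFor 21 (PWrite 4 (at2 (V 20) (V 21)) (Read 2 (at2 (V 20) (V 21)))))
    I R (fun x t => forall y : 'I_n, t 4 (x * n + y) = s 2 (x * n + y)) (fun=> 0) (fun=> 0) s.
- by move=> t1 j.
- by move=> t1 t2 t3 H1 H2 j /H1 /H2.
- by move=> x t1 t2 H1 H2 y; apply: H1.
- by move=> t' j; apply: (keep_upd _ _ K).
- by move=> t' j i; rewrite upd_ne.
- by [].
- by [].
- exact: Hin.
by move=> _ _ H _ x y; apply: H.
Qed.

Definition index_cmd := PFor 20 (PWhen [:: Read 13 (V 20)]
  (PBlock [:: PWrite 16 (V 17) (V 20); incr 17])).

Lemma index_spec n s : s 17 0 = 0 ->
  let s' := den n index_cmd s in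
  exists l : seq 'I_n, [/\ uniq l, l =i mset n 13 s, s' 17 0 = size l &
    forall i, i < size l -> s' 16 i = nth 0 (map val l) i].
Proof.
move=> s17; set W := mset n 13 s.
pose Inv j (t : state) := mset n 13 t = W /\ exists l : seq 'I_n,
  [/\ uniq l, forall x, (x \in l) = (x \in W) && (x < j), t 17 0 = size l &
    forall i, i < size l -> t 16 i = nth 0 (map val l) i].
have I0 : Inv 0 s.
  split=> //; exists [::]; split=> // x; by rewrite ltn0 andbF.
have IS j t : j < n -> Inv j t ->
  Inv j.+1 (den n (PWhen [:: Read 13 (V 20)]
    (PBlock [:: PWrite 16 (V 17) (V 20); incr 17])) (update t 20 0 j)).
  move=> jn [tW [l [lu lW l17 l16]]]; pose x := Ordinal jn.
  have lt (y : 'I_n) : (y < j.+1) = (y == x) || (y < j).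
    by rewrite ltnS leq_eqVlt -val_eqE.
  rewrite den_when /ev /= upd_eq upd_ne // andbT.
  have -> : (t 13 j != 0) = (x \in W) by rewrite -tW inE.
  case: ifP => xW; last first.
    split; first by rewrite mset_upd.
    exists l; rewrite upd_ne //; split=> //.
    move=> y; rewrite lW lt; case: (eqVneq y x) => [->|//]; by rewrite xW.
  rewrite !denE /=.
  split; first by rewrite !mset_upd.
  have xl : x \notin l by rewrite lW ltnn andbF.
  exists (rcons l x); split.
  - by rewrite rcons_uniq xl.
  - move=> y; rewrite mem_rcons inE lW lt; case: (eqVneq y x) => [->|//].
    by rewrite xW.
  - by rewrite upd_eq !upd_ne // l17 size_rcons addn1.
  - move=> i; rewrite size_rcons ltnS => il; rewrite upd_ne // upd_at upd_eq !upd_ne // l17.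
    rewrite map_rcons nth_rcons size_map; case: eqP => [->|/eqP ne]; first by rewrite ltnn.
    have il' : i < size l by rewrite ltn_neqAle ne.
    by rewrite il' l16.
have [s' [_ [l [lu lW l17 l16]]] E] := loop_inv (i := 20) I0 IS.
rewrite /index_cmd -[den n _ s]/(loop 20 _ n 0 s) E.
exists l; split; rewrite ?upd_ne //.
  by move=> x; rewrite lW ltn_ord andbT.
Qed.

(** Loops always run over n values; the guards restrict them to the m vertices of the list.
    Overwriting the input matrix is safe because the current graph is in array 4. *)
Definition emit_body := PWhen [:: Defs.Sub (V 17) (V 20); Defs.Sub (V 17) (V 21)]
  (PWrite 2 (Add (Read 18 (V 20)) (V 21)) (G (Read 16 (V 20)) (Read 16 (V 21)))).

Definition good_cmd := PBlock [:: index_cmd; fill_rows 18 17; PWrite 0 (Const 0) (V 17);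
  PFor 20 (PFor 21 emit_body)].

Lemma good_spec n e k s : ctx e k s -> s 17 0 = 0 -> s 18 0 = 0 ->
  let s' := den n good_cmd s in
  exists m, exists f : 'I_m -> 'I_n,
    [/\ injective f, f @: setT = mset n 13 s, s' 0 0 = m, s' 1 0 = k &
        forall x y : 'I_m, s' 2 (x * m + y) = e (f x) (f y)].
Proof.
move=> cs s17 s18; rewrite /good_cmd den_cons.
have [l [lu lW l17 l16]] := index_spec n s17.
have c1 : ctx e k (den n index_cmd s) by apply: (keep_den _ (@ctx_keeps n e k)).
have z18 : den n index_cmd s 18 0 = 0 by rewrite den_frame.
move: (den n index_cmd s) l17 l16 c1 z18 => s1 l17 l16 c1 z18.
set m := size l in l17 l16.
have mn : m <= n by have := max_card (mem l); rewrite (card_uniqP lu) card_ord.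
rewrite den_cons.
have R18 := @fill_rows_spec n 18 17 s1 isT isT z18.
have c2 : ctx e k (den n (fill_rows 18 17) s1) by apply: (keep_den _ (@ctx_keeps n e k)).
have E17 : den n (fill_rows 18 17) s1 17 0 = m by rewrite den_frame.
have E16 i : i < m -> den n (fill_rows 18 17) s1 16 i = nth 0 (map val l) i.
  by move=> im; rewrite den_frame // l16.
rewrite l17 in R18.
move: (den n (fill_rows 18 17) s1) R18 c2 E17 E16 => s2 R18 c2 E17 E16 {s1 l17 l16 c1 z18}.
rewrite !denE /= E17; set s3 := update s2 0 0 m.
have [f fl] : exists f : 'I_m -> 'I_n, forall i : 'I_m, f i = nth 0 (map val l) i :> nat.
  exists (tnth (in_tuple l)) => i; rewrite (nth_map (tnth_default (in_tuple l) i)) //.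
have fi : injective f.
  move=> i j fij; apply: val_inj; apply/eqP.
  have lu' : uniq (map val l) by rewrite (map_inj_uniq val_inj).
  have := @nth_uniq _ 0 (map val l) i j; rewrite size_map => /(_ (ltn_ord i) (ltn_ord j) lu') <-.
  by rewrite -!fl fij.
have fW : f @: setT = mset n 13 s.
  apply/eqP; rewrite eqEcard; apply/andP; split.
    apply/subsetP => _ /imsetP [i _ ->]; rewrite -lW.
    by rewrite -(mem_map val_inj) [val _](fl i) mem_nth // size_map.
  by rewrite (card_imset _ fi) cardsT card_ord -(eq_card lW) (card_uniqP lu).
pose I t := [/\ ctx e k t, t 17 0 = m, forall x, x <= n -> t 18 x = x * m &
  forall i : 'I_m, t 16 i = f i].
have K : keeps [:: 1; 4; 5; 17; 18; 16] I.
  move=> t t' E [h1 h2 h3 h4]; split.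
  - by apply: ctx_keeps h1 => a j; rewrite !inE => /or3P [] /eqP ->; rewrite E.
  - by rewrite E.
  - by move=> x xn; rewrite E // h3.
  - by move=> i; rewrite E // h4.
have I3 : I s3.
  apply: (keep_upd _ _ K) => //; split=> // i; by rewrite E16 // fl.
pose ok (t : state) (x y : 'I_m) := t 2 (x * m + y) = e (f x) (f y) :> nat.
pose R (t t' : state) := forall x y, ok t x y -> ok t' x y.
have Rr t : R t t by [].
have Rt t1 t2 t3 : R t1 t2 -> R t2 t3 -> R t1 t3 by move=> H1 H2 x y /H1 /H2.
have Ru a t j v : a != 2 -> R t (update t a j v) by move=> a2 x y; rewrite /ok upd_ne.
(* Loop variables range below n, output indices below m; Q is vacuous for values from m on. *)
pose Q (x y : 'I_n) t := forall x' y' : 'I_m, x' = x :> nat -> y' = y :> nat -> ok t x' y'.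
have QR x y t t' : R t t' -> Q x y t -> Q x y t' by move=> H HQ x' y' xx yy; apply/H/HQ.
have Hin t (x : 'I_n) : I t -> t 20 0 = x ->
  let t' := den n (PFor 21 emit_body) t in [/\ I t', R t t', forall y, Q x y t' & 0 <= 0 + 0].
  move=> It tx.
  have [] := @for_rule n 21 emit_body (fun t => I t /\ t 20 0 = x) R (Q x) (fun=> 0) (fun=> 0) t
    Rr Rt (QR x).
  - by move=> t' j [It' tx']; split; [exact: (keep_upd _ _ K) | rewrite upd_ne].
  - by move=> t' j; apply: Ru.
  - by [].
  - by [].
  - move=> t' y [It' tx'] ty'; have [h1 h2 h3 h4] := It'.
    rewrite /emit_body den_when.
    have -> : ev t' [:: Defs.Sub (V 17) (V 20); Defs.Sub (V 17) (V 21)] = (x < m) && (y < m).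
      by rewrite /ev /= h2 tx' ty' andbT !subn_eq0 -!ltnNge.
    case: ifP => [/andP [xm ym]|N]; last first.
      by split=> // x' y' xx yy; move: N; rewrite -xx -yy !ltn_ord.
    rewrite den_write.
    have -> : eval t' (G (Read 16 (V 20)) (Read 16 (V 21))) = e (f (Ordinal xm)) (f (Ordinal ym)).
      apply: (eval_G h1); first by rewrite /= tx' -(h4 (Ordinal xm)).
      by rewrite /= ty' -(h4 (Ordinal ym)).
    have -> : eval t' (Add (Read 18 (V 20)) (V 21)) = x * m + y by rewrite /= tx' ty' h3 // ltnW.
    have okU (x' y' : 'I_m) : x' = x :> nat -> y' = y :> nat ->
        ok (update t' 2 (x * m + y) (e (f (Ordinal xm)) (f (Ordinal ym)))) x' y'.
      move=> xx yy; rewrite /ok xx yy upd_eq.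
      have -> : x' = Ordinal xm by apply: val_inj.
      by have -> : y' = Ordinal ym by apply: val_inj.
    split; [by split; [exact: (keep_upd _ _ K) | rewrite upd_ne] | | exact: okU | by []].
    move=> x' y' H; case: (boolP (x' * m + y' == x * m + y)) => [|ne].
      by rewrite -[y : nat]/(Ordinal ym : nat) idx_eq => /andP [/eqP xx /eqP yy]; apply: okU => //; rewrite yy.
    by rewrite /ok upd_at (negbTE ne).
  by move=> [? _] ? ? _; split.
have [] := @for_rule n 20 (PFor 21 emit_body) I R (fun x t => forall y, Q x y t) (fun=> 0) (fun=> 0) s3
    Rr Rt (fun x t t' H HQ y => QR x y t t' H (HQ y)).
- by move=> t' j; apply: (keep_upd _ _ K).
- by move=> t' j; apply: Ru.
- by [].
- by [].
- exact: Hin.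
move=> [[k4 _ _] _ _ _] _ Q4 _; exists m, f; split=> //.
- by rewrite den_frame // /s3 upd_eq.
- move=> x y.
  exact: (Q4 (widen_ord mn x) (widen_ord mn y) x y).
Qed.

Definition fill A (l : seq nat) := PBlock
  [seq PWrite A (Const p.1) (Const p.2) | p <- zip (iota 0 (size l)) l].

Lemma fill_spec n A l s i : i < size l -> den n (fill A l) s A i = nth 0 l i.
Proof.
rewrite /fill; have H b t : (forall j, j < b ->
    den n (PBlock [seq PWrite A (Const p.1) (Const p.2) | p <- zip (iota b (size l)) l]) t A j = t A j)
  /\ (forall j, j < size l ->
    den n (PBlock [seq PWrite A (Const p.1) (Const p.2) | p <- zip (iota b (size l)) l]) t A (b + j) = nth 0 l j).
  elim: l b t => [|v l IH] b t //.
  rewrite /= den_cons den_write /=.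
  have [H1 H2] := IH b.+1 (update t A b v); split=> [j jb|[|j] jl].
  - by rewrite H1 ?ltnS 1?ltnW // upd_at ltn_eqF.
  - by rewrite addn0 H1 // upd_eq.
  - by rewrite -addSnnS H2.
by move=> il; have [_ /(_ i il)] := H 0 s; rewrite add0n.
Qed.

Definition diamond_bits := [:: 0; 0; 1; 1; 0; 0; 1; 1; 1; 1; 0; 1; 1; 1; 1; 0].

Definition bad_cmd := PSeq (PWrite 0 (Const 0) (Const 4))
  (PSeq (PWrite 1 (Const 0) (Const 0)) (fill 2 diamond_bits)).

Lemma diamond_simple : simple_graph diamond.
Proof. exact: subsetDl. Qed.

(** The fixed no-instance that is output once the answer is known to be no; its vertices are the 4
    in [kernel_bound]. *)
Definition diamond_instance := Instance diamond_simple 0.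

Lemma diamond_no : ~ yes_instance diamond_instance.
Proof.
case=> Ep [Em [_ _]]; rewrite /= leqn0 cards_eq0 setU_eq0 => /andP [/eqP -> /eqP ->].
by rewrite setU0 setD0; apply; exists id; split.
Qed.

Lemma den_seq n p q s : den n (PSeq p q) s = den n q (den n p s).
Proof. by []. Qed.

Lemma bad_spec n s : output (den n bad_cmd s) diamond_instance.
Proof.
rewrite /bad_cmd 2!den_seq; set t := den n _ (den n _ s).
have t0 : t 0 0 = 4 by [].
have t1 : t 1 0 = 0 by [].
have H := @fill_spec n 2 diamond_bits t.
have F a j : a != 2 -> den n (fill 2 diamond_bits) t a j = t a j.
  by move=> a2; apply: den_frame; rewrite /= !inE (negbTE a2).
move: (den n (fill 2 diamond_bits) t) H F => t' H F; split; [by rewrite F | by rewrite F |].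
move=> x y; rewrite adj_diamond.
by case: (ord4_cases x) => ->; case: (ord4_cases y) => ->;
  rewrite !inord4_eq // !inordK // H.
Qed.

(** * The whole program and the size bound *)

Definition six_k := Add (Add (Add (V 1) (V 1)) (Add (V 1) (V 1))) (Add (V 1) (V 1)).

Definition init_cmd := PSeq (fill_rows 5 3) copy_cmd.

Definition limit_cmd := PWrite 6 (Const 0) (Add six_k (Const 6)).

Definition check_cmd := PWhen [:: Defs.Sub (V 11) (V 1)] (PWrite 7 (Const 0) (Const 1)).

Definition output_cmd := PIf (V 7) bad_cmd good_cmd.

Definition main := PSeq init_cmd (PSeq forcing (PSeq limit_cmd (PSeq packing
  (PSeq check_cmd (PSeq core_cmd (PSeq closure_cmd output_cmd)))))).

Lemma main_wf : wf main.
Proof. by vm_compute. Qed.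

(** At most 12k ordered pairs are packed; each has a flower of at most 4k+6 vertices, each
    contributing itself and L others, so L+1 = 6k+7. *)
Definition core_bound k := 12 * k * ((4 * k + 6) * (6 * k + 7)).
(** Y itself, and for each of |Y|^2 pairs at most L vertices b with L further ones each. *)
Definition kernel_bound k :=
  4 + (core_bound k + core_bound k * (core_bound k * ((6 * k + 6) * (6 * k + 7)))).

(** Forced edits lower the budget; the bound for the remaining one is passed on to the original
    one. *)
Lemma kernel_bound_mono k k' : k <= k' -> kernel_bound k <= kernel_bound k'.
Proof.
move=> kk; have C : core_bound k <= core_bound k'.
  by rewrite /core_bound; do ![apply: leq_mul => // | apply: leq_add => //]; rewrite leq_mul2l kk orbT.
rewrite /kernel_bound leq_add2l; apply: leq_add => //.
by do 2!apply: leq_mul => //; apply: leq_mul; rewrite leq_add2r leq_mul2l kk orbT.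
Qed.

Lemma kernel_bound_big_O : big_O kernel_bound (fun k => k ^ 8).
Proof.
have cube x y z k : x * (y * z) * k ^ 3 = x * k * ((y * k) * (z * k)).
  by rewrite !expnS expn0 muln1 mulnACA (mulnACA y).
suff [C HC] : exists C, forall k, 0 < k -> kernel_bound k <= C * k ^ 8 by exists C, 1.
have [a Ha] : exists a, forall k, 0 < k -> core_bound k <= a * k ^ 3.
  (* For k > 0, 4k+6 <= 10k and 6k+7 <= 13k. *)
  exists (12 * (10 * 13)) => k k0.
  have -> : 12 * (10 * 13) * k ^ 3 = 12 * k * ((10 * k) * (13 * k)).
    exact: cube.
  by apply: leq_mul => //; apply: leq_mul; move: k0; clear; lia.
have [b Hb] : exists b, forall k, 0 < k -> (6 * k + 6) * (6 * k + 7) <= b * k ^ 2.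
  exists (12 * 13) => k k0.
  have -> : 12 * 13 * k ^ 2 = (12 * k) * (13 * k).
    by rewrite -mulnn mulnACA.
  by apply: leq_mul; move: k0; clear; lia.
exists (4 + (a + a * (a * b))) => k k0.
have X m : m <= 8 -> k ^ m <= k ^ 8 by move=> m8; apply: leq_pexp2l.
rewrite /kernel_bound [leqRHS]mulnDl [X in _ <= _ + X]mulnDl; apply: leq_add.
  by rewrite leq_pmulr // expn_gt0 k0.
apply: leq_add.
  by apply: leq_trans (Ha k k0) _; rewrite leq_mul2l X ?orbT.
apply: leq_trans (leq_mul (Ha k k0) (leq_mul (Ha k k0) (Hb k k0))) _.
have -> : a * k ^ 3 * (a * k ^ 3 * (b * k ^ 2)) = a * (a * b) * (k ^ 3 * (k ^ 3 * k ^ 2)).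
  by rewrite (mulnACA a (k ^ 3) b) mulnACA.
by rewrite -!expnD.
Qed.

Lemma den_if n c p q s : den n (PIf c p q) s = if eval s c != 0 then den n p s else den n q s.
Proof. by []. Qed.

Lemma input_adj (I : instance) (x y : 'I_(nverts I)) :
  input I 2 (x * nverts I + y) = adj (edges I) x y.
Proof.
rewrite /=; congr nat_of_bool; apply/existsP/idP => [[x' /existsP [y' /andP []]]|xy].
  by rewrite idx_eq => /andP [/eqP /val_inj -> /eqP ->].
by exists x; apply/existsP; exists y; rewrite eqxx.
Qed.

(** * Correctness of a run *)

Section Run.
Variable I : instance.
Let n := nverts I.
Let e0 : rel 'I_n := adj (edges I).
Let k0 := budget I.

Let s0 := update (input I) 3 0 n.
Let s1 := den n init_cmd s0.
Let s2 := den n forcing s1.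
Let s3 := den n limit_cmd s2.
Let s4 := den n packing s3.
Let s5 := den n check_cmd s4.
Let s6 := den n core_cmd s5.
Let s7 := den n closure_cmd s6.
Let s8 := den n output_cmd s7.

Let e0g : sgraph e0. Proof. exact: adj_sgraph (edges_simple I). Qed.

Lemma init_ctx : ctx e0 k0 s1.
Proof.
have s03 : s0 3 0 = n by rewrite /s0 upd_eq.
have R1 : rows n (den n (fill_rows 5 3) s0).
  move=> x; rewrite (@fill_rows_spec n 5 3 s0 isT isT) ?s03 //; exact: ltnW.
split.
- by rewrite /s1 den_frame // /s0 upd_ne.
- move=> x; rewrite /s1 /init_cmd den_seq den_frame //; exact: R1.
- move=> x y; rewrite /s1 /init_cmd den_seq copy_spec // den_frame // /s0 upd_ne //.
  exact: input_adj.
Qed.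

Lemma init_zero a j : a \in [:: 6; 7; 10; 11; 12; 13; 17; 18; 19] -> s1 a j = 0.
Proof.
move=> aA; rewrite /s1 den_frame; last by move: aA; rewrite !inE; do ![case/orP => [/eqP -> //|]]; move=> /eqP ->.
by move: aA; rewrite /s0 !inE; do ![case/orP => [/eqP -> //|]]; move=> /eqP ->.
Qed.

Lemma main_den : den n main s0 = s8.
Proof. by rewrite /main 7!den_seq. Qed.

Lemma mset_zero A s : (forall j, s A j = 0) -> mset n A s = set0.
Proof. by move=> H; apply/setP => x; rewrite !inE H. Qed.

Lemma pset_zero A s : (forall j, s A j = 0) -> pset n A s = set0.
Proof. by move=> H; apply/setP => x; rewrite !inE H. Qed.

Lemma bad_output : ~ yes_instance I -> s7 7 0 != 0 ->
  exists J, [/\ output s8 J, budget J <= k0, nverts J <= kernel_bound k0 &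
    yes_instance I <-> yes_instance J].
Proof.
move=> no b; exists diamond_instance; split; [|exact: leq0n|exact: leq_addr|].
  have E : eval s7 (V 7) != 0 by exact: b.
  rewrite /s8 /output_cmd den_if E; exact: bad_spec.
by split=> [/no|/diamond_no].
Qed.

Lemma run_output : exists J, [/\ output s8 J, budget J <= k0, nverts J <= kernel_bound k0 &
    yes_instance I <-> yes_instance J].
Proof.
have z a j : a \in [:: 6; 7; 10; 11; 12; 13; 17; 18; 19] -> s1 a j = 0 by exact: init_zero.
have [e [k [eg c2 kk st fb]]] := @forcing_spec n e0 k0 s1 e0g init_ctx (z 7 0 isT) (z 19 0 isT).
rewrite -/s2 in c2 st fb.
have c3 : ctx e k s3 by apply: (keep_den _ (@ctx_keeps n e k)).
have L3 : s3 6 0 = 6 * k + 6.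
  have [k2 _ _] := c2; rewrite /s3 den_write upd_eq /= k2; clear; lia.
have P0 : pset n 10 s3 = set0.
  by apply: pset_zero => j; rewrite /s3 den_frame // /s2 den_frame // z.
have N0 : s3 11 0 = 0 by rewrite /s3 den_frame // /s2 den_frame // z.
have [] := packing_spec eg c3 P0 N0; rewrite -/s4 => -[Ps Pi Pc Ph] Pd.
have c4 : ctx e k s4 by apply: (keep_den _ (@ctx_keeps n e k)).
have b4 : s4 7 0 = s2 7 0 by rewrite /s4 den_frame // /s3 den_frame.
have b7 : s7 7 0 = s5 7 0 by rewrite /s7 den_frame // /s6 den_frame.
have b5 : s5 7 0 = if k < s4 11 0 then 1 else s2 7 0.
  have [k4 _ _] := c4; rewrite /s5 /check_cmd den_when /ev /= k4 andbT subn_eq0 -ltnNge.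
  by case: ifP => _ //; rewrite den_write upd_eq.
(* The flag is raised by a forced edit without budget or by more than k packed diamonds; either
   excludes a solution. *)
case: (boolP (s7 7 0 == 0)) => [/eqP b0|bad]; last first.
  apply: bad_output => // /yes_instanceE Y0; move: bad; rewrite b7 b5.
  move: st; rewrite /status; case: eqP => [->|//] st2.
  case: ifP => // kc _; case/st2: Y0 => h [hg hf hk].
  have := leq_trans (Ph h hg hf) (leq_trans (subset_leq_card (subsetIl _ _)) hk).
  by rewrite leq_mul2l /= leqNgt kc.
rewrite b7 b5 in b0; case: ltnP b0 => // cnt b2.
rewrite b2 /status eqxx in st; move/(_ b2): fb => fb.
have F5 a j : a != 7 -> s5 a j = s4 a j by move=> a7; rewrite /s5 den_frame //= !inE.
have c5 : ctx e k s5 by apply: (keep_den _ (@ctx_keeps n e k)).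
have L5 : s5 6 0 = 6 * k + 6 by rewrite F5 // /s4 den_frame.
have P5 : pset n 10 s5 = pset n 10 s4 by apply/setP => p; rewrite !inE F5.
have Y5 : mset n 12 s5 = set0.
  by apply: mset_zero => j; rewrite F5 // /s4 den_frame // /s3 den_frame // /s2 den_frame // z.
have [Yc Yf] := core_spec eg (And3 c5 L5 P5) fb Pi Y5; rewrite -/s6 in Yc Yf.
have dc := core_of_packing eg Ps Pd Yf.
have c6 : ctx e k s6 by apply: (keep_den _ (@ctx_keeps n e k)).
have L6 : s6 6 0 = 6 * k + 6 by rewrite /s6 den_frame.
have W6 : mset n 13 s6 = set0.
  apply: mset_zero => j; rewrite /s6 den_frame // F5 // /s4 den_frame // /s3 den_frame //.
  by rewrite /s2 den_frame // z.
have [YW cl Wc] := closure_spec (And3 c6 L6 erefl) W6; rewrite -/s7 in YW cl Wc.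
have c7 : ctx e k s7 by apply: (keep_den _ (@ctx_keeps n e k)).
have z7 a : a \in [:: 17; 18] -> s7 a 0 = 0.
  rewrite !inE => /orP [] /eqP ->; rewrite /s7 den_frame // /s6 den_frame // F5 // /s4 den_frame //;
  by rewrite /s3 den_frame // /s2 den_frame // z.
have [m [f [fi fW m0 m1 m2]]] := good_spec c7 (z7 17 isT) (z7 18 isT).
have E8 : s8 = den n good_cmd s7.
  have E : eval s7 (V 7) = 0 by rewrite -[LHS]/(s7 7 0) b7 b5 ltnNge cnt.
  by rewrite /s8 /output_cmd den_if E.
rewrite -E8 in m0 m1 m2.
pose e' : rel 'I_m := fun x y => e (f x) (f y).
have [es ei] := eg.
have e's : symmetric e' by move=> x y; rewrite /e' es.
have e'i : irreflexive e' by move=> x; rewrite /e' ei.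
have adjE x y : adj (edge_set e') x y = e' x y by rewrite /adj mem_edge_set.
exists (Instance (edge_set_simple e'i) k); split=> //=.
- by split=> //= x y; rewrite m2 adjE.
- apply: leq_trans (kernel_bound_mono kk).
  have -> : m = #|mset n 13 s7| by rewrite -fW (card_imset _ fi) cardsT card_ord.
  have L7 : (6 * k + 6).+1 = 6 * k + 7 by rewrite -addnS.
  rewrite L7 in Wc Yc; apply: leq_trans Wc _.
  have Yb : #|mset n 12 s6| <= core_bound k.
    apply: leq_trans Yc _; apply: leq_mul (leqnn _).
    by apply: leq_trans Pc _; rewrite leq_mul2l cnt.
  apply: leq_trans (leq_addl 4 _); apply: (leq_add Yb).
  by apply: (leq_mul Yb); apply: leq_mul Yb (leqnn _).
have fe : forall x y, e' x y = e (f x) (f y) by [].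
have Ye' : yes_rel (adj (edge_set e')) k <-> yes_rel e' k.
  have E h : edits (adj (edge_set e')) h = edits e' h.
    by apply/setP => -[x y]; rewrite !in_edits adjE.
  by split=> -[h [h1 h2 h3]]; exists h; split=> //; [rewrite -E | rewrite E].
rewrite yes_instanceE (yes_instanceE (Instance _ _)) /= Ye' st.
split; first exact: (yes_induced fi fe).
move/(sol_induced fi eg fe); rewrite fW.
exact: (core_kernel eg fb dc YW cl).
Qed.

End Run.

(** The loop bound is set outside [main], because [wf] forbids writing array 3. *)
Definition kernel_program := Seq (Write 3 (Const 0) (V 0)) (compile main).

(** [poly_time] uses one constant as factor and as exponent, hence the sum; 4 is the cost of the
    initial write. *)
Lemma kernel_run I : exists J, [/\
  exists t s, [/\ exec kernel_program (input I) t s, output s J &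
     t <= (coef main + depth main + 4) * instance_size I ^ (coef main + depth main + 4)],
  budget J <= budget I, nverts J <= kernel_bound (budget I) &
  yes_instance I <-> yes_instance J].
Proof.
have [J [out bJ nJ yJ]] := run_output I; exists J; split=> //.
rewrite -main_den in out; set n := nverts I in out.
have s3 : update (input I) 3 0 n 3 0 = n by rewrite upd_eq.
have [t tt ex] := exec_compile main_wf s3.
exists (4 + t), (den n main (update (input I) 3 0 n)); split=> //.
  exact: exec_seq (exec_write (input I) 3 (Const 0) (V 0)) ex.
move: (leq_trans tt (tm_poly n main)); move: (coef main) (depth main) => K d {ex out tt} tK.
have nS : n.+1 <= instance_size I.
  rewrite /instance_size -/n addnS ltnS; apply: leq_trans (leq_addr _ _).
  by case: (n) => // m; rewrite leq_pmulr.
have S1 : 0 < instance_size I by apply: leq_trans nS.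
move: (instance_size I) nS S1 => S nS S1.
have H0 m : n.+1 ^ m <= S ^ m by elim: m => // m IH; rewrite !expnS leq_mul.
have H : t <= K * S ^ d by apply: leq_trans tK _; rewrite leq_mul2l H0 orbT.
have H1 : S ^ d <= S ^ (K + d + 4) by apply: leq_pexp2l => //; lia.
have H2 : 0 < S ^ (K + d + 4) by rewrite expn_gt0 S1.
have H3 : K * S ^ d <= K * S ^ (K + d + 4) by rewrite leq_mul2l H1 orbT.
by rewrite !mulnDl; lia.
Qed.

Theorem theorem1 :
  exists (F : instance -> instance) (f : nat -> nat),
    [/\ poly_time F,
        big_O f (fun k => k ^ 8) &
        forall I : instance,
          [/\ budget (F I) <= budget I,
              nverts (F I) <= f (budget I) &
              yes_instance I <-> yes_instance (F I)]].
Proof.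
(* One program serves all instances; choice only turns its outputs into a function. *)
have [F HF] := functional_choice _ kernel_run.
exists F, kernel_bound; split; last by move=> I; case: (HF I).
  by exists kernel_program, (coef main + depth main + 4) => I; case: (HF I).
exact: kernel_bound_big_O.
Qed.
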